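(* Let $G$ be a metric graph and let $p\ge 1$ be an integer. Then: (i) $d_p=\sqrt{\gamma_p}$ is a distance on $G$. (ii) For each non-constant completely monotonic function $\psi:[0,+\infty)\to\mathbb R$, the function $C_Y(x_1,x_2):=\psi\big(d_p^2(x_1,x_2)\big)$ is strictly positive definite on $G\times G$. (iii) If in addition $p\ge 2$ and $|\psi^{(p-1)}(0^+)|<+\infty$, then the (centred Gaussian) process $Y$ on $G$ having covariance function $C_Y$ belongs to $C_1^{p-1}(G)$.
   Context: A metric graph $G=(V,E)$ has a finite vertex set $V$ ($n:=|V|$) and a finite edge set $E$; each edge $e\in E$ has a length $0<l_e<\infty$ and is identified with the segment $[0,l_e]$, edges being glued at their common endpoints (the vertices). $G$ also denotes the set of all points on the edges (vertices included). Throughout, $G$ is connected and simple (no self-loops, no multiple edges). For $f:G\to\mathbb R$, $f_e$ is the restriction of $f$ to $e$ viewed as a function on $[0,l_e]$, and $\int_G f(x)\,dx:=\sum_{e\in E}\int_0^{l_e}f_e(x)\,dx$. For $x\in G$, $E_x$ is the set of edges stemming from $x$ (if $x$ is interior to an edge $(v_1,v_2)$, these are the two segments from $x$ to $v_1$ and from $x$ to $v_2$). The exiting directional derivative is $\partial_e f(x):=\lim_{h\to0^+}\frac{f(x+he)-f(x)}{h}$, where $x+he$ is the point of $e$ at shortest-path distance $h$ from $x$; $\partial_e^i$ is the $i$-th order exiting derivative. For integers $0\le j\le m\le\infty$, a function $f:G\to\mathbb R$ is in $C_j^m(G)$ if $f|_e\in C^m(e)$ for each $e\in E$ and at each $v\in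 V$ the Kirchhoff conditions of every order $i\in\{0,\dots,j\}$ hold: if $i$ is even, all exiting derivatives $\partial_e^i f(v)$, $e\in E_v$, are equal; if $i$ is odd, $\sum_{e\in E_v}\partial_e^i f(v)=0$. A stochastic process on $G$ is in $C_j^m(G)$ if its restriction to each edge has continuous $m$-order derivative in the mean-square sense and at each vertex the same Kirchhoff conditions (with mean-square exiting derivatives) hold almost surely for every $i\in\{0,\dots,j\}$. Write $C^m:=C^m_m$. For an integer $p\ge1$ let $m:=p-1$. Let $\mathcal F$ be the set of $f:G\to\mathbb R$ such that $f\in C^m(G)$; for each $e\in E$, $f_e^{(m)}$ is absolutely continuous and $f_e^{(m+1)}\in L^2([0,l_e])$; and $\sum_{v\in V}f(v)=0$. Put $\langle f,g\rangle_{\mathcal F}:=\int_G f^{(p)}(x)g^{(p)}(x)\,dx$. Then $\mathcal H=(\mathcal F,\langle\cdot,\cdot\rangle_{\mathcal F})$ is a reproducing kernel Hilbert space (RKHS). $Z=Z_m$ is the (unique in law) zero-mean Gaussian process on $G$ whose RKHS is $\mathcal H$ (i.e. its covariance function is the reproducing kernel of $\mathcal H$), $\gamma_p(x_1,x_2):=\mathrm{Var}(Z(x_1)-Z(x_2))$ is its variogram and $d_p:=\sqrt{\gamma_p}$. A completely monotonic function $\psi:[0,+\infty)\to\mathbb R$ is continuous on $[0,\infty)$ (so $\psi(0)<\infty$), infinitely differentiable on $(0,\infty)$, with $(-1)^k\psi^{(k)}\ge0$ on $(0,\infty)$ for all $k\ge0$. *)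

(* Defs.v *)
From HB Require Import structures.
From mathcomp Require Import all_boot all_order all_algebra.
From mathcomp Require Import all_classical all_reals all_analysis.

Set Implicit Arguments.
Unset Strict Implicit.
Unset Printing Implicit Defensive.

Import Order.TTheory GRing.Theory Num.Theory.
Import numFieldNormedType.Exports.
Local Open Scope classical_set_scope.
Local Open Scope ring_scope.

(* Each edge carries an arbitrary orientation [src] -> [tgt], which only serves
   to identify it with the segment [0, len e]. *)
Record metricGraph (R : realType) := MetricGraph {
  vertex : finType;
  edge : finType;
  src : edge -> vertex;
  tgt : edge -> vertex;
  len : edge -> R;
  len_gt0 : forall e, 0 < len e;
  no_loop : forall e, src e != tgt e;
  no_multi_edge : forall e1 e2,
    [set src e1; tgt e1]%SET = [set src e2; tgt e2]%SET -> e1 = e2;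
  graph_connected : forall u v : vertex,
    fingraph.connect
      (fun x y => [exists e, ((src e == x) && (tgt e == y))
                          || ((src e == y) && (tgt e == x))]) u v
}.

Section Points.
Context {R : realType}.

(* The gluing of the segments at their endpoints: a point is either a vertex or
   a pair (e, t) with t in the open segment ]0, len e[. *)
Definition gpoint (G : metricGraph R) : Type :=
  (vertex G + {x : edge G * R | 0 < x.2 < len x.1})%type.

Variable G : metricGraph R.

(* The identification of [0, len e] with the edge e; arguments outside of
   [0, len e] are clamped to an endpoint and never matter. *)
Definition edge_pt (e : edge G) (t : R) : gpoint G :=
  match insub (e, t) with
  | Some x => inr x
  | None => inl (if t <= 0 then src e else tgt e)
  end.

Definition restr (T : Type) (f : gpoint G -> T) (e : edge G) : R -> T :=
  fun t => f (edge_pt e t).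

Definition incident (v : vertex G) (e : edge G) : bool :=
  (src e == v) || (tgt e == v).

(* For e incident to v, [exit_pt v e h] is the point v + he. *)
Definition exit_pt (v : vertex G) (e : edge G) (h : R) : gpoint G :=
  edge_pt e (if src e == v then h else len e - h).

(* The Kirchhoff condition of order i at v, on given values of the i-th order
   exiting derivatives along the edges stemming from v. *)
Definition kirchhoff (v : vertex G) (i : nat) (a : edge G -> R) : Prop :=
  if odd i then \sum_(e | incident v e) a e = 0
  else forall e1 e2, incident v e1 -> incident v e2 -> a e1 = a e2.

End Points.

Section FunctionsOnSegment.
Context {R : realType}.
Implicit Types (l : R) (f : R -> R).

Definition seg_quot l f (t : R) : set_system R :=
  (fun s => (f s - f t) / (s - t)) @ within `[0, l] t^'.

(* The derivative on [0, l], one-sided at 0 and at l. *)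
Definition seg_deriv l f : R -> R := fun t => lim (seg_quot l f t).

Definition seg_derivn l (i : nat) f : R -> R := iter i (seg_deriv l) f.

Definition seg_C l (m : nat) f : Prop :=
  (forall i, (i < m)%N -> forall t, t \in `[0, l] ->
     cvg (seg_quot l (seg_derivn l i f) t)) /\
  {within `[0, l], continuous (seg_derivn l m f)}.

Definition seg_abs_continuous l f : Prop :=
  forall eps : R, 0 < eps -> exists2 delta : R, 0 < delta &
    forall (n : nat) (a b : 'I_n -> R),
      (forall i, 0 <= a i /\ a i <= b i /\ b i <= l) ->
      trivIset setT (fun i => `]a i, b i[%classic) ->
      \sum_i (b i - a i) < delta ->
      \sum_i `|f (b i) - f (a i)| < eps.

Definition seg_L2 l f : Prop :=
  (f \_ `[0, l]) \in Lfun (@lebesgue_measure R) 2%:E.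

End FunctionsOnSegment.

Section FunctionsOnGraph.
Context {R : realType} (G : metricGraph R).
Implicit Types (f g : gpoint G -> R).

Definition exit_derivn (v : vertex G) (e : edge G) (i : nat) f : R :=
  seg_derivn (len e) i (fun h => f (exit_pt v e h)) 0.

(* The class $C_j^m(G)$ for finite j <= m. *)
Definition C_graph (j m : nat) f : Prop :=
  (forall e, seg_C (len e) m (restr f e)) /\
  (forall (v : vertex G) (i : nat), (i <= j)%N ->
     kirchhoff v i (fun e => exit_derivn v e i f)).

Definition edge_derivn (e : edge G) (i : nat) f : R -> R :=
  seg_derivn (len e) i (restr f e).

Definition spaceF (p : nat) : set (gpoint G -> R) :=
  [set f | [/\ C_graph p.-1 p.-1 f,
    forall e, seg_abs_continuous (len e) (edge_derivn e p.-1 f),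
    forall e, seg_L2 (len e) (edge_derivn e p f) &
    \sum_(v : vertex G) f (inl v) = 0]].

Definition innerF (p : nat) f g : R :=
  \sum_(e : edge G) \int[lebesgue_measure]_(t in `[0, len e])
    (edge_derivn e p f t * edge_derivn e p g t).

End FunctionsOnGraph.

Definition reproducing_kernel (R : realType) (T : Type) (F : set (T -> R))
    (inner : (T -> R) -> (T -> R) -> R) (K : T -> T -> R) : Prop :=
  (forall x, F (K x)) /\ (forall f x, F f -> inner f (K x) = f x).

Section Processes.
Context {R : realType} {d : measure_display} {Omega : measurableType d}.
Variable P : probability Omega R.

(* [normal_prob m 0] is not the Dirac mass at m in the library, so degenerate
   Gaussian variables are treated apart. *)
Definition gaussian_rv (X : Omega -> R) : Prop :=
  (exists m s : R, s != 0 /\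
     forall A, measurable A -> P (X @^-1` A) = normal_prob m s A) \/
  (exists c : R, {ae P, forall w, X w = c}).

Definition gaussian_process (T : Type) (X : T -> {RV P >-> R}) : Prop :=
  forall (n : nat) (x : 'I_n -> T) (a : 'I_n -> R),
    gaussian_rv (fun w => \sum_i a i * X (x i) w).

Definition centred_gaussian_process (T : Type) (X : T -> {RV P >-> R})
    (C : T -> T -> R) : Prop :=
  [/\ gaussian_process X,
      forall x, ('E_P[X x] = 0)%E &
      forall x y, covariance P (X x) (X y) = (C x y)%:E].

Definition variogram (T : Type) (X : T -> {RV P >-> R}) (x y : T) : R :=
  fine ('V_P[(X x \- X y)%R])%E.

Definition ms_cvg (X : R -> Omega -> R) (F : set_system R) (U : Omega -> R) :
    Prop :=
  ('E_P[fun w => ((X s w - U w) ^+ 2)%R])%E @[s --> F] --> 0%E.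

(* D 0, ..., D i are the successive mean-square derivatives of X on [0, l],
   up to order i. *)
Definition ms_derivs (l : R) (i : nat) (X : R -> {RV P >-> R})
    (D : nat -> R -> {RV P >-> R}) : Prop :=
  (forall t, D 0%N t = X t) /\
  (forall k, (k < i)%N -> forall t, t \in `[0, l] ->
     ms_cvg (fun s w => (D k s w - D k t w) / (s - t))
       (within `[0, l] t^') (D k.+1 t)).

Definition ms_C (l : R) (m : nat) (X : R -> {RV P >-> R}) : Prop :=
  exists2 D, ms_derivs l m X D &
    forall t, t \in `[0, l] -> ms_cvg (D m) (within `[0, l] (nbhs t)) (D m t).

Context (G : metricGraph R).

(* U is (a version of) the i-th order exiting derivative of Y at v along e. *)
Definition ms_exit_derivn (v : vertex G) (e : edge G) (i : nat)
    (Y : gpoint G -> {RV P >-> R}) (U : {RV P >-> R}) : Prop :=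
  exists2 D, ms_derivs (len e) i (fun h => Y (exit_pt v e h)) D & D i 0 = U.

Definition ms_C_graph (j m : nat) (Y : gpoint G -> {RV P >-> R}) : Prop :=
  (forall e, ms_C (len e) m (restr Y e)) /\
  (forall (v : vertex G) (i : nat), (i <= j)%N ->
     exists2 U : edge G -> {RV P >-> R},
       forall e, incident v e -> ms_exit_derivn v e i Y (U e) &
       {ae P, forall w, kirchhoff v i (fun e => U e w)}).

End Processes.

Definition is_distance (R : realType) (T : Type) (dist : T -> T -> R) : Prop :=
  [/\ forall x y, 0 <= dist x y,
      forall x y, dist x y = 0 <-> x = y,
      forall x y, dist x y = dist y x &
      forall x y z, dist x z <= dist x y + dist y z].

Definition strictly_positive_definite (R : realType) (T : Type)
    (C : T -> T -> R) : Prop :=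
  (forall x y, C x y = C y x) /\
  (forall (n : nat) (x : 'I_n -> T) (a : 'I_n -> R),
     injective x -> (exists i, a i != 0) ->
     0 < \sum_i \sum_j a i * a j * C (x i) (x j)).

(* Only the restriction of psi to [0, +oo[ is relevant. *)
Definition completely_monotonic (R : realType) (psi : R -> R) : Prop :=
  [/\ {within `[0, +oo[, continuous psi},
      forall (k : nat) (t : R), 0 < t -> derivable (derive1n k psi) t 1 &
      forall (k : nat) (t : R), 0 < t -> 0 <= (-1) ^+ k * derive1n k psi t].

Definition nonconstant_on_nonneg (R : realType) (psi : R -> R) : Prop :=
  exists s t : R, [/\ 0 <= s, 0 <= t & psi s != psi t].

(* Main.v *)
Require Import Defs.
From HB Require Import structures.
From mathcomp Require Import all_boot all_order all_algebra.
From mathcomp Require Import all_classical all_reals all_analysis.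
From mathcomp Require Import measurable_realfun.
From mathcomp Require Import ring lra zify.

(* Let m = p - 1, and view Z(x) as a vector of L^2, so that <Z(x), Z(y)> = K(x, y).

   (i) d_p(x, y) = |Z(x) - Z(y)|. If it vanishes, then K_x = K_y, hence all the
   functions of F take the same value at x and y; but F contains piecewise
   polynomials, flat at the vertices, that separate any two points.

   (ii) On a finite set, psi is approximated by mixtures of the functions
   t |-> x^t with x in [0, 1] (Bernstein's theorem, obtained from the Hausdorff
   moment problem), which do not concentrate at x = 1 when psi is not constant.
   For 0 < x < 1 the kernel x^(d_p^2) is strictly positive definite, because it is
   up to a diagonal scaling the entrywise exponential of a Gram matrix.

   (iii) If f is a combination of the K_x and S the same combination of the Z(x),
   the Cauchy-Schwarz inequality gives |f^(m)(t) - f^(m)(s)| <= |t - s|^(1/2) |S|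
   along each edge, and the lower order derivatives are bounded by C |S| too; by
   duality, t |-> Z(t) is a C^m path in L^2. The mixed derivatives of
   psi(|Z(s) - Z(t)|^2) are sums of terms psi^(r)(|Z(s) - Z(t)|^2) w(s, t), where w
   vanishes on the diagonal to a high enough order to compensate the blow-up of
   psi^(r) for r > m, as y^j psi^(m+j)(y) -> 0 when y -> 0+; hence Y is
   mean-square C^m. Finally, psi(g) = psi(0) + psi'(0+) g + o(g) reduces the first
   Kirchhoff condition for Y to the one for Z, which holds by duality because it
   holds for every K_x. *)

Set Implicit Arguments.
Unset Strict Implicit.
Unset Printing Implicit Defensive.

Import Order.TTheory GRing.Theory Num.Theory.
Import numFieldNormedType.Exports.
Local Open Scope classical_set_scope.
Local Open Scope ring_scope.

(** The mixed derivatives of the kernel of $Y$ that are needed involve derivatives of $\psi$ up to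
    order $2m$, while only the first $m$ are controlled at 0. The kernel is therefore regularized
    into $\psi(\cdot+e)$, differentiated for $e>0$, and $e\to0^+$ is taken afterwards. What has to
    survive this limit is a mean value property: a path in a complete space is differentiable as
    soon as the mixed second differences of its Gram kernel are, up to an arbitrary error, areas of
    rectangles times values of a continuous function.

    The Hölder bound for $Z$ integrates $f^{(p)}$, whereas membership in $F$ gives the absolute
    continuity of $f^{(m)}$ in its epsilon-delta form. Lebesgue's fundamental theorem bridges the
    gap, through total variation, Stieltjes measures, Radon-Nikodym and Lebesgue differentiation.

    Strict positivity concerns finitely many points, where finite mixtures approximate $\psi$
    instead of a representing measure. Since strict inequalities do not pass to limits, positivity
    is made quantitative on an interval $[0,\rho]$ of bases, $\rho<1$, that carries a mass bounded
    below. *)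

Section AbsoluteContinuity.
Context {R : realType}.
Implicit Types (l : R) (f : R -> R).

(** Refined families of intervals are naturally indexed by dependent pairs, whence an arbitrary
    finite index type and a disjointness expressed through the order of the endpoints. *)
Lemma seg_abs_continuous_fin l f (eps : R) :
  seg_abs_continuous l f -> 0 < eps ->
  exists2 delta : R, 0 < delta &
    forall (I : finType) (a b : I -> R),
      (forall i, 0 <= a i /\ a i <= b i /\ b i <= l) ->
      (forall i j, i != j -> b i <= a j \/ b j <= a i) ->
      \sum_i (b i - a i) < delta -> \sum_i `|f (b i) - f (a i)| < eps.
Proof.
move=> fac /fac[delta delta0 H]; exists delta => // I a b ab abd sab.
have E (g : I -> R) : \sum_(i < #|I|) g (enum_val i) = \sum_i g i.
  by rewrite [RHS](reindex (@enum_val I predT)) //; exact: onW_bij (enum_val_bij _).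
have := H #|I| (a \o enum_val) (b \o enum_val) (fun i => ab _).
rewrite (E (fun i => b i - a i)) (E (fun i => `|f (b i) - f (a i)|)).
apply => // i j _ _ /= [x []]; rewrite /= !in_itv/= => /andP[ax xb] /andP[ax' xb'].
apply/eqP/negPn/negP => ij.
have /abd[] : enum_val i != enum_val j by apply: contra ij => /eqP/enum_val_inj->.
  by move=> /(lt_le_trans xb)/lt_trans/(_ ax'); rewrite ltxx.
by move=> /(lt_le_trans xb')/lt_trans/(_ ax); rewrite ltxx.
Qed.

Section partition.
Variables (a b : R) (s : seq R).
Hypothesis abs : itv_partition a b s.

Let sa : sorted <%R (a :: s). Proof. by case: abs. Qed.

Lemma itv_partition_nth_lt i j : (i < j)%N -> (j <= size s)%N ->
  nth b (a :: s) i < nth b (a :: s) j.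
Proof.
move=> ij js; apply: (sorted_ltn_nth lt_trans b sa) => //; rewrite inE/= ltnS//.
by rewrite (leq_trans _ js)// ltnW.
Qed.

Lemma itv_partition_nth_ge i : (i <= size s)%N -> a <= nth b (a :: s) i.
Proof.
by case: i => [//|i] /(@itv_partition_nth_lt 0%N i.+1 erefl); exact: ltW.
Qed.

Lemma itv_partition_nth_le i : (i <= size s)%N -> nth b (a :: s) i <= b.
Proof.
have bE : nth b (a :: s) (size s) = b.
  by case: abs => _ /eqP; rewrite (last_nth b).
rewrite leq_eqVlt => /predU1P[->|]; first by rewrite bE.
by move=> /itv_partition_nth_lt => /(_ (leqnn _)); rewrite bE => /ltW.
Qed.

End partition.

(* Refine every interval of the family by a partition that almost realizes the
   total variation: this yields a larger family of the same total length. *)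
Lemma total_variation_abs_continuous l f (eps : R) :
  seg_abs_continuous l f -> bounded_variation 0 l f -> 0 < eps ->
  exists2 delta : R, 0 < delta &
    forall (I : finType) (a b : I -> R),
      (forall i, 0 <= a i /\ a i <= b i /\ b i <= l) ->
      (forall i j, i != j -> b i <= a j \/ b j <= a i) ->
      \sum_i (b i - a i) < delta ->
      \sum_i fine (total_variation (a i) (b i) f) <= eps.
Proof.
move=> fac bvf eps0; have [delta delta0 H] := seg_abs_continuous_fin fac eps0.
exists delta => // I a b ab abd sab; apply/ler_addgt0Pr => e e0.
(* Each of the [#|I|] partitions misses its total variation by at most [eta], so the whole loss is
   at most [e]; the successor covers an empty [I]. *)
pose eta := e / (#|I|.+1%:R).
have eta0 : 0 < eta by rewrite divr_gt0.
have /choice[s /all_and2[ps Hs]] : forall i, exists s, itv_partition (a i) (b i) s /\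
    fine (total_variation (a i) (b i) f) <= variation (a i) (b i) f s + eta.
  move=> i; have [a0 [aib bl]] := ab i.
  have fin : total_variation (a i) (b i) f \is a fin_num.
    apply/bounded_variationP => //; apply: (bounded_variationr a0) => //.
    by apply: (bounded_variationl _ bl bvf); exact: le_trans aib.
  have [_ [_ [s ps <-] <-] lt] := ub_ereal_sup_adherent eta0 fin.
  exists s; split=> //; rewrite -lee_fin fineK// EFinD -leeBlDr//.
  exact: ltW.
pose al (p : {i : I & 'I_(size (s i))}) :=
  nth (b (tag p)) (a (tag p) :: s (tag p)) (tagged p).
pose be (p : {i : I & 'I_(size (s i))}) :=
  nth (b (tag p)) (a (tag p) :: s (tag p)) (tagged p).+1.
have varE (g : R -> R) i : variation (a i) (b i) g (s i) =
    \sum_(j < size (s i)) `|g (nth (b i) (a i :: s i) j.+1)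
                            - g (nth (b i) (a i :: s i) j)|.
  by rewrite /variation big_mkord.
have sumE (g : R -> R) : \sum_p `|g (be p) - g (al p)| =
    \sum_i variation (a i) (b i) g (s i).
  under [RHS]eq_bigr do rewrite varE.
  by rewrite (sig_big_dep xpredT (fun _ => xpredT) (fun i (j : 'I_(size (s i))) =>
    `|g (nth (b i) (a i :: s i) j.+1) - g (nth (b i) (a i :: s i) j)|)).
apply: (@le_trans _ _ (\sum_i (variation (a i) (b i) f (s i) + eta))).
  exact: ler_sum.
rewrite big_split/= sumr_const lerD//; last first.
  rewrite -(mulr_natr eta) /eta mulrAC ler_pdivrMr// ler_wpM2l// ?(ltW e0)//.
  by rewrite ler_nat.
rewrite -sumE; apply/ltW/H.
- move=> p; have [a0 [_ bl]] := ab (tag p).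
  split; first by rewrite (le_trans a0)// itv_partition_nth_ge// ltnW.
  split; first by apply/ltW/itv_partition_nth_lt.
  by rewrite (le_trans _ bl)// itv_partition_nth_le.
- move=> [i j] [i' j'] /=; have [ii'|ii' _] := eqVneq i i'; last first.
    have [h|h] := abd _ _ ii'; [left|right]; rewrite /al /be/=.
      apply: (@le_trans _ _ (b i)).
        exact: (@itv_partition_nth_le _ _ _ (ps i) j.+1).
      by rewrite (le_trans h)// itv_partition_nth_ge// ltnW.
    apply: (@le_trans _ _ (b i')).
      exact: (@itv_partition_nth_le _ _ _ (ps i') j'.+1).
    by rewrite (le_trans h)// itv_partition_nth_ge// ltnW.
  subst i' => jj'; rewrite /al /be/=.
  have le_nth (k k' : 'I_(size (s i))) : (k < k')%N ->
      nth (b i) (s i) k <= nth (b i) (a i :: s i) k'.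
    rewrite leq_eqVlt => /predU1P[<-//|kk']; apply: ltW.
    exact: (@itv_partition_nth_lt _ _ _ (ps i) k.+1 k' kk' (ltnW (ltn_ord _))).
  have [lt|lt|e'] := ltngtP j j'; [left|right|]; try exact: le_nth.
  by move: jj'; rewrite (val_inj e') eqxx.
- rewrite (le_lt_trans _ sab)//.

  (* The variation of the identity along a partition is the length of the interval, so refining
     keeps the total length. *)
  have := sumE idfun; rewrite /= => h.
  rewrite (eq_bigr (fun p => `|be p - al p|)); last first.
    move=> p _; rewrite ger0_norm// subr_ge0; apply/ltW.
    exact: itv_partition_nth_lt.
  rewrite h; apply: ler_sum => i _.
  by rewrite (nondecreasing_variation _ (ps i)).
Qed.

End AbsoluteContinuity.

(** * Stieltjes measures and Radon-Nikodym densities *)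

Section StieltjesDensity.
Context {R : realType}.
Local Notation mu := (@lebesgue_measure R).

(** Meant for the components of a bounded open set, some of which may be empty in their enumeration;
    the pair [(0, 0)] gives these real endpoints as well. *)
Lemma open_bounded_interval (O : set R) (m M : R) :
  open O -> is_interval O -> O `<=` `[m, M]%classic ->
  exists ab : R * R, (ab.1 < ab.2 \/ ab = (0, 0)) /\ O = `]ab.1, ab.2[%classic.
Proof.
move=> oO iO OmM; have [->|O0] := eqVneq O set0.
  by exists (0, 0); split => /=; [right|rewrite set_itvoo0].
have lO : has_lbound O by exists m => x /OmM/=; rewrite in_itv/= => /andP[].
have uO : has_ubound O by exists M => x /OmM/=; rewrite in_itv/= => /andP[].
have OE : O = `]inf O, sup O[%classic.
  transitivity (O°); first by apply/esym/interior_id.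
  by rewrite interval_bounded_interior.
exists (inf O, sup O); split => //; left => /=.
have /set0P[x] := O0; rewrite {1}OE/= in_itv/= => /andP[ax xb].
exact: lt_trans ax xb.
Qed.

Definition clamp (l x : R) := Num.max 0 (Num.min x l).

Lemma clamp_homo l : {homo clamp l : x y / x <= y}.
Proof.
move=> x y; rewrite /clamp /Num.max /Num.min => xy.
by do !case: ifPn => //; rewrite -?leNgt => *; lra.
Qed.

Lemma clamp_itv l x : 0 <= l -> 0 <= clamp l x <= l.
Proof. by move=> l0; rewrite /clamp le_max lexx/= ge_max l0 ge_min lexx orbT. Qed.

Lemma clamp_id l x : 0 <= x -> x <= l -> clamp l x = x.
Proof. by move=> x0 xl; rewrite /clamp (min_idPl _)// (max_idPr _). Qed.

Lemma clamp_ge l x : 0 <= l -> l <= x -> clamp l x = l.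
Proof. by move=> l0 xl; rewrite /clamp (min_idPr _)// (max_idPr _). Qed.

Lemma clamp_le0 l x : x <= 0 -> clamp l x = 0.
Proof. by move=> x0; rewrite /clamp (max_idPl _)// ge_min x0. Qed.

Lemma clamp_lip l x y : x <= y -> clamp l y - clamp l x <= y - x.
Proof.
rewrite /clamp /Num.max /Num.min => xy.
by do !case: ifPn => //; rewrite -?leNgt => *; lra.
Qed.

(** A form for nondecreasing functions; the non-strict bound is what a total variation, being a
    supremum, inherits. *)
Definition abs_continuous_le (l : R) (G : R -> R) := forall eps : R, 0 < eps ->
  exists2 delta : R, 0 < delta &
    forall (I : finType) (a b : I -> R),
      (forall i, 0 <= a i /\ a i <= b i /\ b i <= l) ->
      (forall i j, i != j -> b i <= a j \/ b j <= a i) ->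
      \sum_i (b i - a i) < delta -> \sum_i (G (b i) - G (a i)) <= eps.

Section cumulative_01.
Variables (l : R) (G : R -> R).
Hypotheses (l0 : 0 < l) (Gnd : {homo G : x y / x <= y})
  (Gac : abs_continuous_le l G)
  (G0 : forall x, G x = G (clamp l x)) (G_0 : G 0 = 0) (G_l : G l = 1).

Let Gcont : continuous G.
Proof.
move=> x; apply/cvgrPdist_le => e e0.
have [d d0 H] := Gac e0.
have step a b : a <= b -> b - a < d -> G b - G a <= e.
  move=> ab abd; rewrite G0 (G0 a).
  have := H unit (fun=> clamp l a) (fun=> clamp l b).
  rewrite !big_const/= card_unit /= !addr0; apply.
  - move=> _; have /andP[-> _] := clamp_itv a (ltW l0).
    by have /andP[_ ->] := clamp_itv b (ltW l0); rewrite clamp_homo.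
  - by case=> -[].
  - exact: le_lt_trans (clamp_lip _ ab) abd.
exists d => //= y /= xyd; have [xy|yx] := leP x y.
  by rewrite distrC ger0_norm ?subr_ge0 ?Gnd// step//; move: xyd;
    rewrite distrC ger0_norm ?subr_ge0.
rewrite ger0_norm ?subr_ge0 ?Gnd ?(ltW yx)// step ?(ltW yx)//.
by move: xyd; rewrite ger0_norm// subr_ge0 ltW.
Qed.

(** [G], constant outside of [[0, l]], is the distribution function of a probability [nu]. Absolute
    continuity says that [nu] vanishes on Lebesgue null sets, so that it has a Radon-Nikodym
    density. *)
Lemma cumulative01_density : exists phi : R -> R,
  mu.-integrable setT (EFin \o phi) /\
  forall x, 0 <= x -> x <= l -> G x = \int[mu]_(t in `[0, x]) phi t.
Proof.
have rc : right_continuous G by exact: right_continuousW.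
have Gy : G @ +oo --> (1 : R).
  by apply: cvg_near_cst; near=> x; rewrite G0 clamp_ge ?G_l// ?(ltW l0)//.
have GNy : G @ -oo --> (0 : R).
  by apply: cvg_near_cst; near=> x; rewrite G0 clamp_le0 ?G_0//.
pose Gc : cumulativeBounded (0 : R) (1 : R) := HB.pack G
  (isCumulative.Build R _ R G Gnd rc) (isCumulativeBounded.Build R 0 1 G GNy Gy).
pose nu : probability (measurableTypeR R) R := lebesgue_stieltjes_measure Gc.
have nuE a b : a <= b -> nu `]a, b]%classic = (G b - G a)%:E.
  move=> ab; rewrite /nu/= /lebesgue_stieltjes_measure /measure_extension.
  by rewrite measurable_mu_extE/=; [rewrite wlength_itv_bnd|exact: is_ocitv].
have nu_oo a b : a <= b -> (nu `]a, b[%classic <= (G b - G a)%:E)%E.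
  move=> ab; rewrite -nuE//; apply: le_measure; rewrite ?inE//;
    try exact: measurable_itv.
  by move=> x/=; rewrite !in_itv/= => /andP[-> /ltW].
have dom : nu `<< mu.
  apply/null_content_dominatesP => A mA muA0.
  (* [nu] charges only [J], hence only the trace of the null set on [J] matters. *)
  pose J := (`]0, l]%classic : set R).
  have nuJ : nu (~` J) = 0%E.
    by rewrite probability_setC ?nuE ?(ltW l0)//; [rewrite G_l G_0 subr0 subee|
      exact: measurable_itv].
  have mJ : measurable J by exact: measurable_itv.
  have mAJ : measurable (A `&` J) by exact: measurableI.
  have nuAJ : (nu A <= nu (A `&` J))%E.
    rewrite -[leLHS](_ : nu ((A `&` J) `|` (A `&` ~` J)) = _); last first.
      by rewrite -setIUr setUv setIT.
    have mAJc : measurable (A `&` ~` J).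
      by apply: measurableI => //; exact: measurableC.
    apply: (le_trans (measureU2 _ mAJ mAJc)).
    rewrite -[leRHS]adde0 leeD2l//.
    by rewrite -nuJ le_measure// ?inE//; exact: measurableC.
  apply/eqP; rewrite eq_le measure_ge0 andbT; apply: (le_trans nuAJ).
  apply/lee_addgt0Pr => e e0; rewrite add0e.
  have [d d0 H] := Gac e0.
  have muAJ : mu (A `&` J) = 0%E.
    apply/eqP; rewrite eq_le measure_ge0 andbT -muA0 le_measure// ?inE//.
  (* Outer regularity encloses the null set in an open set of measure less than [d], the modulus of
     absolute continuity for [e]; a bounded window then makes all its components bounded. *)
  have [|U [oU AU muU]] := lebesgue_regularity_outer mAJ _ d0.
    by change (mu (A `&` J) < +oo)%E; rewrite muAJ ltry.
  pose V := U `&` `]-1, (l + 1)[%classic.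
  have oV : open V by apply: openI => //; exact: interval_open.
  have AV : A `&` J `<=` V.
    move=> x AJx; split; first exact: AU.
    case: AJx => _; rewrite /J/= !in_itv/= => /andP[x0 xl].
    by rewrite (lt_trans (ltrN10 _) x0)/= (le_lt_trans xl)// ltrDl.
  have mV : measurable V by exact: open_measurable.
  have muV : (mu V < d%:E)%E.
    have muU' : (mu U < d%:E)%E.
      have mU : measurable U by exact: open_measurable.
      rewrite -[ltLHS](_ : mu ((U `\` (A `&` J)) `|` (A `&` J)) = _); last first.
        by rewrite setUC setDUK.
      apply: (le_lt_trans (measureU2 _ _ _)) => //; first exact: measurableD.
      by change (mu (U `\` (A `&` J)) + mu (A `&` J) < d%:E)%E; rewrite muAJ adde0.
    apply: le_lt_trans muU'; apply: le_measure; rewrite ?inE//.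
      exact: open_measurable.
    by move=> x [].
  pose O := open_disjoint_itv oV.
  have /choice[ab /all_and2[ab_lt OE]] : forall q, exists ab : R * R,
      (ab.1 < ab.2 \/ ab = (0, 0)) /\ O q = `]ab.1, ab.2[%classic.
    move=> q; apply: (@open_bounded_interval _ (-1) (l + 1)).
    - exact: open_disjoint_itv_open.
    - exact: open_disjoint_itv_is_interval.
    - move=> x Oqx; have : V x by rewrite (open_disjoint_itv_bigcup oV); exists q.
      by move=> [_]; rewrite /= !in_itv/= => /andP[/ltW-> /ltW->].
  have ab_le q : (ab q).1 <= (ab q).2 by case: (ab_lt q) => [/ltW//|->].
  have mO q : measurable (O q) by rewrite OE; exact: measurable_itv.
  have tO : trivIset setT O by exact: open_disjoint_itv_trivIset.
  have VE : V = \bigcup_q O q by exact: open_disjoint_itv_bigcup.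
  have nuV : (nu (A `&` J) <= nu V)%E by apply: le_measure => //; rewrite inE.
  refine (le_trans nuV _).
  rewrite VE measure_bigcup; [|by move=> q _; exact: mO|exact: tO].
  (* Absolute continuity bears on finite families, so it is applied to the partial sums over the
     components. *)
  apply: lime_le.
    by apply: is_cvg_nneseries.
  near=> n; rewrite big_mkord (eq_bigl xpredT); last by move=> i; rewrite in_setT.
  apply: (@le_trans _ _ (\sum_(i < n) (G (ab i).2 - G (ab i).1)%:E)%E).
    by apply: lee_sum => i _; rewrite OE nu_oo.
  rewrite sumEFin lee_fin.
  under eq_bigr do rewrite (G0 (_.2)) (G0 (_.1)).
  apply: (H _ (fun i : 'I_n => clamp l (ab i).1) (fun i => clamp l (ab i).2)).
  - move=> i; have /andP[-> _] := clamp_itv (ab i).1 (ltW l0).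
    by have /andP[_ ->] := clamp_itv (ab i).2 (ltW l0); rewrite clamp_homo.
  - have ge0 x : 0 <= clamp l x by have /andP[] := clamp_itv x (ltW l0).
    have c0 : clamp l 0 = 0 by exact: clamp_le0.
    move=> i j ij; case: (ab_lt i) => [hi|->]; last by left; rewrite c0.
    case: (ab_lt j) => [hj|->]; last by right; rewrite c0.
    suff [h|h] : (ab i).2 <= (ab j).1 \/ (ab j).2 <= (ab i).1.
    + by left; exact: clamp_homo.
    + by right; exact: clamp_homo.
    have [|h1] := leP (ab i).2 (ab j).1; first by left.
    have [|h2] := leP (ab j).2 (ab i).1; first by right.
    exfalso; move/eqP: ij; apply; apply/val_inj/tO => //.
    (* Two overlapping components would share the midpoint of []u, v[], against their
       disjointness. *)
    pose u := Num.max (ab i).1 (ab j).1; pose v := Num.min (ab i).2 (ab j).2.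
    have uv : u < v by rewrite /u /v gt_max !lt_min hi hj h1 h2.
    exists ((u + v) / 2); have := midf_lt uv; rewrite /u /v => -[/= hu hv].
    move: hu hv; rewrite gt_max lt_min => /andP[u1 u2] /andP[v1 v2].
    by rewrite !OE; split; rewrite /= in_itv/=; apply/andP.
  - rewrite -lte_fin; apply: le_lt_trans muV.
    rewrite VE; apply: (@le_trans _ _ (mu (\big[setU/set0]_(i < n) O i))).
      rewrite measure_bigsetU_ord; [|by move=> i; exact: mO|
        by move=> i j _ _ ij; exact/val_inj/tO].
      rewrite -sumEFin; apply: lee_sum => i _.
      rewrite OE; change ((clamp l (ab i).2 - clamp l (ab i).1)%:E <=
        mu `](ab i).1, (ab i).2[%classic)%E.
      rewrite lebesgue_measure_itv/= lte_fin.
      case: ltP => h; first by rewrite -EFinD lee_fin clamp_lip.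
      by rewrite lee_fin (_ : (ab i).1 = (ab i).2) ?subrr//; apply/eqP; rewrite eq_le h ab_le.
    apply: le_measure; rewrite ?inE//.
    + by apply: bigsetU_measurable => i _; exact: mO.
    + by rewrite -VE.
    + exact: bigsetU_bigcup.
have [f [f0 ffin fint fE]] := radon_nikodym_sigma_finite dom.
exists (fine \o f); have -> : EFin \o (fine \o f) = f.
  by apply/funext => x /=; rewrite fineK.
split => // x x0 xl; have -> : G x = G x - G 0 by rewrite G_0 subr0.
transitivity (\int[mu]_(t in `]0, x]) (fine \o f) t); last first.
  refine (@Rintegral_itv_obnd_cbnd R 0 (BRight x) (fine \o f) _).
  have -> : EFin \o (fine \o f) = f by apply/funext => y /=; rewrite fineK.
  by apply: integrableS fint => //; exact: measurable_itv.
rewrite /Rintegral; under eq_integral do rewrite /= fineK//.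
rewrite -[LHS]/(fine (G x - G 0)%:E) -nuE//; congr fine.
by apply: fE; exact: measurable_itv.
Unshelve. all: by end_near.
Qed.
End cumulative_01.

End StieltjesDensity.

(** * The fundamental theorem of calculus for absolutely continuous functions *)

Section FundamentalTheorem.
Context {R : realType}.
Local Notation mu := (@lebesgue_measure R).
Implicit Types (l : R) (f : R -> R).

(** Dividing by the total increment [c] reduces to a distribution function; when [c] vanishes, [G]
    is constant on [[0, l]] and the density 0 works. *)
Lemma nondecreasing_density l (G : R -> R) : 0 < l ->
  (forall x y, 0 <= x -> x <= y -> y <= l -> G x <= G y) ->
  abs_continuous_le l G ->
  exists phi : R -> R, mu.-integrable setT (EFin \o phi) /\
    forall x, 0 <= x -> x <= l -> G x - G 0 = \int[mu]_(t in `[0, x]) phi t.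
Proof.
move=> l0 Gnd Gac; pose c := G l - G 0.
have c0 : 0 <= c by rewrite subr_ge0 Gnd// ltW.
have [cE|cn0] := eqVneq c 0.
  exists (cst 0); split.
    exact: (integrable0 mu setT).
  move=> x x0 xl; have -> : \int[mu]_(t in `[0, x]) cst 0 t = 0.
    by rewrite /Rintegral integral0.
  have := Gnd 0 x (lexx _) x0 xl; have := Gnd x l x0 xl (lexx _).
  by move: cE; rewrite /c => *; lra.
have cgt0 : 0 < c by rewrite lt_def cn0.
have cl x := clamp_itv x (ltW l0).
pose G1 x := (G (clamp l x) - G 0) / c.
have [phi [iphi phiE]] : exists phi : R -> R, mu.-integrable setT (EFin \o phi) /\
    forall x, 0 <= x -> x <= l -> G1 x = \int[mu]_(t in `[0, x]) phi t.
  apply: cumulative01_density => //.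
  - move=> x y xy; rewrite /G1 ler_pM2r ?invr_gt0// lerD2r.
    by have /andP[? ?] := cl x; have /andP[? ?] := cl y; apply: Gnd => //; exact: clamp_homo.
  - move=> e e0; have [d d0 H] := Gac _ (mulr_gt0 e0 cgt0).
    exists d => // I a b ab abd sab.
    rewrite /G1 (eq_bigr (fun i => (G (b i) - G (a i)) / c)).
      by rewrite -mulr_suml ler_pdivrMr// H.
    move=> i _; have [a0 [aib bl]] := ab i.
    by rewrite !clamp_id// ?(le_trans a0) ?(le_trans aib)//; lra.
  - move=> x; rewrite /G1 (@clamp_id _ _ (clamp l x))//; by have /andP[] := cl x.
  - by rewrite /G1 clamp_le0// subrr mul0r.
  - by rewrite /G1 clamp_ge ?(ltW l0)// divff.
exists (fun x => c * phi x); split.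
  have := integrableZl measurableT c iphi.
  by apply: eq_integrable => // x _; rewrite /= EFinM.
move=> x x0 xl; rewrite RintegralZl//; last first.
  by apply: integrableS iphi => //; exact: measurable_itv.
by rewrite -phiE// /G1 clamp_id// mulrC divfK.
Qed.

(** Take the [d] of absolute continuity for the error 1: an interval shorter than [d] has variation
    at most 1, and finitely many intervals of length at most [d / 2] cover [[0, l]]. *)
Lemma seg_abs_continuous_bounded_variation l f : 0 <= l ->
  seg_abs_continuous l f -> bounded_variation 0 l f.
Proof.
move=> l0 fac; have [d d0 H] := seg_abs_continuous_fin fac ltr01.
have small a b : 0 <= a -> a <= b -> b <= l -> b - a < d -> bounded_variation a b f.
  move=> a0 ab bl abd; exists 1 => _ [s ps <-]; rewrite /variation big_mkord.
  apply/ltW; apply: (H 'I_(size s) (fun i => nth b (a :: s) i)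
    (fun i => nth b (a :: s) i.+1)).
  - move=> i; split; first by rewrite (le_trans a0)// itv_partition_nth_ge// ltnW.
    split; first by apply/ltW/itv_partition_nth_lt.
    by rewrite (le_trans _ bl)// (@itv_partition_nth_le _ _ _ _ ps i.+1).
  - have le_nth (k k' : 'I_(size s)) : (k < k')%N ->
        nth b (a :: s) k.+1 <= nth b (a :: s) k'.
      rewrite leq_eqVlt => /predU1P[<-//|kk']; apply: ltW.
      exact: (@itv_partition_nth_lt _ _ _ _ ps k.+1 k' kk' (ltnW (ltn_ord _))).
    move=> i j ij; have [lt|lt|e'] := ltngtP i j; [left|right|]; try exact: le_nth.
    by move: ij; rewrite (val_inj e') eqxx.
  - apply: le_lt_trans abd.
    rewrite -[leRHS](nondecreasing_variation (f := idfun) _ ps)// /variation big_mkord.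
    by apply: ler_sum => i _; exact: ler_norm.
pose h := d / 2; have h0 : 0 < h by rewrite divr_gt0.
have [N lN] : exists N : nat, l <= N%:R * h.
  exists (Num.truncn (l / h)).+1; rewrite -ler_pdivrMr//; exact/ltW/truncnS_gt.
suff bv n : bounded_variation 0 (Num.min l (n%:R * h)) f.
  by have := bv N; rewrite (min_idPl lN).
elim: n => [|n IH].
  rewrite mul0r (min_idPr l0); exact: bounded_variationxx.
set a := Num.min l (n%:R * h) in IH *; set b := Num.min l (n.+1%:R * h).
have a0 : 0 <= a by rewrite le_min l0/= mulr_ge0// ltW.
have ab : a <= b.
  rewrite /b le_min /a ge_min lexx/= ge_min orbC ler_wpM2r ?ler_nat//; exact: ltW.
have bl : b <= l by rewrite /b ge_min lexx.
have abd : b - a < d.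
  have hd : h < d by rewrite /h; lra.
  rewrite /b /a -[n.+1]addn1 natrD mulrDl mul1r /Num.min.
  by do !case: ifPn => //; rewrite -?leNgt => *; lra.
apply/bounded_variationP; first exact: le_trans ab.
rewrite (total_variationD f a0 ab) fin_numD; apply/andP; split.
  exact/bounded_variationP.
exact/bounded_variationP/small.
Qed.

(** Jordan decomposition [f = T - (T - f)], with [T] the total variation from 0: both parts are
    nondecreasing and inherit the absolute continuity. *)
Lemma abs_continuous_density l f : 0 < l -> seg_abs_continuous l f ->
  exists phi : R -> R, mu.-integrable setT (EFin \o phi) /\
    forall x, 0 <= x -> x <= l -> f x - f 0 = \int[mu]_(t in `[0, x]) phi t.
Proof.
move=> l0 fac; have bvf := seg_abs_continuous_bounded_variation (ltW l0) fac.
pose T x := fine (total_variation 0 x f).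
have fin a b : 0 <= a -> a <= b -> b <= l -> total_variation a b f \is a fin_num.
  move=> a0 ab bl; apply/bounded_variationP => //; apply: (bounded_variationr a0) => //.
  by apply: (bounded_variationl _ bl bvf); exact: le_trans ab.
have TE a b : 0 <= a -> a <= b -> b <= l ->
    T b - T a = fine (total_variation a b f).
  move=> a0 ab bl; rewrite /T (total_variationD f a0 ab) fineD ?fin//.
    by rewrite addrC addKr.
  exact: le_trans bl.
have Tf a b : 0 <= a -> a <= b -> b <= l -> `|f b - f a| <= T b - T a.
  by move=> a0 ab bl; rewrite TE// -lee_fin fineK ?fin//; exact: total_variation_ge.
have Tac : abs_continuous_le l T.
  move=> e e0; have [d d0 H] := total_variation_abs_continuous fac bvf e0.
  exists d => // I a b ab abd sab; rewrite (le_trans _ (H I a b ab abd sab))//.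
  by apply: ler_sum => i _; have [? [? ?]] := ab i; rewrite TE.
have [p1 [ip1 p1E]] : exists phi : R -> R, mu.-integrable setT (EFin \o phi) /\
    forall x, 0 <= x -> x <= l -> T x - T 0 = \int[mu]_(t in `[0, x]) phi t.
  apply: nondecreasing_density => // x y x0 xy yl.
  by rewrite -subr_ge0 (le_trans _ (Tf _ _ x0 xy yl)).
have [p2 [ip2 p2E]] : exists phi : R -> R, mu.-integrable setT (EFin \o phi) /\
    forall x, 0 <= x -> x <= l ->
      (T x - f x) - (T 0 - f 0) = \int[mu]_(t in `[0, x]) phi t.
  apply: (@nondecreasing_density _ (fun x => T x - f x)) => // [x y x0 xy yl|].
    have := Tf _ _ x0 xy yl; have := ler_norm (f y - f x) => *; lra.
  (* The increments of [T - f] are at most twice those of [T], whence [e / 2]. *)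
  move=> e e0; have e20 : 0 < e / 2 by rewrite divr_gt0.
  have [d d0 H] := Tac _ e20; exists d => // I a b ab abd sab.
  have := H I a b ab abd sab.
  suff : \sum_i (T (b i) - f (b i) - (T (a i) - f (a i))) <=
      2 * \sum_i (T (b i) - T (a i)) by move=> *; lra.
  rewrite mulr_sumr; apply: ler_sum => i _; have [a0 [aib bl]] := ab i.
  have := Tf _ _ a0 aib bl; rewrite distrC; have := ler_norm (f (a i) - f (b i)) => *; lra.
exists (p1 \- p2); split.
  have := integrableB measurableT ip1 ip2.
  by apply: eq_integrable => // x _; rewrite /= EFinB.
move=> x x0 xl; rewrite RintegralB//; try
  by (apply: integrableS ip1 || apply: integrableS ip2) => //; exact: measurable_itv.
by rewrite -p1E// -p2E//; ring.
Qed.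

Lemma seg_quot_cvgP l f (t a : R) : seg_quot l f t --> a <->
  forall e : R, 0 < e -> exists2 d : R, 0 < d & forall s, 0 <= s -> s <= l -> s != t ->
    `|s - t| < d -> `|(f s - f t) / (s - t) - a| <= e.
Proof.
split=> [/cvgrPdist_le h e e0|h].
  have [d /= d0 H] := h _ e0; exists d => // s s0 sl st std.
  by rewrite distrC; apply: H => //=; rewrite ?in_itv/= ?s0// distrC.
apply/cvgrPdist_le => e e0; have [d d0 H] := h _ e0.
exists d => //= s /= std st; rewrite in_itv/= => /andP[s0 sl].
by rewrite distrC; apply: H => //; rewrite distrC.
Qed.

Lemma seg_proper_filter l (t : R) : 0 < l -> 0 <= t <= l ->
  ProperFilter (within `[0, l]%classic t^').
Proof.
move=> l0 /andP[t0 tl]; apply: Build_ProperFilter_ex => P [d /= d0 H].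
pose h := Num.min (d / 2) (l / 2).
have h0 : 0 < h by rewrite lt_min !divr_gt0.
have hl : h <= l / 2 by rewrite ge_min lexx orbT.
have hd : h < d by rewrite gt_min; apply/orP; left; lra.
have [tl2|tl2] := leP t (l / 2).
- exists (t + h); apply: H => /=.
  + by rewrite opprD addNKr normrN gtr0_norm.
  + by rewrite -subr_eq0 addrAC subrr add0r gt_eqF.
  + by rewrite in_itv/=; apply/andP; split; lra.
- exists (t - h); apply: H => /=.
  + by rewrite opprB addrC subrK gtr0_norm.
  + by rewrite -subr_eq0 addrAC subrr add0r oppr_eq0 gt_eqF.
  + by rewrite in_itv/=; apply/andP; split; lra.
Qed.

Lemma seg_deriv_cvg l f (t a : R) : 0 < l -> 0 <= t <= l ->
  seg_quot l f t --> a -> seg_deriv l f t = a.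
Proof.
move=> l0 tl h; have := seg_proper_filter l0 tl => ?.
by apply: (cvg_lim _ h); exact: Rhausdorff.
Qed.

Lemma seg_quot_cvg_derivable l f (F : R -> R) (x a : R) : 0 < x < l ->
  (forall y, 0 <= y -> y <= l -> f y - f 0 = F y) ->
  derivable F x 1 -> derive1 F x = a -> seg_quot l f x --> a.
Proof.
move=> /andP[x0 xl] fF dF F'E.
have /is_derive1_caratheodory[g [gE gc ga]] : is_derive x (1 : R) F a.
  by split=> //; rewrite -derive1E.
apply/seg_quot_cvgP => e e0; move/cvgrPdist_le : gc => /(_ _ e0)[d /= d0 H].
exists d => // s s0 sl sx sxd; rewrite distrC -ga.
have -> : f s - f x = g s * (s - x).
  by rewrite -gE -!fF ?(ltW x0) ?(ltW xl)//; ring.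
by rewrite mulfK ?subr_eq0//; apply: H; rewrite /= distrC.
Qed.

(** By Lebesgue's differentiation theorem, the integral of the density has derivative [phi] at
    almost every point. As [seg_deriv] is a [lim], its value there is identified through the
    convergence of the quotients. *)
Theorem FTC_abs_continuous l f : 0 < l -> seg_abs_continuous l f ->
  exists phi : R -> R, [/\ mu.-integrable setT (EFin \o phi),
    forall x y, 0 <= x -> x <= y -> y <= l -> f y - f x = \int[mu]_(t in `[x, y]) phi t &
    {ae mu, forall x, 0 < x < l -> seg_deriv l f x = phi x}].
Proof.
move=> l0 fac; have [phi [iphi phiE]] := abs_continuous_density l0 fac.
have ip (A : set R) : measurable A -> mu.-integrable A (EFin \o phi).
  by move=> mA; apply: integrableS iphi.
exists phi; split => //.
- move=> x y x0 xy yl.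
  have -> : f y - f x = (f y - f 0) - (f x - f 0) by ring.
  have y0 := le_trans x0 xy; have xl := le_trans xy yl.
  rewrite !phiE// Rintegral_itvB ?bnd_simp//; last by apply: ip; exact: measurable_itv.
  by rewrite Rintegral_itv_obnd_cbnd//; apply: ip; exact: measurable_itv.
- have /lebesgue_differentiation : locally_integrable setT phi.
    have -> : phi = phi \_ [set: R] by apply/funext => x; rewrite patchE in_setT.
    exact: integrable_locally.
  apply: negligibleS => x; apply: contra_not => phix /andP[x0 xl].
  have [dF FE] := @FTC1_lebesgue_pt _ phi (BLeft 0) x l xl (ip _ (measurable_itv _)) x0 phix.
  have : seg_quot l f x --> phi x.
    apply: (@seg_quot_cvg_derivable _ _ (fun y => \int[mu]_(t in `[0, y]) phi t)) => //.
    by rewrite x0.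
  by apply: seg_deriv_cvg => //; rewrite ltW//= ltW.
Qed.
End FundamentalTheorem.

(** * Semi-inner products *)

Record semiInner (R : realType) := SemiInner {
  si_car :> lmodType R;
  ip : si_car -> si_car -> R;
  ipC : forall x y, ip x y = ip y x;
  ipDl : forall x y z, ip (x + y) z = ip x z + ip y z;
  ipZl : forall a x y, ip (a *: x) y = a * ip x y;
  ip_ge0 : forall x, 0 <= ip x x
}.

Section SemiInnerTheory.
Context {R : realType} {V : semiInner R}.
Implicit Types (x y z : V) (a : R).

Lemma ipDr x y z : ip x (y + z) = ip x y + ip x z.
Proof. by rewrite ipC ipDl !(ipC _ x). Qed.
Lemma ipZr a x y : ip x (a *: y) = a * ip x y.
Proof. by rewrite ipC ipZl ipC. Qed.
Lemma ipNl x y : ip (- x) y = - ip x y.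
Proof. by rewrite -scaleN1r ipZl mulN1r. Qed.
Lemma ipNr x y : ip x (- y) = - ip x y.
Proof. by rewrite ipC ipNl ipC. Qed.
Lemma ipBl x y z : ip (x - y) z = ip x z - ip y z.
Proof. by rewrite ipDl ipNl. Qed.
Lemma ipBr x y z : ip x (y - z) = ip x y - ip x z.
Proof. by rewrite ipDr ipNr. Qed.
Lemma ip0l x : ip 0 x = 0.
Proof. by rewrite -[0]subr0 ipBl subrr. Qed.
Lemma ip_suml (I : Type) (r : seq I) (Q : pred I) (F : I -> V) x :
  ip (\sum_(i <- r | Q i) F i) x = \sum_(i <- r | Q i) ip (F i) x.
Proof.
elim: r => [|i r IH]; first by rewrite !big_nil ip0l.
by rewrite !big_cons; case: (Q i); rewrite ?ipDl IH.
Qed.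

Lemma ip_sumr (I : Type) (r : seq I) (Q : pred I) (F : I -> V) x :
  ip x (\sum_(i <- r | Q i) F i) = \sum_(i <- r | Q i) ip x (F i).
Proof. by rewrite ipC ip_suml; apply: eq_bigr => i _; rewrite ipC. Qed.

(** Only a seminorm: in the instance of interest, the vectors are square-integrable functions and
    not their almost sure classes. *)
Definition sinorm x := Num.sqrt (ip x x).

Lemma sinorm_ge0 x : 0 <= sinorm x. Proof. exact: sqrtr_ge0. Qed.
Lemma sqr_sinorm x : sinorm x ^+ 2 = ip x x.
Proof. by rewrite sqr_sqrtr// ip_ge0. Qed.

Lemma ip_sqr_le x y : ip x y ^+ 2 <= ip x x * ip y y.
Proof.
have H a : 0 <= ip x x + 2 * a * ip x y + a ^+ 2 * ip y y.
  have := ip_ge0 (x + a *: y); rewrite ipDl !ipDr !ipZl !ipZr (ipC y x).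
  by congr (_ <= _); ring.
have [y0|yn0] := eqVneq (ip y y) 0.
  rewrite y0 mulr0; have [->|xy0] := eqVneq (ip x y) 0; first by rewrite expr0n.
  (* With [ip y y = 0], this parameter would give the nonnegative expression the value -1. *)
  have := H (- (ip x x + 1) / (2 * ip x y)); rewrite y0 mulr0 addr0.
  have -> : 2 * (- (ip x x + 1) / (2 * ip x y)) * ip x y = - (ip x x + 1).
    by field.
  by move=> h; exfalso; lra.
have y0 : 0 < ip y y by rewrite lt_def yn0 ip_ge0.
have := H (- ip x y / ip y y).
have -> : ip x x + 2 * (- ip x y / ip y y) * ip x y + (- ip x y / ip y y) ^+ 2 * ip y y
  = (ip x x * ip y y - ip x y ^+ 2) / ip y y by field.
by rewrite pmulr_lge0 ?invr_gt0// subr_ge0.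
Qed.

Lemma ip_le x y : `|ip x y| <= sinorm x * sinorm y.
Proof.
rewrite -sqrtrM ?ip_ge0// -(sqrtr_sqr (ip x y)) ler_sqrt ?mulr_ge0 ?ip_ge0//.
exact: ip_sqr_le.
Qed.

Lemma sinormD x y : sinorm (x + y) <= sinorm x + sinorm y.
Proof.
rewrite -(@ler_pXn2r _ 2)// ?nnegrE ?addr_ge0 ?sinorm_ge0//.
rewrite sqr_sinorm ipDl !ipDr (ipC y x) sqrrD !sqr_sinorm.
have := ip_le x y; have := ler_norm (ip x y); rewrite mulr2n; lra.
Qed.

Lemma sinormZ a x : sinorm (a *: x) = `|a| * sinorm x.
Proof. by rewrite /sinorm ipZl ipZr mulrA -expr2 sqrtrM ?sqr_ge0// sqrtr_sqr. Qed.
Lemma sinormN x : sinorm (- x) = sinorm x.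
Proof. by rewrite /sinorm ipNl ipNr opprK. Qed.
Lemma sinormBC x y : sinorm (x - y) = sinorm (y - x).
Proof. by rewrite -sinormN opprB. Qed.
Lemma sinormB_le x y z : sinorm (x - z) <= sinorm (x - y) + sinorm (y - z).
Proof. by have := sinormD (x - y) (y - z); rewrite addrA subrK. Qed.
Lemma sinorm0 : sinorm 0 = 0.
Proof. by rewrite /sinorm ip0l sqrtr0. Qed.

Lemma sinorm_sum (I : Type) (r : seq I) (Q : pred I) (F : I -> V) :
  sinorm (\sum_(i <- r | Q i) F i) <= \sum_(i <- r | Q i) sinorm (F i).
Proof.
elim: r => [|i r IH]; first by rewrite !big_nil sinorm0.
rewrite !big_cons; case: (Q i) => //.
by rewrite (le_trans (sinormD _ _))// lerD2l.
Qed.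

Lemma sinorm_le x e : 0 <= e -> (sinorm x <= e) = (ip x x <= e ^+ 2).
Proof.
move=> e0; rewrite -sqr_sinorm ler_pXn2r// ?nnegrE//; exact: sinorm_ge0.
Qed.

Lemma ip_dist_le x y x' y' :
  `|ip x y - ip x' y'| <= sinorm (x - x') * sinorm y + sinorm x' * sinorm (y - y').
Proof.
have -> : ip x y - ip x' y' = ip (x - x') y + ip x' (y - y').
  by rewrite ipBl ipBr; ring.
by rewrite (le_trans (ler_normD _ _))// lerD// ip_le.
Qed.

Lemma ip_close x' y' (e : R) : 0 < e -> exists2 d : R, 0 < d &
  forall x y, sinorm (x - x') <= d -> sinorm (y - y') <= d -> `|ip x y - ip x' y'| <= e.
Proof.
move=> e0; pose M := sinorm x' + sinorm y' + 1.
have M0 : 0 < M by rewrite ltr_wpDl// addr_ge0// sinorm_ge0.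
exists (Num.min 1 (e / M)); first by rewrite lt_min ltr01 divr_gt0.
set d := Num.min _ _ => x y xd yd; apply: (le_trans (ip_dist_le _ _ _ _)).
have d1 : d <= 1 by rewrite ge_min lexx.
have d0 : 0 <= d by rewrite le_min ler01 divr_ge0// ltW.
have yn : sinorm y <= sinorm y' + 1.
  rewrite -[y](subrK y') (le_trans (sinormD _ _))// addrC lerD2l.
  exact: le_trans d1.
apply: (@le_trans _ _ (d * M)); last by rewrite -ler_pdivlMr// ge_min lexx orbT.
rewrite (_ : d * M = d * (sinorm y' + 1) + sinorm x' * d); last by rewrite /M; ring.
apply: lerD; first by apply: ler_pM => //; exact: sinorm_ge0.
by rewrite ler_wpM2l// sinorm_ge0.
Qed.

End SemiInnerTheory.

Definition si_complete (R : realType) (V : semiInner R) := forall X : nat -> V,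
  (forall e : R, 0 < e -> exists N, forall n m, (N <= n)%N -> (N <= m)%N ->
    sinorm (X n - X m) <= e) ->
  exists U, forall e : R, 0 < e -> exists N, forall n, (N <= n)%N -> sinorm (X n - U) <= e.

(** * Differentiation of a path through its Gram kernel *)

Section PathCalculus.
Context {R : realType} {V : semiInner R}.
Variable l : R.
Hypothesis l0 : 0 < l.
Implicit Types (y : R -> V) (s t : R).

Definition vquot y t s : V := (s - t)^-1 *: (y s - y t).

Definition vderiv y t (U : V) := forall e : R, 0 < e -> exists2 d : R, 0 < d &
  forall s, 0 <= s <= l -> s != t -> `|s - t| < d -> sinorm (vquot y t s - U) <= e.

Definition UC2 (w : R -> R -> R) := forall e : R, 0 < e -> exists2 d : R, 0 < d &
  forall s t s' t', 0 <= s <= l -> 0 <= t <= l -> 0 <= s' <= l -> 0 <= t' <= l ->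
    `|s - s'| < d -> `|t - t'| < d -> `|w s t - w s' t'| <= e.

Lemma vquotC y t s : vquot y t s = vquot y s t.
Proof.
by rewrite /vquot -[t - s]opprB invrN scaleNr -scalerN opprB.
Qed.

Lemma seg_near_point t d : 0 <= t <= l -> 0 < d ->
  exists s, [/\ 0 <= s <= l, s != t & `|s - t| < d].
Proof.
move=> tl d0; have := seg_proper_filter l0 tl => PF.
have /filter_ex : within `[0, l]%classic t^'
    (fun s => [/\ 0 <= s <= l, s != t & `|s - t| < d]).
  exists d => //= s /= sd st; rewrite in_itv/= => sl; split => //.
  by rewrite distrC.
by [].
Qed.

Lemma vderiv_cauchy y t : si_complete V -> 0 <= t <= l ->
  (forall e : R, 0 < e -> exists2 d : R, 0 < d & forall s s',
     0 <= s <= l -> 0 <= s' <= l -> s != t -> s' != t ->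
     `|s - t| < d -> `|s' - t| < d -> sinorm (vquot y t s - vquot y t s') <= e) ->
  exists U, vderiv y t U.
Proof.
move=> Vc tl H.
have /choice[sn /all_and3[snl snt snd]] : forall n : nat, exists s,
    [/\ 0 <= s <= l, s != t & `|s - t| < n.+1%:R^-1].
  by move=> n; exact: seg_near_point.
have snd' d : 0 < d -> exists N, forall n, (N <= n)%N -> `|sn n - t| < d.
  move=> d0; exists (Num.truncn d^-1) => n Nn; rewrite (lt_trans (snd n))//.
  rewrite invf_plt ?posrE// (lt_le_trans (truncnS_gt _))// ler_nat ltnS//.
have [|U HU] := Vc (fun n => vquot y t (sn n)); last first.
  exists U => e e0; have e20 : 0 < e / 2 by rewrite divr_gt0.
  have [d d0 Hd] := H _ e20; exists d => // s sl st sd.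
  have [N HN] := HU _ e20; have [N' HN'] := snd' _ d0.
  pose n := maxn N N'.
  rewrite (le_trans (sinormB_le _ (vquot y t (sn n)) _))// (splitr e) lerD//.
    by apply: Hd => //; apply: HN'; exact: leq_maxr.
  by apply: HN; exact: leq_maxl.
move=> e e0; have [d d0 Hd] := H _ e0; have [N HN] := snd' _ d0.
by exists N => n m Nn Nm; apply: Hd => //; exact: HN.
Qed.

(** The inner product of two difference quotients is a mixed second difference of [c] over the area
    of a rectangle, hence close to a value of [c']. So all inner products of quotients at [t] tend
    to [c' t t]: the quotients are Cauchy, and their limits have Gram kernel [c']. The tolerance
    [eta] makes the hypothesis stable under uniform limits of kernels. *)
Lemma kernel_vderiv y (c c' : R -> R -> R) : si_complete V ->
  (forall s t, 0 <= s <= l -> 0 <= t <= l -> ip (y s) (y t) = c s t) ->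
  UC2 c' ->
  (forall s0 s1 t0 t1 : R, 0 <= s0 -> s0 < s1 -> s1 <= l -> 0 <= t0 -> t0 < t1 -> t1 <= l ->
    forall eta : R, 0 < eta -> exists xi zeta, [/\ s0 <= xi <= s1, t0 <= zeta <= t1 &
      `|c s1 t1 - c s0 t1 - c s1 t0 + c s0 t0
        - (s1 - s0) * (t1 - t0) * c' xi zeta| <= eta]) ->
  exists y' : R -> V,
    (forall t, 0 <= t <= l -> vderiv y t (y' t)) /\
    (forall s t, 0 <= s <= l -> 0 <= t <= l -> ip (y' s) (y' t) = c' s t).
Proof.
move=> Vc yc c'c DD.
have A (e : R) : 0 < e -> exists2 d : R, 0 < d & forall t t' s s',
    0 <= t <= l -> 0 <= t' <= l -> 0 <= s <= l -> 0 <= s' <= l ->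
    s != t -> s' != t' -> `|s - t| < d -> `|s' - t'| < d ->
    `|ip (vquot y t s) (vquot y t' s') - c' t t'| <= e.
  move=> e0; have e20 : 0 < e / 2 by rewrite divr_gt0.
  have [d d0 Hd] := c'c _ e20; exists d => // t t' s s' tl tl' sl sl' st st' sd sd'.
  (* A quotient is symmetric in its two points, which may thus be put in the increasing order
     required by the rectangles of the hypothesis. *)
  have order u v : 0 <= u <= l -> 0 <= v <= l -> v != u -> `|v - u| < d ->
      exists a b, [/\ 0 <= a, a < b, b <= l, vquot y u v = vquot y a b &
        forall w, a <= w <= b -> `|w - u| < d].
    move=> /andP[u0 ul] /andP[v0 vl]; rewrite neq_lt => /orP[uv|vu].
      rewrite distrC gtr0_norm ?subr_gt0// => h; exists v, u; split=> //; first exact: vquotC.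
      by move=> w /andP[vw wu]; rewrite distrC ger0_norm; lra.
    rewrite gtr0_norm ?subr_gt0// => h; exists u, v; split => //.
    by move=> w /andP[vw wu]; rewrite ger0_norm; lra.
  have [a [b [a0 ab bl -> Hab]]] := order _ _ tl sl st sd.
  have [a' [b' [a'0 ab' bl' -> Hab']]] := order _ _ tl' sl' st' sd'.
  pose A := (b - a) * (b' - a').
  have A0 : 0 < A by rewrite mulr_gt0 ?subr_gt0.
  have [xi [ze [xiab zeab Hxi]]] := DD _ _ _ _ a0 ab bl a'0 ab' bl' _ (mulr_gt0 e20 A0).
  have -> : ip (vquot y a b) (vquot y a' b') =
      (c b b' - c a b' - c b a' + c a a') / A.
    rewrite /vquot ipZl ipZr !ipBl !ipBr !yc ?(a0, a'0, bl, bl', (ltW ab), (ltW ab'),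
      le_trans (ltW ab) bl, le_trans (ltW ab') bl', le_trans a0 (ltW ab),
      le_trans a'0 (ltW ab'))// /A.
    by field; rewrite !subr_eq0 !gt_eqF.
  have E (u v w : R) : u / A - v = (u - A * w) / A + (w - v).
    by field; rewrite gt_eqF.
  rewrite (E _ _ (c' xi ze)) (le_trans (ler_normD _ (c' xi ze - c' t t')))// (splitr e) lerD//.
    by rewrite normrM normfV (gtr0_norm A0) ler_pdivrMr.
  have /andP[xi1 xi2] := xiab; have /andP[ze1 ze2] := zeab.
  apply: Hd => //; [| |exact: Hab|exact: Hab'].
    by rewrite (le_trans a0)//= (le_trans xi2).
  by rewrite (le_trans a'0)//= (le_trans ze2).
have /choice[y' Hy'] : forall t, exists U, 0 <= t <= l -> vderiv y t U.
  move=> t; case: (boolP (0 <= t <= l)) => [tl|_]; last by exists 0.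
  have [|U HU] := @vderiv_cauchy y t Vc tl; last by exists U.
  (* The squared norm of a difference of two quotients combines four inner products, each within
     [e ^+ 2 / 4] of the same [c' t t]. *)
  move=> e e0; have e40 : 0 < e ^+ 2 / 4 by rewrite divr_gt0// exprn_gt0.
  have [d d0 Hd] := A _ e40; exists d => // s s' sl sl' st st' sd sd'.
  rewrite sinorm_le ?(ltW e0)// ipBl !ipBr (ipC (vquot y t s') (vquot y t s)).
  have := Hd _ _ _ _ tl tl sl sl st st sd sd.
  have := Hd _ _ _ _ tl tl sl sl' st st' sd sd'.
  have := Hd _ _ _ _ tl tl sl' sl' st' st' sd' sd'.
  rewrite !ler_norml => /andP[? ?] /andP[? ?] /andP[? ?]. lra.
exists y'; split => // s t sl tl; apply/eqP; rewrite -subr_eq0 -normr_le0.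
apply/ler_addgt0Pr => e e0; rewrite add0r.
have e20 : 0 < e / 2 by rewrite divr_gt0.
have [d d0 Hd] := A _ e20.
have [r r0 Hr] := ip_close (y' s) (y' t) e20.
have [d1 d10 H1] := Hy' s sl _ r0; have [d2 d20 H2] := Hy' t tl _ r0.
have m1 : 0 < Num.min d d1 by rewrite lt_min d0.
have m2 : 0 < Num.min d d2 by rewrite lt_min d0.
have [s' [sl' st']] := seg_near_point sl m1; rewrite lt_min => /andP[? ?].
have [t' [tl' tt']] := seg_near_point tl m2; rewrite lt_min => /andP[? ?].
have E (u v w : R) : u - v = (w - v) - (w - u) by ring.
rewrite (E _ _ (ip (vquot y s s') (vquot y t t'))) (le_trans (ler_normB (ip (vquot y s s') (vquot y t t') - c' s t) _))//.
by rewrite (splitr e) lerD//; [exact: Hd|apply: Hr; [exact: H1|exact: H2]].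
Qed.

Lemma kernel_Cm (m : nat) y (c : nat -> R -> R -> R) : si_complete V ->
  (forall s t, 0 <= s <= l -> 0 <= t <= l -> ip (y s) (y t) = c 0%N s t) ->
  (forall k, (k <= m)%N -> UC2 (c k)) ->
  (forall k, (k < m)%N ->
   forall s0 s1 t0 t1 : R, 0 <= s0 -> s0 < s1 -> s1 <= l -> 0 <= t0 -> t0 < t1 -> t1 <= l ->
    forall eta : R, 0 < eta -> exists xi zeta, [/\ s0 <= xi <= s1, t0 <= zeta <= t1 &
      `|c k s1 t1 - c k s0 t1 - c k s1 t0 + c k s0 t0
        - (s1 - s0) * (t1 - t0) * c k.+1 xi zeta| <= eta]) ->
  exists D : nat -> R -> V, [/\ D 0%N = y,
    forall k, (k < m)%N -> forall t, 0 <= t <= l -> vderiv (D k) t (D k.+1 t) &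
    forall k, (k <= m)%N -> forall s t, 0 <= s <= l -> 0 <= t <= l ->
      ip (D k s) (D k t) = c k s t].
Proof.
move=> Vc yc cc DD.
have : forall n, (n <= m)%N -> exists D : nat -> R -> V, [/\ D 0%N = y,
    forall k, (k < n)%N -> forall t, 0 <= t <= l -> vderiv (D k) t (D k.+1 t) &
    forall k, (k <= n)%N -> forall s t, 0 <= s <= l -> 0 <= t <= l ->
      ip (D k s) (D k t) = c k s t]; last by apply.
elim=> [_|n IH nm].
  by exists (fun=> y); split => // k; rewrite leqn0 => /eqP-> s t sl tl; exact: yc.
have [D [D0 D1 D2]] := IH (ltnW nm).
have [y' [y'1 y'2]] := kernel_vderiv Vc (D2 n (leqnn _)) (cc _ nm) (DD _ nm).
exists (fun k => if (k <= n)%N then D k else y'); split => //.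
  move=> k; rewrite ltnS => kn t tl; rewrite kn; have [kn'|] := ltnP k n.
    exact: D1.
  by move=> nk; have -> : k = n by [apply/eqP; rewrite eqn_leq kn]; exact: y'1.
move=> k; rewrite leq_eqVlt => /predU1P[->|]; first by rewrite ltnn.
by rewrite ltnS => kn; rewrite kn; exact: D2.
Qed.

End PathCalculus.

(** * The complete space of square-integrable random variables *)

Lemma Lfun2_mem (R : realType) (d : measure_display) (T : measurableType d)
    (mu : {measure set T -> \bar R}) (f : T -> R) : measurable_fun setT f ->
  (\int[mu]_w (f w ^+ 2)%:E < +oo)%E -> f \in Lfun mu 2%:E.
Proof.
move=> mf fi; apply/andP; split; first by rewrite inE.
rewrite inE/= /finite_norm unlock /= poweR_lty// (le_lt_trans _ fi)//.
apply: ge0_le_integral => //.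
- apply/measurable_EFinP.
  apply/(@measurableT_comp _ _ _ _ _ _ (fun x : R => x `^ 2)%R) => //.
  exact/measurableT_comp.
- by apply/measurable_EFinP; exact: measurable_funX.
- by move=> w _; rewrite lee_fin powR_mulrn// real_normK// num_real.
Qed.

Section L2Space.
Context {R : realType} {d : measure_display} {Omega : measurableType d}.
Variable P : probability Omega R.

Lemma one_le_two : (1 <= 2%:E :> \bar R)%E. Proof. by rewrite lee_fin ler1n. Qed.

Definition L2type := LfunType P one_le_two.

Definition L2ip (f g : L2type) : R := fine (\int[P]_w (f w * g w)%:E).

Lemma L2_integrableM (f g : L2type) : P.-integrable setT (fun w => (f w * g w)%:E).
Proof. by apply/Lfun1_integrable; apply: Lfun2_mul_Lfun1; exact: LfunP. Qed.

Lemma L2_measurable (f : L2type) : measurable_fun setT (f : Omega -> R).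
Proof. exact: measurable_funPT. Qed.

Lemma L2ipE (f g : L2type) : (L2ip f g)%:E = (\int[P]_w (f w * g w)%:E)%E.
Proof.
by rewrite /L2ip fineK//; apply: integrable_fin_num; [|exact: L2_integrableM].
Qed.

Lemma L2ipC (f g : L2type) : L2ip f g = L2ip g f.
Proof. by rewrite /L2ip; under eq_integral do rewrite mulrC. Qed.

Lemma L2ipDl (f g h : L2type) : L2ip (f + g) h = L2ip f h + L2ip g h.
Proof.
apply: EFin_inj; rewrite [RHS]EFinD !L2ipE -integralD//; try exact: L2_integrableM.
by apply: eq_integral => w _; rewrite -EFinD -mulrDl.
Qed.

Lemma L2ipZl (a : R) (f g : L2type) : L2ip (a *: f) g = a * L2ip f g.
Proof.
apply: EFin_inj; rewrite [RHS]EFinM !L2ipE -integralZl//; last exact: L2_integrableM.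
by apply: eq_integral => w _; rewrite -EFinM mulrA.
Qed.

Lemma L2ip_ge0 (f : L2type) : 0 <= L2ip f f.
Proof.
by rewrite -lee_fin L2ipE; apply: integral_ge0 => w _; rewrite lee_fin -expr2 sqr_ge0.
Qed.

Definition L2 : semiInner R := SemiInner L2ipC L2ipDl L2ipZl L2ip_ge0.

Lemma L2_normE (f : L2) : (sinorm f ^+ 2)%:E = (\int[P]_w ((f : L2type) w ^+ 2)%:E)%E.
Proof. by rewrite sqr_sinorm /= L2ipE. Qed.

Lemma L2_mem (f : Omega -> R) : measurable_fun setT f ->
  (\int[P]_w (f w ^+ 2)%:E < +oo)%E -> exists U : L2type, U = f :> (Omega -> R).
Proof. by move=> mf fi; exists (Lfun_Sub one_le_two (Lfun2_mem mf fi)). Qed.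

(** Young's inequality [|f| <= e / 2 + f ^+ 2 / (2 * e)], integrated against a probability. *)
Lemma L2_L1_le (f : L2) (e : R) : 0 < e -> sinorm f <= e ->
  (\int[P]_w `|(f : L2type) w|%:E <= e%:E)%E.
Proof.
move=> e0 fe; have mf := L2_measurable f.
have mf2 : measurable_fun setT (fun w => (f : L2type) w ^+ 2) by exact: measurable_funX.
apply: (@le_trans _ _ (\int[P]_w ((e / 2)%:E + ((2 * e)^-1 * (f : L2type) w ^+ 2)%:E))%E).
  apply: ge0_le_integral => //.
  - by apply/measurable_EFinP; exact: measurableT_comp.
  - by apply: emeasurable_funD => //; apply/measurable_EFinP; exact: measurable_funM.
  - move=> w _; rewrite -EFinD lee_fin.
    have -> : e / 2 + (2 * e)^-1 * (f : L2type) w ^+ 2 = (e ^+ 2 + `|(f : L2type) w| ^+ 2) / (2 * e).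
      by rewrite real_normK ?num_real//; field; rewrite gt_eqF.
    rewrite ler_pdivlMr ?mulr_gt0//; have := sqr_ge0 (e - `|(f : L2type) w|).
    by rewrite sqrrB -mulr_natr; lra.
rewrite ge0_integralD//; last 3 first.
- by move=> w _; rewrite lee_fin divr_ge0 ?ltW.
- by move=> w _; rewrite lee_fin mulr_ge0 ?sqr_ge0// invr_ge0 mulr_ge0 ?ltW.
- by apply/measurable_EFinP; exact: measurable_funM.
rewrite integral_cst// [X in (_ * X)%E](_ : _ = 1%E) ?mule1; last exact: probability_setT.
under eq_integral do rewrite EFinM.
rewrite ge0_integralZl//; last 3 first.
- exact/measurable_EFinP.
- by move=> w _; rewrite lee_fin sqr_ge0.
- by rewrite lee_fin invr_ge0 mulr_ge0 ?ltW.
rewrite -L2_normE -EFinM -EFinD lee_fin.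
have fe2 : sinorm f ^+ 2 <= e ^+ 2 by rewrite ler_pXn2r ?nnegrE ?sinorm_ge0 ?(ltW e0).
have : (2 * e)^-1 * sinorm f ^+ 2 <= (2 * e)^-1 * e ^+ 2.
  by rewrite ler_wpM2l// invr_ge0 mulr_ge0 ?ltW.
have -> : (2 * e)^-1 * e ^+ 2 = e / 2 by field; rewrite gt_eqF.
by move=> h; lra.
Qed.

(* Riesz-Fischer: a subsequence with summable L2 increments converges almost
   surely, and Fatou's lemma identifies its limit as the L2 limit. *)
Lemma L2_complete : si_complete L2.
Proof.
move=> X HX.
have /choice[N HN] : forall k : nat, exists N, forall n m, (N <= n)%N -> (N <= m)%N ->
    sinorm (X n - X m) <= 1 / (2 ^ k.+1)%:R.
  by move=> k; apply: HX; rewrite divr_gt0// ltr0n expn_gt0.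
(* This extraction bounds the norm of the k-th increment of [Y] by [1 / 2 ^ k.+1], which is
   summable. *)
pose M := fix M k := if k is k'.+1 then maxn (N k) (M k') else N 0%N.
have NM k : (N k <= M k)%N by case: k => //= k; exact: leq_maxl.
have MS k j : (k <= j)%N -> (M k <= M j)%N.
  move=> /subnK <-; elim: (j - k)%N => // i IH; rewrite addSn/=.
  by rewrite (leq_trans IH)// leq_maxr.
pose Y k : L2type := X (M k).
pose D k w := `|Y k.+1 w - Y k w|.
have D0 k w : (0 <= (D k w)%:E)%E by rewrite lee_fin normr_ge0.
have mD k : measurable_fun setT (D k).
  by apply: measurableT_comp => //; apply: measurable_funB; exact: L2_measurable.
have mDE k : measurable_fun setT (fun w => (D k w)%:E) by apply/measurable_EFinP.
have DE k : (\int[P]_w (D k w)%:E <= (1 / (2 ^ k.+1)%:R)%:E)%E.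
  have := @L2_L1_le (Y k.+1 - Y k : L2) (1 / (2 ^ k.+1)%:R).
  apply; first by rewrite divr_gt0// ltr0n expn_gt0.
  by apply: HN; [rewrite (leq_trans (NM k))// MS|exact: NM].
have sumD : (\int[P]_w (\sum_(0 <= k <oo) (D k w)%:E) < +oo)%E.
  rewrite integral_nneseries; [|by []|exact: mDE|by move=> n w _; exact: D0].
  rewrite (@le_lt_trans _ _ (1%:E))//; last exact: ltry.
  apply: le_trans (epsilon_trick0 xpredT (ler01 : 0 <= 1 :> R)).
  apply: lee_nneseries => [k _ _|k _]; [|exact: DE].
  by apply: integral_ge0 => w _; exact: D0.
have msum : measurable_fun setT (fun w => \sum_(0 <= k <oo) (D k w)%:E)%E.
  by apply: ge0_emeasurable_sum => [k w _ _|k _]; [exact: D0|exact: mDE].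
have Ycvg : {ae P, forall w, cvgn (fun k => Y k w)}.
  have := @integrable_ae _ _ _ P setT measurableT (fun w => \sum_(0 <= k <oo) (D k w)%:E)%E.
  have isum : P.-integrable setT (fun w => \sum_(0 <= k <oo) (D k w)%:E)%E.
    apply/integrableP; split => //.
    under eq_integral do rewrite gee0_abs ?nneseries_ge0//.
    exact: sumD.
  move=> /(_ isum); apply: negligibleS => w /=; apply: contra_not => /(_ I) fin.
  have /normed_cvg : cvgn [normed series (telescope (fun k => Y k w))].
    apply: (@nnseries_is_cvg _ (fun k => D k w)) => [k|]; first exact: normr_ge0.
    by rewrite -ge0_fin_numE//; apply: nneseries_ge0 => k _ _; exact: D0.
  rewrite telescopeK => /cvg_ex[a ya]; apply/cvg_ex; exists (a + Y 0%N w).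
  have -> : (fun k => Y k w) = (fun k => (Y k w - Y 0%N w) + Y 0%N w).
    by apply/funext => k; rewrite subrK.
  by apply: cvgD => //; exact: cvg_cst.
(* The upper limit is measurable everywhere and agrees with the limit wherever the latter exists. *)
pose U w := fine (limn_esup (fun k => (Y k w)%:E)).
have mU : measurable_fun setT U.
  apply: measurableT_comp; first exact: fine_measurable.
  by apply: measurable_fun_limn_esup => k; apply/measurable_EFinP; exact: L2_measurable.
have YU w : cvgn (fun k => Y k w) -> (fun k => Y k w) @ \oo --> U w.
  move=> /[dup] c /cvgP/cvg_lim cl; rewrite /U is_cvg_limn_esupE.
    by rewrite EFin_lim.
  by apply/cvg_ex; exists (limn (fun k => Y k w))%:E; apply: cvg_EFin => //; near=> k.
have key j : (\int[P]_w ((U w - Y j w) ^+ 2)%:E <= ((1 / (2 ^ j.+1)%:R) ^+ 2)%:E)%E.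
  pose f k w := ((Y k w - Y j w) ^+ 2)%:E.
  have mf k : measurable_fun setT (f k).
    apply/measurable_EFinP/measurable_funX/measurable_funB; exact: L2_measurable.
  have mlim : measurable_fun setT (fun w => limn_einf (f^~ w)).
    rewrite (_ : (fun w => _) = (fun w => limn_esup (einfs (f^~ w)))).
      by apply: measurable_fun_limn_esup; exact: measurable_fun_einfs.
    by apply/funext => w; rewrite limn_einf_lim is_cvg_limn_esupE//; exact: is_cvg_einfs.
  have f0 k w : (0 <= f k w)%E by rewrite lee_fin sqr_ge0.
  apply: (@le_trans _ _ (\int[P]_w limn_einf (f^~ w))%E).
    apply: ae_ge0_le_integral => //.
    - by move=> w _; rewrite lee_fin sqr_ge0.
    - by apply/measurable_EFinP/measurable_funX/measurable_funB => //; exact: L2_measurable.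
    - move=> w _; rewrite limn_einf_lim; apply: lime_ge; first exact: is_cvg_einfs.
      near=> k; apply: le_ereal_inf_tmp => _ [i _ <-]; exact: f0.
    - apply: negligibleS Ycvg => w /=; apply: contra_not => c _.
      have fc : f^~ w @ \oo --> ((U w - Y j w) ^+ 2)%:E.
        apply: cvg_EFin; first by near=> k.
        have cY : (fun k => Y k w - Y j w) @ \oo --> U w - Y j w.
          by apply: cvgB; [exact: YU|exact: cvg_cst].
        rewrite expr2 (_ : fine \o _ = (fun k => (Y k w - Y j w) * (Y k w - Y j w))).
          exact: cvgM.
        by apply/funext.
      by rewrite is_cvg_limn_einfE; [rewrite (cvg_lim _ fc)|apply/cvg_ex; eexists; exact: fc].
  apply: (le_trans (fatou _ _ _ _)) => //.
  rewrite limn_einf_lim; apply: lime_le; first exact: is_cvg_einfs.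
  near=> k; apply: (@le_trans _ _ (\int[P]_w f k w)%E).
    by apply: ereal_inf_lbound; exists k => //=.
  rewrite /f -(L2_normE (Y k - Y j : L2)) lee_fin ler_pXn2r ?nnegrE ?sinorm_ge0//.
  apply: HN; last exact: NM.
  rewrite (leq_trans (NM j))// MS//; near: k; exact: nbhs_infty_ge.
(* [key 0] gives the square integrability of [U - Y 0]; adding [Y 0] back yields the limit as a
   vector. *)
have [W WE] : exists W : L2type, W = (fun w => U w - Y 0%N w) :> (Omega -> R).
  apply: L2_mem; first by apply: measurable_funB => //; exact: L2_measurable.
  exact: le_lt_trans (key 0%N) (ltry _).
exists (W + Y 0%N) => e e0.
have e20 : 0 < e / 2 by rewrite divr_gt0.
have [j je] : exists j, 1 / (2 ^ j.+1)%:R <= e / 2.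
  exists (Num.truncn (e / 2)^-1); rewrite div1r.
  rewrite -[leRHS]invrK lef_pV2 ?posrE ?invr_gt0// ?ltr0n ?expn_gt0//.
  by rewrite (le_trans (ltW (truncnS_gt _)))// ler_nat ltnW// ltn_expl.
exists (M j) => n nM; rewrite (le_trans (sinormB_le _ (Y j : L2) _))// (splitr e) lerD//.
  by rewrite (le_trans _ je)// HN// (leq_trans (NM j)).
rewrite (le_trans _ je)// sinormBC sinorm_le ?divr_ge0// -lee_fin -sqr_sinorm L2_normE.
rewrite (le_trans _ (key j))//.
rewrite (eq_integral (fun w => ((U w - Y j w) ^+ 2)%:E))// => w _.
congr (_ ^+ 2)%:E; rewrite -[LHS]/(W w + Y 0%N w - Y j w) WE/=; ring.
Unshelve. all: by end_near.
Qed.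
End L2Space.

(** * Completely monotonic functions and the Hausdorff moment problem *)

Section CompletelyMonotone.
Context {R : realType}.

(* [F k] stands for the k-th derivative of a completely monotonic function on
   the open half-line. *)
Definition cm_seq (F : nat -> R -> R) := forall (k : nat) (t : R), 0 < t ->
  is_derive t (1 : R) (F k) (F k.+1 t) /\ 0 <= (-1) ^+ k * F k t.

Implicit Types (F : nat -> R -> R).

Lemma cm_seq_derive1n (psi : R -> R) :
  completely_monotonic psi -> cm_seq (fun k => derive1n k psi).
Proof.
move=> [_ dpsi spsi] k t t0; split; last exact: spsi.
by rewrite derive1nS derive1E; apply: DeriveDef => //; exact: dpsi.
Qed.

Lemma is_derive1_MVT (f df : R -> R) (a b : R) : a < b ->
  (forall x, a <= x -> x <= b -> is_derive x (1 : R) f (df x)) ->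
  exists c, [/\ a < c, c < b & f b - f a = df c * (b - a)].
Proof.
move=> ab fd; have [| |c] := @MVT R f df a b ab.
- by move=> x; rewrite in_itv/= => /andP[/ltW ? /ltW ?]; exact: fd.
- apply: derivable_within_continuous => x; rewrite in_itv/= => /andP[ax xb].
  by have := fd x ax xb; case.
- by rewrite in_itv/= => /andP[ac cb] h; exists c.
Qed.

Lemma cm_seq_MVT F k (s t : R) : cm_seq F -> 0 < s -> s < t ->
  exists c, [/\ s < c, c < t & F k t - F k s = F k.+1 c * (t - s)].
Proof.
move=> cF s0 st; apply: is_derive1_MVT => // x sx xt.
by have [] := cF k x (lt_le_trans s0 sx).
Qed.

Lemma cm_seq_nonincreasing F k (s t : R) : cm_seq F -> 0 < s -> s <= t ->
  (-1) ^+ k * F k t <= (-1) ^+ k * F k s.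
Proof.
move=> cF s0; rewrite le_eqVlt => /predU1P[->//|st].
have [c [sc ct E]] := cm_seq_MVT k cF s0 st.
rewrite -subr_le0 -mulrBr E mulrA -oppr_ge0 -mulNr mulr_ge0 ?subr_ge0 ?(ltW st)//.
have [_] := cF k.+1 c (lt_trans s0 sc); rewrite exprS; lra.
Qed.

Lemma cm_seq_shift F (h : R) : 0 <= h -> cm_seq F -> cm_seq (fun k t => F k (t + h)).
Proof.
move=> h0 cF k t t0; have th0 : 0 < t + h by rewrite ltr_wpDr.
have [dF sF] := cF k (t + h) th0; split => //.
rewrite -[F k.+1 (t + h)]mulr1; apply: is_derive1_comp => //.
by rewrite -[X in is_derive _ _ _ X]addr0; apply: is_deriveD.
Qed.

Lemma cm_seq_diff F (h : R) : 0 <= h -> cm_seq F ->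
  cm_seq (fun k t => F k t - F k (t + h)).
Proof.
move=> h0 cF k t t0; have [dF _] := cF k t t0; have [dF' _] := cm_seq_shift h0 cF k t0.
split; first exact: is_deriveB.
by rewrite mulrBr subr_ge0 cm_seq_nonincreasing// lerDl.
Qed.

(** For the moments [mu] of a measure on [0, 1], this is the integral of x^k (1 - x)^r. *)
Fixpoint seq_diff (r : nat) (mu : nat -> R) (k : nat) : R :=
  if r is r'.+1 then seq_diff r' mu k - seq_diff r' mu k.+1 else mu k.

Lemma seq_diffS r mu k :
  seq_diff r.+1 mu k = seq_diff r (fun k => mu k - mu k.+1) k.
Proof.
elim: r k => [//|r IH] k.
by rewrite -[LHS]/(seq_diff r.+1 mu k - seq_diff r.+1 mu k.+1) !IH.
Qed.

Lemma eq_seq_diff r mu nu k : mu =1 nu -> seq_diff r mu k = seq_diff r nu k.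
Proof. by move=> E; elim: r k => [|r IH] k /=; rewrite ?E// !IH. Qed.

(** Taking a difference of step [h] preserves complete monotonicity, so an r-th difference of the
    samples is again a sample of a completely monotonic function. *)
Lemma cm_seq_diff_ge0 F (t0 h : R) r k : 0 < t0 -> 0 <= h -> cm_seq F ->
  0 <= seq_diff r (fun j => F 0%N (t0 + j%:R * h)) k.
Proof.
move=> t00 h0; elim: r F k => [|r IH] F k cF.
  have p : 0 < t0 + k%:R * h by rewrite ltr_wpDr// mulr_ge0.
  by have [_] := cF 0%N _ p; rewrite mul1r.
rewrite seq_diffS; have := IH _ k (cm_seq_diff h0 cF).
congr (0 <= _); apply: eq_seq_diff => j.
by rewrite -addrA -[j.+1%:R]natr1 mulrDl mul1r.
Qed.

(** Formally the expansion of x^j (x + (1 - x))^N; the induction is Pascal's rule. *)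
Lemma hausdorff_sum mu N j :
  mu j = \sum_(i < N.+1) 'C(N, i)%:R * seq_diff (N - i) mu (j + i).
Proof.
elim: N => [|N IH]; first by rewrite big_ord1 bin0 mul1r subnn addn0.
rewrite IH; pose a i := seq_diff (N.+1 - i) mu (j + i).
have aE i : (i < N.+1)%N -> seq_diff (N - i) mu (j + i) = a i + a i.+1.
  by move=> iN; rewrite /a subSS addnS subSn//= subrK.
rewrite (eq_bigr (fun i : 'I_N.+1 => 'C(N, i)%:R * a i + 'C(N, i)%:R * a i.+1)); last first.
  by move=> i _; rewrite aE// mulrDr.
rewrite big_split/=.
have -> : \sum_(i < N.+1) 'C(N, i)%:R * a i = a 0%N + \sum_(i < N.+1) 'C(N, i.+1)%:R * a i.+1.
  rewrite big_ord_recl/= bin0 mul1r; congr (_ + _).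
  by rewrite [RHS]big_ord_recr/= bin_small// mul0r addr0.
rewrite [RHS]big_ord_recl/= bin0 mul1r -addrA; congr (_ + _).
by rewrite -big_split/=; apply: eq_bigr => i _; rewrite /bump/= add1n binS natrD mulrDl.
Qed.

Lemma bin_ffact_ratio n k j : (k <= n)%N -> (j <= k)%N ->
  ('C(n - j, k - j) * n ^_ j = 'C(n, k) * k ^_ j)%N.
Proof.
move=> kn jk; have jn := leq_trans jk kn.
have f1 := bin_fact kn; have f2 := @bin_fact (n - j) (k - j) (leq_sub2r j kn).
have f3 := ffact_fact jn; have f4 := ffact_fact jk.
have e : (n - j - (k - j) = n - k)%N by lia.
rewrite e in f2.
have p : (0 < (k - j)`! * (n - k)`!)%N by rewrite muln_gt0 !fact_gt0.
apply/eqP; rewrite -(eqn_pmul2r p); apply/eqP.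
by transitivity (n`!); [rewrite -f3 -f2; ring|rewrite -f1 -f4; ring].
Qed.

(** The weights do not depend on [j]: for the moments of a measure, they are the integrals of the
    Bernstein polynomials of degree [n]. The last factor is nearly (k/n)^j, the j-th power of an
    atom. *)
Lemma hausdorff_moment mu n j : (j <= n)%N -> mu j =
  \sum_(k < n.+1) ('C(n, k)%:R * seq_diff (n - k) mu k) * ((k ^_ j)%:R / (n ^_ j)%:R).
Proof.
move=> jn; rewrite (hausdorff_sum mu (n - j) j).
pose f k := ('C(n, k)%:R * seq_diff (n - k) mu k) * ((k ^_ j)%:R / (n ^_ j)%:R).
rewrite -[RHS](big_mkord xpredT f) (@big_cat_nat _ _ _ j)//=; last first.
  exact: leq_trans jn _.
rewrite [X in _ = X + _]big1_seq ?add0r; last first.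
  move=> k /andP[_]; rewrite mem_index_iota => /andP[_ kj].
  by rewrite /f ffact_small// mul0r mulr0.
have -> : \sum_(j <= k < n.+1) f k = \sum_(0 <= i < (n - j).+1) f (i + j)%N.
  by have := @big_addn R 0 +%R 0 n.+1 j xpredT f; rewrite add0n subSn.
rewrite big_mkord; apply: eq_bigr => i _.
have ijn : (i + j <= n)%N by have := ltn_ord i; lia.
have := bin_ffact_ratio ijn (leq_addl i j); rewrite addnK => h.
rewrite /f mulrAC -subnDA [(j + i)%N]addnC; congr (_ * _).
have p : (n ^_ j)%:R != 0 :> R by rewrite pnatr_eq0 -lt0n ffact_gt0.
by apply: (mulIf p); rewrite -natrM h natrM mulrA divfK.
Qed.

(** Each new factor [(k - j) / (n - j)] is compared with [k / n]: they differ by at most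
    [j / (n - j)], uniformly in [k]. For [k < j] the truncated difference makes the factor 0, and
    [k / n] itself is below that bound. *)
Lemma falling_ratio_cvg j (e : R) : 0 < e -> exists n0, forall n k,
  (n0 <= n)%N -> (k <= n)%N ->
  `|(k ^_ j)%:R / (n ^_ j)%:R - (k%:R / n%:R) ^+ j| <= e.
Proof.
elim: j e => [|j IH] e e0.
  by exists 0%N => n k _ _; rewrite !ffactn0 divr1 expr0 subrr normr0 ltW.
have e20 : 0 < e / 2 by rewrite divr_gt0.
have [n0 H] := IH _ e20.
exists (maxn n0 (j + (Num.truncn (j%:R / (e / 2))).+1)) => n k.
rewrite geq_max => /andP[n0n nj kn].
have jn : (j < n)%N by lia.
have njp : (0 : R) < (n - j)%:R by rewrite ltr0n subn_gt0.
have np : (0 : R) < n%:R by rewrite ltr0n; lia.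
have fp i : (i <= n)%N -> (0 : R) < (n ^_ i)%:R by move=> ?; rewrite ltr0n ffact_gt0.
pose r := (k ^_ j)%:R / (n ^_ j)%:R : R; pose x := k%:R / n%:R : R.
have x01 : 0 <= x <= 1 by rewrite divr_ge0//= ler_pdivrMr// mul1r ler_nat.
have jdiv : j%:R / (n - j)%:R <= e / 2.
  rewrite ler_pdivrMr// [leRHS]mulrC -ler_pdivrMr//.
  by rewrite (le_trans (ltW (truncnS_gt _)))// ler_nat ltn_subRL; move: nj; rewrite addnS.
have close : `|(k - j)%:R / (n - j)%:R - x| <= e / 2.
  apply: le_trans jdiv; have [kj|jk] := ltnP k j.
    have -> : (k - j = 0)%N by lia.
    rewrite mul0r sub0r normrN ger0_norm; last by case/andP: x01.
    rewrite /x ler_pdivrMr// mulrAC ler_pdivlMr//.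
    by rewrite -!natrM ler_nat; apply: leq_mul; [exact: ltnW|exact: leq_subr].
  rewrite /x !natrB ?(ltnW jn)//.
  have nj0 : (0 : R) < n%:R - j%:R by rewrite -natrB// ltnW.
  have -> : (k%:R - j%:R) / (n%:R - j%:R) - k%:R / n%:R =
      - (j%:R * ((n%:R - k%:R) / n%:R) / (n%:R - j%:R)) :> R.
    by field; rewrite !gt_eqF.
  have q0 : 0 <= (n%:R - k%:R) / n%:R :> R by rewrite divr_ge0// subr_ge0 ler_nat.
  rewrite normrN ger0_norm; last by apply: divr_ge0 (ltW nj0); exact: mulr_ge0.
  rewrite ler_pM2r ?invr_gt0//.
  rewrite ler_piMr// ler_pdivrMr// mul1r lerBlDr lerDl.
  by [].
have r01 : 0 <= r <= 1.
  rewrite divr_ge0//= ler_pdivrMr ?fp ?(ltnW jn)// mul1r ler_nat.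
  by elim: (j) => // i ih; rewrite !ffactnSr leq_mul// leq_sub2r.
have q01 : 0 <= (k - j)%:R / (n - j)%:R :> R /\ (k - j)%:R / (n - j)%:R <= 1 :> R.
  by rewrite divr_ge0// ler_pdivrMr// mul1r ler_nat leq_sub2r.
have -> : (k ^_ j.+1)%:R / (n ^_ j.+1)%:R = r * ((k - j)%:R / (n - j)%:R) :> R.
  by rewrite !ffactnSr !natrM /r; field; rewrite !gt_eqF// fp// ltnW.
rewrite exprSr -/x.
have E (q y : R) : r * q - y * x = (r - y) * x + r * (q - x) by ring.
rewrite E (le_trans (ler_normD _ _))// (splitr e) lerD// normrM.
  case/andP: x01 => x0 x1; rewrite (ger0_norm x0) (le_trans _ (H n k n0n kn))//.
  by rewrite ler_piMr.
case/andP: r01 => r0 r1; rewrite (ger0_norm r0) (le_trans _ close)//.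
by rewrite ler_piMl.
Qed.

(* Hausdorff's solution of the moment problem, at a finite level. *)
Lemma hausdorff_approx (mu : nat -> R) (J : nat) (e : R) :
  (forall r k, 0 <= seq_diff r mu k) -> 0 < e ->
  exists (n : nat) (lam x : 'I_n -> R), [/\ forall k, 0 <= lam k,
    forall k, 0 <= x k <= 1, \sum_k lam k = mu 0%N &
    forall j, (j <= J)%N -> `|mu j - \sum_k lam k * x k ^+ j| <= e].
Proof.
move=> mu0 e0; have m0 : 0 <= mu 0%N := mu0 0%N 0%N.
(* The weights will sum to [mu 0]; adding 1 covers the case where it vanishes. *)
pose e' := e / (mu 0%N + 1); have e'0 : 0 < e' by rewrite divr_gt0// ltr_wpDl.
have [n0 H] : exists n0, forall j, (j <= J)%N -> forall n k, (n0 <= n)%N -> (k <= n)%N ->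
    `|(k ^_ j)%:R / (n ^_ j)%:R - (k%:R / n%:R) ^+ j| <= e'.
  elim: (J) => [|J' [n0 IH]].
    have [n0 H] := falling_ratio_cvg 0%N e'0; exists n0 => j; rewrite leqn0 => /eqP->.
    exact: H.
  have [n1 H] := falling_ratio_cvg J'.+1 e'0; exists (maxn n0 n1) => j jJ n k.
  rewrite geq_max => /andP[n0n n1n] kn; move: jJ; rewrite leq_eqVlt => /predU1P[->|].
    exact: H.
  by rewrite ltnS => jJ; exact: IH.
pose n := maxn (maxn n0 J) 1.
pose lam (k : 'I_n.+1) := 'C(n, k)%:R * seq_diff (n - k) mu k.
have lam0 k : 0 <= lam k by rewrite mulr_ge0.
have n0n : (n0 <= n)%N by rewrite /n; lia.
have Jn : (J <= n)%N by rewrite /n; lia.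
have np : (0 : R) < n%:R by rewrite ltr0n /n; lia.
have slam : \sum_k lam k = mu 0%N.
  rewrite (hausdorff_moment mu (leq0n n)); apply: eq_bigr => k _.
  by rewrite !ffactn0 divr1 mulr1.
exists n.+1, lam, (fun k => k%:R / n%:R); split => //.
  move=> k; rewrite divr_ge0//= ler_pdivrMr// mul1r ler_nat; exact: (ltn_ord k).
move=> j jJ; rewrite (hausdorff_moment mu (leq_trans jJ Jn)) -sumrB.
apply: (le_trans (ler_norm_sum _ _ _)).
apply: (@le_trans _ _ (\sum_k lam k * e')).
  apply: ler_sum => k _; rewrite -/(lam k) -mulrBr normrM (ger0_norm (lam0 k)).
  by apply: ler_wpM2l => //; apply: H => //; exact: (ltn_ord k).
rewrite -mulr_suml slam /e' mulrA ler_pdivrMr ?ltr_wpDl//.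
by rewrite mulrDr mulr1 [mu 0%N * e]mulrC lerDl ltW.
Qed.

End CompletelyMonotone.

(** * Finite mixtures of powers approximating a completely monotonic function *)

Section BernsteinApproximation.
Context {R : realType}.
Implicit Types (F : nat -> R -> R) (psi : R -> R).

(** The gaps [x ^+ i - x ^+ i.+1] decrease with [i] and the first [j.+1] of them sum to
    [1 - x ^+ j.+1], so the last one is at most their average. *)
Lemma expr_gap_le (x : R) j : 0 <= x <= 1 -> x ^+ j - x ^+ j.+1 <= j.+1%:R^-1.
Proof.
move=> /andP[x0 x1]; have H : j.+1%:R * (x ^+ j - x ^+ j.+1) <= 1 - x ^+ j.+1.
  elim: j => [|j IH]; first by rewrite mul1r.
  have := ler_wpM2l x0 IH; rewrite -[j.+2%:R]natr1 ![x ^+ _.+1]exprS -!exprS.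
  have p1 : x ^+ j.+1 <= 1 by exact: exprn_ile1.
  have : 0 <= (1 - x) * (1 - x ^+ j.+1) by rewrite mulr_ge0// subr_ge0.
  rewrite !exprS; set y := x ^+ j; set n := j.+1%:R => *; lra.
rewrite -[leRHS]div1r ler_pdivlMr// mulrC (le_trans H)// gerBl; exact: exprn_ge0.
Qed.

Lemma expr_powR_close (x s : R) : 0 <= x <= 1 -> 0 < s ->
  `|x ^+ Num.truncn s - x `^ s| <= s^-1.
Proof.
move=> /andP[x0 x1] s0; have s0' := ltW s0; set j := Num.truncn s.
have js : j%:R <= s by rewrite truncn_le.
have sj : s < j.+1%:R by exact: truncnS_gt.
have sV : j.+1%:R^-1 <= s^-1 by rewrite lef_pV2 ?posrE// ltW.
have [->|xn0] := eqVneq x 0.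
  (* When [j = 0], the power [0 ^+ 0 = 1] is compared with 0; the bound holds because [s < 1]. *)
  rewrite powR0 ?gt_eqF// subr0; have [j0|jn0] := eqVneq j 0%N.
    by move: sV; rewrite j0 expr0 normr1 invr1.
  by rewrite expr0n (negbTE jn0) normr0 invr_ge0.
have xp : 0 < x by rewrite lt_def xn0.
have x01 : 0 < x <= 1 by rewrite xp.
have h1 : x `^ s <= x ^+ j by rewrite -powR_mulrn//; exact: ger_powR.
have h2 : x ^+ j.+1 <= x `^ s by rewrite -powR_mulrn//; exact/ger_powR/ltW.
rewrite ger0_norm ?subr_ge0//; apply: le_trans sV.
by apply: (le_trans _ (@expr_gap_le x j _)); rewrite ?x0// lerD2l lerN2.
Qed.

Lemma cm_seq_lipschitz F (s t : R) : cm_seq F -> 0 < s -> s <= t ->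
  `|F 0%N t - F 0%N s| <= `|F 1%N s| * (t - s).
Proof.
move=> cF s0; rewrite le_eqVlt => /predU1P[->|st]; first by rewrite !subrr normr0 mulr0.
have [c [sc ct ->]] := cm_seq_MVT 0 cF s0 st.
rewrite normrM [X in _ * X]ger0_norm ?subr_ge0 ?(ltW st)// ler_pM2r ?subr_gt0//.
have := cm_seq_nonincreasing 1 cF s0 (ltW sc).
have [_] := cF 1%N c (lt_trans s0 sc); have [_] := cF 1%N s s0.
by rewrite !expr1 !mulN1r => h1 h2 h3; rewrite !ler0_norm; lra.
Qed.

(** Hausdorff's theorem is applied to the samples of [F 0] on a grid of step [1 / N] started at
    [t0]; an atom [x] for the sequence becomes the base [x ^+ N]. Two further errors are of order
    [1 / N]: rounding [t i] down to the grid, controlled by the Lipschitz constant at [t0 > 0], and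
    rounding the exponent. *)
Lemma cm_seq_bernstein F (t0 : R) (I : finType) (t : I -> R) (e : R) : cm_seq F ->
  0 < t0 -> (forall i, 0 <= t i) -> 0 < e ->
  exists (n : nat) (lam x : 'I_n -> R), [/\ forall k, 0 <= lam k,
    forall k, 0 <= x k <= 1 &
    forall i, `|F 0%N (t0 + t i) - \sum_k lam k * x k `^ t i| <= e].
Proof.
move=> cF t00 tge e0; pose L := `|F 1%N t0|; pose f0 := F 0%N t0.
have f00 : 0 <= f0 by have [_] := cF 0%N t0 t00; rewrite mul1r.
have e30 : 0 < e / 3 by rewrite divr_gt0.
(* [N] is at least [L / (e / 3)] and every [B i], which bounds each rounding error by [e / 3]; a
   zero [t i] gives [B i = 0] and causes no rounding. *)
pose B i := f0 / (t i * (e / 3)).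
have B0 i : 0 <= B i by rewrite divr_ge0// mulr_ge0// ltW.
pose N := (Num.truncn (L / (e / 3) + \sum_i B i)).+1.
have Np : (0 : R) < N%:R by [].
have N1 : L / (e / 3) + \sum_i B i <= N%:R by exact/ltW/truncnS_gt.
have NL : L / N%:R <= e / 3.
  rewrite ler_pdivrMr// mulrC -ler_pdivrMr// (le_trans _ N1)// lerDl.
  exact: sumr_ge0.
have BN i : B i <= N%:R.
  have hs : 0 <= \sum_(k | k != i) B k by apply: sumr_ge0.
  have hL : 0 <= L / (e / 3) by rewrite divr_ge0 ?normr_ge0// ltW.
  by move: N1; rewrite (bigD1 i)//=; lra.
have NB i : 0 < t i -> f0 / (t i * N%:R) <= e / 3.
  move=> ti; have := BN i; rewrite /B !ler_pdivrMr ?mulr_gt0//.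
  by congr (_ <= _); ring.
pose h := (N%:R)^-1 : R; have h0 : 0 <= h by rewrite invr_ge0.
pose j i := Num.truncn (t i * N%:R).
have tN i : 0 <= t i * N%:R by rewrite mulr_ge0.
have [n [lam [x [lam0 x01 slam H]]]] := @hausdorff_approx R
  (fun j => F 0%N (t0 + j%:R * h)) (\sum_i j i) _
  (fun r k => cm_seq_diff_ge0 r k t00 h0 cF) e30.
rewrite mul0r addr0 in slam.
exists n, lam, (fun k => x k ^+ N); split => //.
  by move=> k; have /andP[? ?] := x01 k; rewrite exprn_ge0//= exprn_ile1.
move=> i; have jJ : (j i <= \sum_i j i)%N by rewrite (bigD1 i)//= leq_addr.
have hj := H _ jJ.
have d1 : `|F 0%N (t0 + t i) - F 0%N (t0 + (j i)%:R * h)| <= e / 3.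
  have le1 : (j i)%:R * h <= t i by rewrite ler_pdivrMr// truncn_le.
  have le2 : t i - (j i)%:R * h <= h.
    rewrite lerBlDr -{1}[h]mul1r -mulrDl addrC natr1 ler_pdivlMr//.
    exact/ltW/truncnS_gt.
  have p : 0 < t0 + (j i)%:R * h by rewrite ltr_wpDr// mulr_ge0.
  have := cm_seq_lipschitz cF p (_ : _ <= t0 + t i); rewrite lerD2l => /(_ le1) hh.
  apply: (le_trans hh); apply: le_trans NL; apply: ler_pM => //.
  - by rewrite subr_ge0 lerD2l.
  - have := cm_seq_nonincreasing 1 cF t00 (_ : t0 <= t0 + (j i)%:R * h).
    rewrite lerDl mulr_ge0// => /(_ isT).
    have [_] := cF 1%N _ p; have [_] := cF 1%N _ t00.
    by rewrite /L !expr1 !mulN1r => ? ? ?; rewrite !ler0_norm; lra.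
  - by rewrite opprD addrACA subrr add0r.
have d2 : `|\sum_k lam k * x k ^+ j i - \sum_k lam k * (x k ^+ N) `^ t i| <= e / 3.
  have [ti0|tin0] := eqVneq (t i) 0.
    rewrite (eq_bigr (fun k => lam k * (x k ^+ N) `^ t i)) ?subrr ?normr0 ?(ltW e30)//.
    move=> k _; rewrite ti0 powRr0 /j ti0 mul0r.
    by have -> : Num.truncn (0 : R) = 0%N by exact: truncn0.
  have tip : 0 < t i by rewrite lt_def tin0 tge.
  apply: le_trans (NB i tip); rewrite /f0 -slam -sumrB.
  rewrite (le_trans (ler_norm_sum _ _ _))// mulr_suml; apply: ler_sum => k _.
  rewrite -mulrBr normrM (ger0_norm (lam0 k)) ler_wpM2l//.
  have /andP[xk0 xk1] := x01 k.
  rewrite -(powR_mulrn N xk0) -powRrM [N%:R * _]mulrC; apply: expr_powR_close => //.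
  by rewrite mulr_gt0.
have E (u v w z : R) : u - z = (u - v) + (v - w) + (w - z) by ring.
rewrite (E _ (F 0%N (t0 + (j i)%:R * h)) (\sum_k lam k * x k ^+ j i)).
apply: (@le_trans _ _ (e / 3 + e / 3 + e / 3)); last by lra.
by rewrite (le_trans (ler_normD _ _))// lerD// (le_trans (ler_normD _ _))// lerD.
Qed.

Lemma cm_right_continuous psi (t e : R) : completely_monotonic psi -> 0 <= t -> 0 < e ->
  exists2 d : R, 0 < d & forall s, 0 <= s -> s < d -> `|psi (s + t) - psi t| <= e.
Proof.
move=> [/continuous_within_itvcyP[c1 c2] _ _].
rewrite le_eqVlt => /predU1P[<-|t0] e0.
  move/cvgrPdist_le : c2 => /(_ _ e0)[d /= d0 H]; exists d => // s.
  rewrite le_eqVlt => /predU1P[<-|s0] sd; first by rewrite addr0 subrr normr0 ltW.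
  by rewrite addr0 distrC; apply: H => //=; rewrite sub0r normrN gtr0_norm.
have := c1 t; rewrite in_itv/= t0 => /(_ isT)/cvgrPdist_le/(_ _ e0)[d /= d0 H].
exists d => // s s0 sd; rewrite distrC; apply: H.
by rewrite /= opprD addrCA subrr addr0 normrN ger0_norm.
Qed.

Lemma cm_bernstein psi (I : finType) (t : I -> R) (e : R) : completely_monotonic psi ->
  (forall i, 0 <= t i) -> 0 < e ->
  exists (n : nat) (lam x : 'I_n -> R), [/\ forall k, 0 <= lam k,
    forall k, 0 <= x k <= 1 &
    forall i, `|psi (t i) - \sum_k lam k * x k `^ t i| <= e].
Proof.
move=> cpsi tge e0; have e20 : 0 < e / 2 by rewrite divr_gt0.
have /choice[d /all_and2[d0 Hd]] : forall i, exists d : R, 0 < d /\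
    forall s, 0 <= s -> s < d -> `|psi (s + t i) - psi (t i)| <= e / 2.
  by move=> i; have [d d0 H] := cm_right_continuous cpsi (tge i) e20; exists d.
(* A shift below every [d i], positive even when [I] is empty. *)
pose t0 := (1 + \sum_i (d i)^-1)^-1 : R.
have s0 : 0 < 1 + \sum_i (d i)^-1.
  by rewrite ltr_pwDl// sumr_ge0// => i _; rewrite invr_ge0 ltW.
have t00 : 0 < t0 by rewrite invr_gt0.
have t0d i : t0 < d i.
  rewrite /t0 invf_plt ?posrE// (bigD1 i)//= addrCA ltrDl ltr_pwDl// sumr_ge0// => k _.
  by rewrite invr_ge0 ltW.
have [n [lam [x [lam0 x01 H]]]] := cm_seq_bernstein (cm_seq_derive1n cpsi) t00 tge e20.
exists n, lam, x; split => // i.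
have E (u v w : R) : u - w = - (v - u) + (v - w) by ring.
rewrite (E _ (psi (t0 + t i))) (le_trans (ler_normD _ _))// (splitr e) lerD// ?H// normrN.
exact/Hd/t0d/ltW.
Qed.

End BernsteinApproximation.

(** * Strict positivity inherited from mixtures *)

Section StrictPositivity.
Context {R : realType}.

Lemma cvg_sumr (T I : Type) (F : set_system T) {FF : Filter F} (r : seq I)
    (f : I -> T -> R) (a : I -> R) :
  (forall i, f i x @[x --> F] --> a i) ->
  (\sum_(i <- r) f i x) @[x --> F] --> \sum_(i <- r) a i.
Proof.
move=> fa; elim: r => [|i r IH].
  rewrite big_nil; under eq_fun do rewrite big_nil; exact: cvg_cst.
rewrite big_cons; under eq_fun do rewrite big_cons; exact: cvgD.
Qed.

(** [Num.max] extends the power continuously to negative arguments; [g = 0] is apart, as it gives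
    the constant 1, at 0 too. *)
Lemma continuous_powR_max (g : R) : 0 <= g ->
  continuous (fun x : R => Num.max 0 x `^ g).
Proof.
rewrite le_eqVlt => /predU1P[<-|g0] x.
  under eq_fun do rewrite powRr0; exact: cvg_cst.
have [x0|x0|->] := ltgtP x 0.
- apply: (@near_cst_continuous _ _ (0 `^ g)); near=> y; rewrite max_l//; apply/ltW.
  by near: y; exact: lt_nbhsl.
- have h : {near x, (fun y => expR (g * ln y)) =1 (fun y => Num.max 0 y `^ g)}.
    near=> y; have y0 : 0 < y by near: y; exact: lt_nbhsr.
    by rewrite max_r ?(ltW y0)// /powR gt_eqF.
  have c : expR (g * ln y) @[y --> x] --> expR (g * ln x).
    apply: continuous_comp; last exact: continuous_expR.
    by apply: cvgM; [exact: cvg_cst|exact: continuous_ln].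
  rewrite /continuous_at max_r ?(ltW x0)// [X in _ --> X](_ : _ = expR (g * ln x)); last first.
    by rewrite /powR gt_eqF.
  exact: cvg_trans (near_eq_cvg h) c.
- rewrite /continuous_at maxxx powR0 ?gt_eqF//; apply/cvgr0Pnorm_le => e e0.
  near=> y; have ye : `|y| < e `^ g^-1.
    by near: y; apply: (@cvgr0_norm_lt _ _ _ _ _ id) => //; exact: powR_gt0.
  rewrite ger0_norm ?powR_ge0// -[leRHS]powRr1 ?(ltW e0)// -(mulVf (lt0r_neq0 g0)) powRrM.
  apply: ge0_ler_powR; rewrite ?nnegrE ?le_max ?lexx ?powR_ge0 ?(ltW g0)//.
  by rewrite ge_max powR_ge0/= (le_trans (ler_norm _))// ltW.
Unshelve. all: by end_near. Qed.

(* Mixtures of the exponentials [x ^ t] approximate [psi]; since [psi] is not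
   constant, they keep a mass bounded below away from [x = 1]. *)
Lemma cm_strictly_positive (psi : R -> R) (I : finType) (g : I -> I -> R) (a : I -> R) :
  completely_monotonic psi -> nonconstant_on_nonneg psi ->
  (forall i j, 0 <= g i j) -> (forall i j, (g i j == 0) = (i == j)) ->
  (exists i, a i != 0) ->
  (forall x, 0 < x < 1 -> 0 < \sum_i \sum_j a i * a j * x `^ g i j) ->
  0 < \sum_i \sum_j a i * a j * psi (g i j).
Proof.
move=> cpsi [s [t [s0 t0 st]]] g0 gE [i0 ai0] gpos.
have cF := cm_seq_derive1n cpsi.
have noninc u v : 0 <= u -> u <= v -> psi v <= psi u.
  move=> u0 uv; apply/ler_addgt0Pr => e e0.
  have e20 : 0 < e / 2 by rewrite divr_gt0.
  have [d d0 Hu] := cm_right_continuous cpsi u0 e20.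
  have [d' d'0 Hv] := cm_right_continuous cpsi (le_trans u0 uv) e20.
  pose h := Num.min d d' / 2.
  have h0 : 0 < h by rewrite divr_gt0// lt_min d0.
  have hm : h < Num.min d d' by rewrite /h ltr_pdivrMr// ltr_pMr ?ltr1n// lt_min d0.
  move: hm; rewrite lt_min => /andP[hd hd'].
  have := Hu h (ltW h0) hd; have := Hv h (ltW h0) hd'.
  have := @cm_seq_nonincreasing _ _ 0%N (h + u) (h + v) cF.
  rewrite expr0 !mul1r ltr_pwDl// lerD2l => /(_ isT uv) /= h1.
  by rewrite !ler_norml => /andP[h2 h3] /andP[h4 h5]; lra.
have [T [T0 psiT]] : exists T, 0 < T /\ psi T < psi 0.
  have [lt|lt|e] := ltgtP s t; last by move: st; rewrite e eqxx.
    exists t; split; first exact: le_lt_trans lt.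
    by rewrite (lt_le_trans _ (noninc 0 s _ _))// lt_def st noninc// ltW.
  exists s; split; first exact: le_lt_trans lt.
  by rewrite (lt_le_trans _ (noninc 0 t _ _))// lt_def eq_sym st noninc// ltW.
have psi0 : 0 < psi 0.
  apply: le_lt_trans psiT; have [_] := cF 0%N T T0; by rewrite mul1r.
pose q x := \sum_i \sum_j a i * a j * x `^ g i j.
(* The factor 5 leaves a mass at least [m] on the atoms below [rho]: two units pay for the
   approximation errors at 0 and at [T], and two for the atoms above [rho], which lose at most a
   fraction [de] of their weight under the power [T]. *)
pose m := (psi 0 - psi T) / 5.
have m0 : 0 < m by rewrite divr_gt0// subr_gt0.
pose de := m / psi 0; have de0 : 0 < de by rewrite divr_gt0.
pose rho := expR (- (de / T)).
have rho01 : 0 < rho < 1.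
  by rewrite expR_gt0/= -[ltRHS]expR0 ltr_expR oppr_lt0 divr_gt0.
have /andP[rho0 rho1] := rho01.
have rhoT : 1 - de <= rho `^ T.
  rewrite /powR gt_eqF// expRK mulrN mulrC divfK ?gt_eqF//.
  by have := expR_ge1Dx (- de).
(* At the endpoints, which the hypothesis leaves out, the form is a square ([x = 1]) or reduces to
   its diagonal ([x = 0]), where alone the exponents vanish. *)
have q1 x : 0 <= x <= 1 -> 0 <= q x.
  move=> /andP[x0 x1]; have [->|xn0] := eqVneq x 0; last first.
    have xp : 0 < x by rewrite lt_def xn0.
    have [->|xn1] := eqVneq x 1; last by apply/ltW/gpos; rewrite xp lt_def eq_sym xn1.
    rewrite /q (eq_bigr (fun i => a i * \sum_j a j)) => [|i _].
      by rewrite -mulr_suml -expr2 sqr_ge0.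
    by rewrite mulr_sumr; apply: eq_bigr => j _; rewrite powR1 mulr1.
  apply: sumr_ge0 => i _; rewrite (bigD1 i)//= big1 => [|j ji].
    by rewrite addr0 mulr_ge0 ?powR_ge0// -expr2 sqr_ge0.
  by rewrite powR0 ?mulr0// gE eq_sym.
have q0 : 0 < q 0.
  have E i : \sum_j a i * a j * 0 `^ g i j = a i ^+ 2.
    rewrite (bigD1 i)//= big1 => [|j ji]; last by rewrite powR0 ?mulr0// gE eq_sym.
    have -> : g i i = 0 by apply/eqP; rewrite gE.
    by rewrite powRr0 mulr1 addr0 expr2.
  rewrite /q (eq_bigr _ (fun i _ => E i)) (bigD1 i0)//= ltr_pwDl ?sumr_ge0//.
    by rewrite lt_def sqrf_eq0 ai0 sqr_ge0.
  by move=> i _; exact: sqr_ge0.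
have [c c0 qc] : exists2 c, 0 < c & forall x, 0 <= x -> x <= rho -> c <= q x.
  have cont : {within `[0, rho], continuous (fun x => q (Num.max 0 x))}.
    apply: continuous_subspaceT => x; rewrite /q.
    apply: cvg_sumr => i; apply: cvg_sumr => j; apply: cvgM; first exact: cvg_cst.
    exact: continuous_powR_max.
  have [x] := EVT_min (ltW rho0) cont; rewrite in_itv/= => /andP[x0 xr] H.
  exists (q (Num.max 0 x)); last first.
    by move=> y y0 yr; rewrite -[X in _ <= q X](max_r y0) H// in_itv/= y0.
  rewrite max_r//; have [->//|xn0] := eqVneq x 0.
  by apply: gpos; rewrite lt_def xn0 x0/= (le_lt_trans xr).
have lower : c * m <= \sum_i \sum_j a i * a j * psi (g i j).
  apply/ler_addgt0Pr => e e0.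
  pose A := 1 + \sum_i \sum_j `|a i * a j|.
  have A0 : 0 < A by rewrite ltr_pwDl// sumr_ge0// => i _; apply: sumr_ge0.
  pose ep := Num.min m (e / A); have ep0 : 0 < ep by rewrite lt_min m0 divr_gt0.
  have epm : ep <= m by rewrite ge_min lexx.
  have epA : A * ep <= e by rewrite mulrC -ler_pdivlMr// ge_min lexx orbT.
  (* A single mixture must approximate [psi] at 0, at [T] and at all the [g i j] simultaneously. *)
  pose ts (o : option (option (I * I))) := match o with
    | Some (Some p) => g p.1 p.2 | Some None => T | None => 0 end.
  have ts0 o : 0 <= ts o by case: o => [[p|]|] //=; exact: ltW.
  have [n [lam [x [lam0 x01 H]]]] := cm_bernstein cpsi ts0 ep0.
  have H0 := H None; have HT := H (Some None).
  have Hg i j := H (Some (Some (i, j))); rewrite /= in H0 HT Hg.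
  have E0 : \sum_k lam k * x k `^ 0 = \sum_k lam k.
    by apply: eq_bigr => k _; rewrite powRr0 mulr1.
  rewrite E0 in H0.
  have mass : m <= \sum_(k | x k <= rho) lam k.
    have h1 : \sum_k lam k - \sum_k lam k * x k `^ T <=
        de * \sum_k lam k + \sum_(k | x k <= rho) lam k.
      rewrite -sumrB mulr_sumr [X in _ <= _ + X]big_mkcond -big_split/=.
      apply: ler_sum => k _; have /andP[xk0 xk1] := x01 k; case: ifPn => [xr|].
        have h2 : 0 <= lam k * x k `^ T by rewrite mulr_ge0// powR_ge0.
        have h3 : 0 <= de * lam k by rewrite mulr_ge0// ltW.
        by lra.
      rewrite -ltNge => rx; rewrite addr0 -{1}[lam k]mulr1 -mulrBr mulrC ler_wpM2r//.
      have : rho `^ T <= x k `^ T.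
        by apply: ge0_ler_powR; rewrite ?nnegrE ?(ltW T0) ?(ltW rho0) ?(ltW rx).
      by move: rhoT; lra.
    have dl : de * \sum_k lam k <= de * (psi 0 + ep).
      by rewrite ler_wpM2l ?(ltW de0)//; move: H0; rewrite ler_norml => /andP[? ?]; lra.
    have dp : de * (psi 0 + ep) <= m + m.
      rewrite mulrDr /de divfK ?gt_eqF// lerD2l.
      rewrite -/de (le_trans (ler_wpM2l (ltW de0) epm))// ger_pMl// /de ler_pdivrMr// mul1r.
      have : 0 <= psi T by have [_] := cF 0%N T T0; rewrite mul1r.
      by rewrite /m; lra.
    move: H0 HT; rewrite !ler_norml => /andP[? ?] /andP[? ?].
    have : psi 0 - psi T = 5 * m by rewrite /m; field.
    by move=> *; lra.
  have h2 : \sum_k lam k * q (x k) <= (\sum_i \sum_j a i * a j * psi (g i j)) + e.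
    have -> : \sum_k lam k * q (x k) =
        \sum_i \sum_j a i * a j * \sum_k lam k * x k `^ g i j.
      under eq_bigr do rewrite mulr_sumr.
      rewrite exchange_big/=; apply: eq_bigr => i _.
      under eq_bigr do rewrite mulr_sumr.
      rewrite exchange_big/=; apply: eq_bigr => j _.
      by rewrite mulr_sumr; apply: eq_bigr => k _; rewrite mulrCA.
    apply: (@le_trans _ _ (\sum_i \sum_j a i * a j * psi (g i j) + A * ep));
      last by rewrite lerD2l.
    rewrite -lerBlDl -sumrB /A mulrDl mul1r ler_wpDl ?(ltW ep0)// mulr_suml.
    apply: ler_sum => i _; rewrite -sumrB mulr_suml; apply: ler_sum => j _.
    rewrite -mulrBr (le_trans (ler_norm _))// normrM ler_wpM2l//.
    by rewrite distrC; exact: Hg.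
  apply: le_trans h2; apply: (@le_trans _ _ (\sum_(k | x k <= rho) lam k * c)).
    by rewrite -mulr_suml mulrC ler_wpM2r// ltW.
  rewrite big_mkcond; apply: ler_sum => k _; have /andP[xk0 xk1] := x01 k; case: ifPn => xr.
    by rewrite ler_wpM2l// qc.
  by rewrite mulr_ge0// q1// xk0.
by rewrite (lt_le_trans _ lower)// mulr_gt0.
Qed.

End StrictPositivity.

(** * Strict positive definiteness of the Gaussian kernel *)

Lemma oppr_half_sum_sqr_le (R : realFieldType) (x y : R) : - ((x ^+ 2 + y ^+ 2) / 2) <= x * y.
Proof. by have := sqr_ge0 (x + y); rewrite sqrrD; lra. Qed.

Section GaussianKernel.
Context {R : realType} {d : measure_display} {Omega : measurableType d}.
Variable P : probability Omega R.
Implicit Types (I : finType).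

Lemma L2_ip_sum (I : Type) (r : seq I) (c : I -> R) (x y : I -> L2 P) :
  P.-integrable setT (fun w => (\sum_(i <- r) c i * ((x i : L2type P) w * (y i : L2type P) w))%:E) /\
  (\sum_(i <- r) c i * ip (x i) (y i))%:E =
    (\int[P]_w (\sum_(i <- r) c i * ((x i : L2type P) w * (y i : L2type P) w))%:E)%E.
Proof.
elim: r => [|i r [int E]].
  split; first by under eq_fun do rewrite big_nil; exact: integrable0.
  by rewrite big_nil; under eq_integral do rewrite big_nil; rewrite integral0.
have ici : P.-integrable setT (fun w => (c i * ((x i : L2type P) w * (y i : L2type P) w))%:E).
  have := integrableZl measurableT (c i) (L2_integrableM (x i) (y i)).
  by apply: eq_integrable => // w _; rewrite /= EFinM.
split.
  under eq_fun do rewrite big_cons EFinD.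
  exact: integrableD.
rewrite big_cons EFinD E; under [RHS]eq_integral do rewrite big_cons EFinD.
rewrite integralD//; congr (_ + _)%E.
by rewrite EFinM /= L2ipE -integralZl//; exact: L2_integrableM.
Qed.

(** Schur's product theorem for the powers of a Gram matrix: the last factor is the integral of
    [z i w * z j w], which is absorbed into the coefficients for each [w] before the induction
    hypothesis is used. *)
Lemma L2_gram_expr_psd I (z : I -> L2 P) (k : nat) (b : I -> R) :
  0 <= \sum_i \sum_j b i * b j * ip (z i) (z j) ^+ k.
Proof.
elim: k b => [|k IH] b.
  rewrite (eq_bigr (fun i => b i * \sum_j b j)) => [|i _].
    by rewrite -mulr_suml -expr2 sqr_ge0.
  by rewrite mulr_sumr; apply: eq_bigr => j _; rewrite expr0 mulr1.
rewrite pair_big/=.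
have [_] := L2_ip_sum (index_enum (I * I)%type)
  (fun p => b p.1 * b p.2 * ip (z p.1) (z p.2) ^+ k) (fun p => z p.1) (fun p => z p.2).
move=> E; rewrite -lee_fin (eq_bigr (fun p => b p.1 * b p.2 * ip (z p.1) (z p.2) ^+ k *
  ip (z p.1) (z p.2))); last by move=> p _; rewrite exprSr mulrA.
rewrite E; apply: integral_ge0 => w _; rewrite lee_fin.
have := IH (fun i => b i * (z i : L2type P) w); rewrite pair_big/=.
by congr (_ <= _); apply: eq_bigr => p _; ring.
Qed.

(** After a diagonal scaling, the form is a power series in [2 * u] with nonnegative coefficients.
    If it vanished at this positive value, all its coefficients would be 0, hence the series
    everywhere; but for a large parameter the Gaussian matrix is diagonally dominant. *)
Lemma gaussian_kernel_strict I (z : I -> L2 P) (a : I -> R) (x : R) :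
  (forall i j, i != j -> sinorm (z i - z j) != 0) -> (exists i, a i != 0) -> 0 < x < 1 ->
  0 < \sum_i \sum_j a i * a j * x `^ (sinorm (z i - z j) ^+ 2).
Proof.
move=> zd [i0 ai0] /andP[x0 x1].
pose G i j := ip (z i) (z j).
have gE i j : sinorm (z i - z j) ^+ 2 = G i i + G j j - 2 * G i j.
  by rewrite sqr_sinorm ipBl !ipBr (ipC (z j) (z i)) /G; ring.
pose f (c : I -> R) v := \sum_i \sum_j c i * c j * expR (v * G i j).
pose s (c : I -> R) k := \sum_i \sum_j c i * c j * G i j ^+ k.
have s0 c k : 0 <= s c k by exact: L2_gram_expr_psd.
have fcvg c v : (fun n => \sum_(0 <= k < n) v ^+ k / k`!%:R * s c k) @ \oo --> f c v.
  rewrite (_ : (fun n => _) = fun n => \sum_i \sum_j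
      c i * c j * series (exp_coeff (v * G i j)) n).
    apply: cvg_sumr => i; apply: cvg_sumr => j; apply: cvgM; first exact: cvg_cst.
    exact: is_cvg_series_exp_coeff.
  apply/funext => n; under eq_bigr do rewrite /s mulr_sumr.
  rewrite exchange_big/=; apply: eq_bigr => i _.
  under eq_bigr do rewrite mulr_sumr.
  rewrite exchange_big/=; apply: eq_bigr => j _.
  rewrite /series/= mulr_sumr; apply: eq_bigr => k _.
  by rewrite /exp_coeff/= exprMn; field; rewrite pnatr_eq0 -lt0n fact_gt0.
have fge c v n : 0 <= v -> \sum_(0 <= k < n) v ^+ k / k`!%:R * s c k <= f c v.
  move=> v0; rewrite -(cvg_lim (@Rhausdorff R) (fcvg c v)).
  apply: nondecreasing_cvgn_le; last by apply/cvg_ex; eexists; exact: fcvg.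
  apply/nondecreasing_seqP => k; rewrite big_nat_recr//= lerDl mulr_ge0//.
  by rewrite divr_ge0// exprn_ge0.
pose u := - ln x; have u0 : 0 < u by rewrite oppr_gt0 ln_lt0// x0.
have key (b : I -> R) v : \sum_i \sum_j b i * b j * expR (- v * sinorm (z i - z j) ^+ 2) =
    f (fun i => b i * expR (- v * G i i)) (2 * v).
  apply: eq_bigr => i _; apply: eq_bigr => j _; rewrite gE.
  have -> : - v * (G i i + G j j - 2 * G i j) = - v * G i i + (- v * G j j + 2 * v * G i j).
    by ring.
  by rewrite !expRD; ring.
pose c i := a i * expR (- u * G i i).
have -> : \sum_i \sum_j a i * a j * x `^ (sinorm (z i - z j) ^+ 2) = f c (2 * u).
  rewrite -key; apply: eq_bigr => i _; apply: eq_bigr => j _.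
  by rewrite /powR gt_eqF// /u opprK [ln x * _]mulrC.
have u20 : 0 < 2 * u by rewrite mulr_gt0.
rewrite lt_def; apply/andP; split; last by have := fge c (2 * u) 0%N (ltW u20); rewrite big_nil.
apply/eqP => fu0.
have sk k : s c k = 0.
  apply/eqP; rewrite eq_le s0 andbT.
  have := fge c (2 * u) k.+1 (ltW u20); rewrite fu0 big_nat_recr//= => h.
  have p : 0 < (2 * u) ^+ k / k`!%:R by rewrite divr_gt0 ?exprn_gt0// ltr0n fact_gt0.
  rewrite -(pmulr_rle0 _ p) (le_trans _ h)// lerDr sumr_ge0// => i _.
  by rewrite mulr_ge0// divr_ge0// exprn_ge0// ltW.
have f0 v : f c v = 0.
  apply: (cvg_unique (@Rhausdorff R) (fcvg c v)).
  rewrite (_ : (fun n => _) = fun=> 0); first exact: cvg_cst.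
  by apply/funext => n; rewrite big1// => k _; rewrite sk mulr0.
pose gmin := \big[Num.min/1]_(p : I * I | p.1 != p.2) sinorm (z p.1 - z p.2) ^+ 2.
have gmin0 : 0 < gmin.
  rewrite /gmin; elim/big_ind: _ => // [y w y0 w0|p pd]; first by rewrite lt_min y0.
  by rewrite exprn_gt0// lt_def zd// sinorm_ge0.
have gminle i j : i != j -> gmin <= sinorm (z i - z j) ^+ 2.
  move=> ij; exact: (@bigmin_le_cond _ _ _ 1 (i, j) (fun p => p.1 != p.2)
    (fun p => sinorm (z p.1 - z p.2) ^+ 2)).
pose n := #|I|%:R : R.
(* The off-diagonal entries are then at most [expR (- n) <= 1 / (1 + n) = th], and [th * n < 1]
   gives the dominance. *)
pose v := n / gmin.
pose th := (1 + n)^-1.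
have n0 : 0 <= n by rewrite ler0n.
have thle i j : i != j -> expR (- v * sinorm (z i - z j) ^+ 2) <= th.
  move=> ij; apply: (@le_trans _ _ (expR (- n))).
    rewrite ler_expR mulNr lerN2 /v -mulrA ler_peMr// mulrC ler_pdivlMr// mul1r.
    exact: gminle.
  by rewrite expRN lef_pV2 ?posrE ?expR_gt0 ?ltr_pwDl// expR_ge1Dx.
(* Scaled back so that the Gaussian form of parameter [v] in [b] is the exponential form in [c],
   known to vanish. *)
pose b i := c i * expR (v * G i i).
have bE i : b i * expR (- v * G i i) = c i.
  by rewrite /b -mulrA -expRD mulNr subrr expR0 mulr1.
have b0 : \sum_i \sum_j b i * b j * expR (- v * sinorm (z i - z j) ^+ 2) = 0.
  rewrite key -[RHS](f0 (2 * v)); apply: eq_bigr => i _; apply: eq_bigr => j _.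
  by rewrite !bE.
have bi0 : b i0 != 0 by rewrite !mulf_neq0// gt_eqF// expR_gt0.
have sc (y : R) : \sum_(j : I) y = n * y.
  by rewrite sumr_const -mulr_natl; congr (_%:R * _); exact: eq_card.
have : (1 - th * n) * \sum_i b i ^+ 2 <=
    \sum_i \sum_j b i * b j * expR (- v * sinorm (z i - z j) ^+ 2).
  rewrite mulrBl mul1r.
  have lower i j : (i == j)%:R * b i ^+ 2 - th * ((b i ^+ 2 + b j ^+ 2) / 2) <=
      b i * b j * expR (- v * sinorm (z i - z j) ^+ 2).
    have th0 : 0 <= th by rewrite invr_ge0 addr_ge0.
    have q1 := sqr_ge0 (b i + b j); have q2 := sqr_ge0 (b i - b j).
    rewrite sqrrD in q1; rewrite sqrrB in q2; rewrite -mulr_natr in q1 q2.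
    case: eqVneq => [->|ij].
      rewrite subrr sinorm0 expr0n/= mulr0 expR0 mulr1 mul1r -expr2 gerBl.
      by rewrite mulr_ge0// divr_ge0// addr_ge0// sqr_ge0.
    rewrite mul0r sub0r; set y := expR _.
    have y0 : 0 <= y by exact: expR_ge0.
    have yt : y <= th by exact: thle.
    pose S := (b i ^+ 2 + b j ^+ 2) / 2.
    have S0 : 0 <= S by rewrite divr_ge0// addr_ge0// sqr_ge0.
    have h1 : y * S <= th * S by rewrite ler_wpM2r.
    have h2 : y * (- S) <= y * (b i * b j) by rewrite ler_wpM2l// oppr_half_sum_sqr_le.
    by rewrite -/S [_ * y]mulrC (le_trans _ h2)// mulrN lerN2.
  have : \sum_i \sum_j ((i == j)%:R * b i ^+ 2 - th * ((b i ^+ 2 + b j ^+ 2) / 2)) <=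
      \sum_i \sum_j b i * b j * expR (- v * sinorm (z i - z j) ^+ 2).
    by apply: ler_sum => i _; apply: ler_sum => j _; exact: lower.
  apply: le_trans; rewrite le_eqVlt; apply/orP; left; apply/eqP.
  have E1 i : \sum_j ((i == j)%:R * b i ^+ 2 - th * ((b i ^+ 2 + b j ^+ 2) / 2)) =
      b i ^+ 2 - th * (n * b i ^+ 2 + \sum_j b j ^+ 2) / 2.
    rewrite sumrB (bigD1 i)//= eqxx mul1r big1 ?addr0 => [|j ji]; last first.
      by rewrite eq_sym (negbTE ji) mul0r.
    rewrite -mulr_sumr -mulr_suml big_split/= sc mulrA.
    by [].
  under [RHS]eq_bigr do rewrite E1.
  by rewrite sumrB -mulr_suml -mulr_sumr big_split/= -mulr_sumr sc; field.
rewrite b0; apply/negP; rewrite -ltNge mulr_gt0//.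
  rewrite subr_gt0 /th mulrC ltr_pdivrMr ?ltr_pwDl// mul1r ltrDr ltr01//.
rewrite (bigD1 i0)//= ltr_pwDl ?sumr_ge0//; first by rewrite lt_def sqrf_eq0 bi0 sqr_ge0.
by move=> i _; exact: sqr_ge0.
Qed.

End GaussianKernel.

(** * Mixed derivatives of psi(|Z(s) - Z(t)|^2) *)

Section KernelCalculus.
Context {R : realType} {V : semiInner R}.

Lemma subrACA (U : zmodType) (a b c e : U) : (a - b) - (c - e) = (a - c) - (b - e).
Proof. by rewrite !opprD !opprK addrACA. Qed.

Lemma is_derive_eps (f : R -> R) (s a : R) :
  (forall e : R, 0 < e -> exists2 d : R, 0 < d &
    forall u, u != s -> `|u - s| < d -> `|(f u - f s) / (u - s) - a| <= e) ->
  is_derive s (1 : R) f a.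
Proof.
move=> H; apply/is_derive1_caratheodory.
exists (fun u => if u == s then a else (f u - f s) / (u - s)); split.
- move=> u; case: eqVneq => [->|us]; first by rewrite !subrr mulr0.
  by rewrite divfK// subr_eq0.
- apply/cvgrPdist_le => e e0; have [d d0 Hd] := H _ e0.
  exists d => // u /= ud; rewrite eqxx; case: eqVneq => [_|us].
    by rewrite subrr normr0 ltW.
  by rewrite distrC Hd// distrC.
- by rewrite eqxx.
Qed.

Variable l : R.
Hypothesis l0 : 0 < l.

(** The quotient of the inner product is linear in the quotients of [A] and [B], up to [u - s] times
    their inner product, which stays bounded. *)
Lemma vderiv_ip (A B : R -> V) (s : R) (A' B' : V) : 0 < s < l ->
  vderiv l A s A' -> vderiv l B s B' ->
  is_derive s (1 : R) (fun u => ip (A u) (B u)) (ip A' (B s) + ip (A s) B').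
Proof.
move=> /andP[s0 sl] dA dB; apply: is_derive_eps => e e0.
have e30 : 0 < e / 3 by rewrite divr_gt0.
have [r1 r10 H1] := ip_close A' (B s) e30.
have [r2 r20 H2] := ip_close (A s) B' e30.
have [r3 r30 H3] := ip_close A' B' (ltr01 : 0 < 1 :> R).
pose r := Num.min r1 (Num.min r2 r3).
have rr0 : 0 < r by rewrite !lt_min r10 r20.
have [dA1 dA0 HA] := dA _ rr0; have [dB1 dB0 HB] := dB _ rr0.
pose M := `|ip A' B'| + 1; have M0 : 0 < M by rewrite ltr_wpDl.
exists (Num.min (Num.min dA1 dB1) (Num.min (Num.min s (l - s)) (e / 3 / M))).
  by rewrite !lt_min dA0 dB0 s0 subr_gt0 sl divr_gt0.
move=> u us; rewrite !lt_min -!andbA => /and5P[uA uB u1 u2 uM].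
have ul : 0 <= u <= l.
  by move: u1 u2; rewrite !ltr_norml => /andP[? ?] /andP[? ?]; apply/andP; split; lra.
have qA := HA u ul us uA; have qB := HB u ul us uB.
have [rA1 rA2 rA3] : [/\ r <= r1, r <= r2 & r <= r3] by rewrite !ge_min !lexx !orbT.
have us0 : u - s != 0 by rewrite subr_eq0.
have -> : (ip (A u) (B u) - ip (A s) (B s)) / (u - s) =
    ip (vquot A s u) (B s) + ip (A s) (vquot B s u) +
    (u - s) * ip (vquot A s u) (vquot B s u).
  by rewrite /vquot !ipZl !ipZr !ipBl !ipBr; field.
have E (a b c a' b' : R) : a + b + c - (a' + b') = (a - a') + (b - b') + c by ring.
rewrite E; apply: (@le_trans _ _ (e / 3 + e / 3 + e / 3)); last by lra.
rewrite (le_trans (ler_normD _ _))// lerD//.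
  rewrite (le_trans (ler_normD _ _))// lerD//.
    by apply: H1; [exact: le_trans rA1|rewrite subrr sinorm0 ltW].
  by apply: H2; [rewrite subrr sinorm0 ltW|exact: le_trans rA2].
have h3 := H3 _ _ (le_trans qA rA3) (le_trans qB rA3).
rewrite normrM (@le_trans _ _ (e / 3 / M * M))//; last by rewrite divfK// gt_eqF.
apply: ler_pM => //; first exact: ltW.
rewrite -[ip (vquot A s u) _](subrK (ip A' B')) (le_trans (ler_normD _ _))//.
by rewrite addrC /M lerD2l.
Qed.

Variables (m : nat) (z : nat -> R -> V).
Hypothesis zd : forall k, (k < m)%N -> forall t, 0 <= t <= l -> vderiv l (z k) t (z k.+1 t).
Hypothesis zc : forall k, (k <= m)%N -> forall e : R, 0 < e -> exists2 d : R, 0 < d &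
  forall s t, 0 <= s <= l -> 0 <= t <= l -> `|s - t| < d -> sinorm (z k s - z k t) <= e.
Hypothesis zb : forall k, (k <= m)%N -> exists M : R, forall t, 0 <= t <= l ->
  sinorm (z k t) <= M.

(* Vector-valued functions on the square, indexed by the orders of the
   derivatives of the path used in each variable and by an order of vanishing on
   the diagonal. *)
Inductive vclass (i j : nat) : nat -> (R -> R -> V) -> Prop :=
| vclass0 v : vclass i j v (fun _ _ => 0)
| vclass_s a : (a <= i)%N -> vclass i j 0 (fun s _ => z a s)
| vclass_t b : (b <= j)%N -> vclass i j 0 (fun _ t => z b t)
| vclass_sN a : (a <= i)%N -> vclass i j 0 (fun s _ => - z a s)
| vclass_tN b : (b <= j)%N -> vclass i j 0 (fun _ t => - z b t)
| vclass_diff : vclass i j 1 (fun s t => z 0 s - z 0 t)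
| vclass_diffN : vclass i j 1 (fun s t => z 0 t - z 0 s).

(** A syntactic class in place of explicit formulas: it is stable under differentiation, and its
    bounds and uniform continuity follow by induction. The index [v] stands for a bound by a
    multiple of [rho ^+ v]. *)
Inductive wclass (i j : nat) : nat -> (R -> R -> R) -> Prop :=
| wclass_ip v v' A B : vclass i j v A -> vclass i j v' B ->
    wclass i j (v + v') (fun s t => ip (A s t) (B s t))
| wclass_cst c : wclass i j 0 (fun _ _ => c)
| wclass_mul v v' w w' : wclass i j v w -> wclass i j v' w' ->
    wclass i j (v + v') (fun s t => w s t * w' s t)
| wclass_add v w w' : wclass i j v w -> wclass i j v w' ->
    wclass i j v (fun s t => w s t + w' s t)
| wclass_weaken v v' w : (v' <= v)%N -> wclass i j v w -> wclass i j v' w.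

Lemma vclassS i j v A : vclass i j v A -> vclass i.+1 j v A.
Proof.
case=> [v'|a ai|b bj|a ai|b bj||]; [exact: vclass0| |exact: vclass_t| |
  exact: vclass_tN|exact: vclass_diff|exact: vclass_diffN].
- by apply: vclass_s; exact: leqW.
- by apply: vclass_sN; exact: leqW.
Qed.

Lemma wclassS i j v w : wclass i j v w -> wclass i.+1 j v w.
Proof.
elim=> [? ? ? ? /vclassS ? /vclassS ?|?|? ? ? ? _ ? _ ?|? ? ? _ ? _ ?|? ? ? h _ ?];
  [exact: wclass_ip|exact: wclass_cst|exact: wclass_mul|exact: wclass_add|
   exact: wclass_weaken h _].
Qed.

Lemma vclass_swap i j v A : vclass i j v A -> vclass j i v (fun s t => A t s).
Proof.
by case=> [v'|a ai|b bj|a ai|b bj||]; [exact: vclass0|exact: vclass_t|exact: vclass_s|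
  exact: vclass_tN|exact: vclass_sN|exact: vclass_diffN|exact: vclass_diff].
Qed.

Lemma wclass_swap i j v w : wclass i j v w -> wclass j i v (fun s t => w t s).
Proof.
elim=> [? ? ? ? /vclass_swap h1 /vclass_swap h2|?|? ? ? ? _ h1 _ h2|? ? ? _ h1 _ h2|
  ? ? ? h _ h1].
- exact: wclass_ip h1 h2.
- exact: wclass_cst.
- exact: wclass_mul h1 h2.
- exact: wclass_add h1 h2.
- exact: wclass_weaken h h1.
Qed.

Lemma vderiv_cst (U : V) s : vderiv l (fun=> U) s 0.
Proof.
move=> e e0; exists 1 => // u ul us _.
by rewrite /vquot subrr scaler0 subrr sinorm0 ltW.
Qed.

Lemma vderivB (A B : R -> V) s A' B' : vderiv l A s A' -> vderiv l B s B' ->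
  vderiv l (fun u => A u - B u) s (A' - B').
Proof.
move=> dA dB e e0; have e20 : 0 < e / 2 by rewrite divr_gt0.
have [d1 d10 H1] := dA _ e20; have [d2 d20 H2] := dB _ e20.
exists (Num.min d1 d2); first by rewrite lt_min d10.
move=> u ul us; rewrite lt_min => /andP[ud1 ud2].
have -> : vquot (fun u => A u - B u) s u - (A' - B') =
    (vquot A s u - A') - (vquot B s u - B').
  by rewrite subrACA /vquot -scalerBr subrACA.
rewrite (le_trans (sinormD _ _))// sinormN (splitr e) lerD//; [exact: H1|exact: H2].
Qed.

Lemma vclass_deriv i j v A : (i < m)%N -> vclass i j v A ->
  exists A', vclass i.+1 j v.-1 A' /\
    forall s t, 0 <= s <= l -> vderiv l (fun u => A u t) s (A' s t).
Proof.
move=> im; case=> [v'|a ai|b bj|a ai|b bj||].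
- by exists (fun _ _ => 0); split; [exact: vclass0|move=> s t sl; exact: vderiv_cst].
- exists (fun s _ => z a.+1 s); split; first exact: vclass_s.
  by move=> s t sl; apply: zd => //; exact: leq_ltn_trans im.
- by exists (fun _ _ => 0); split; [exact: vclass0|move=> s t sl; exact: vderiv_cst].
- exists (fun s _ => - z a.+1 s); split; first exact: vclass_sN.
  move=> s t sl; rewrite -[- z a.+1 s]sub0r.
  rewrite (_ : (fun u => - z a u) = fun u => 0 - z a u); last first.
    by apply/funext => u; rewrite sub0r.
  by apply: vderivB; [exact: vderiv_cst|apply: zd => //; exact: leq_ltn_trans im].
- by exists (fun _ _ => 0); split; [exact: vclass0|move=> s t sl; exact: vderiv_cst].
- exists (fun s _ => z 1 s); split; first exact: vclass_s.
  move=> s t sl; rewrite -[z 1 s]subr0; apply: vderivB; last exact: vderiv_cst.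
  by apply: zd => //; exact: leq_ltn_trans im.
- exists (fun s _ => - z 1 s); split; first exact: vclass_sN.
  move=> s t sl; rewrite -[- z 1 s]sub0r; apply: vderivB; first exact: vderiv_cst.
  by apply: zd => //; exact: leq_ltn_trans im.
Qed.

(** A derivative costs at most one order of vanishing; the truncated predecessor covers order 0. *)
Lemma wclass_deriv i j v w : (i < m)%N -> wclass i j v w ->
  exists w', wclass i.+1 j v.-1 w' /\
    forall s t, 0 < s < l -> is_derive s (1 : R) (fun u => w u t) (w' s t).
Proof.
move=> im; elim=> {v w} [v v' A B cA cB|c|v v' w w' cw [dw [cdw Hw]] cw' [dw' [cdw' Hw']]
  |v w w' cw [dw [cdw Hw]] cw' [dw' [cdw' Hw']]|v v' w vv' cw [dw [cdw Hw]]].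
- have [A' [cA' HA]] := vclass_deriv im cA; have [B' [cB' HB]] := vclass_deriv im cB.
  exists (fun s t => ip (A' s t) (B s t) + ip (A s t) (B' s t)); split.
    apply: wclass_add.
      by apply: wclass_weaken (wclass_ip cA' (vclassS cB)); lia.
    by apply: wclass_weaken (wclass_ip (vclassS cA) cB'); lia.
  move=> s t /[dup] s0l /andP[s0 sl]; have sl' : 0 <= s <= l by rewrite !ltW.
  by apply: (@vderiv_ip (fun u => A u t) (fun u => B u t)) => //; [exact: HA|exact: HB].
- exists (fun _ _ => 0); split; first exact: wclass_cst.
  by move=> s t _; exact: is_derive_cst.
- exists (fun s t => w s t * dw' s t + w' s t * dw s t); split.
    apply: wclass_add.
      by apply: wclass_weaken (wclass_mul (wclassS cw) cdw'); lia.
    by apply: wclass_weaken (wclass_mul (wclassS cw') cdw); lia.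
  by move=> s t sl; apply: is_deriveM; [exact: Hw|exact: Hw'].
- exists (fun s t => dw s t + dw' s t); split; first exact: wclass_add.
  by move=> s t sl; apply: is_deriveD; [exact: Hw|exact: Hw'].
- exists dw; split => //; apply: wclass_weaken cdw; lia.
Qed.

Definition rho s t := sinorm (z 0 s - z 0 t).

Lemma vclass_bound i j v A : (i <= m)%N -> (j <= m)%N -> vclass i j v A ->
  exists2 C : R, 0 <= C & forall s t, 0 <= s <= l -> 0 <= t <= l ->
    sinorm (A s t) <= C * rho s t ^+ v.
Proof.
move=> im jm; case=> [v'|a ai|b bj|a ai|b bj||].
- by exists 0 => // s t sl tl; rewrite sinorm0 mul0r.
- have [M HM] := zb (leq_trans ai im); exists `|M| => // s t sl tl.
  by rewrite expr0 mulr1 (le_trans (HM s sl))// ler_norm.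
- have [M HM] := zb (leq_trans bj jm); exists `|M| => // s t sl tl.
  by rewrite expr0 mulr1 (le_trans (HM t tl))// ler_norm.
- have [M HM] := zb (leq_trans ai im); exists `|M| => // s t sl tl.
  by rewrite expr0 mulr1 sinormN (le_trans (HM s sl))// ler_norm.
- have [M HM] := zb (leq_trans bj jm); exists `|M| => // s t sl tl.
  by rewrite expr0 mulr1 sinormN (le_trans (HM t tl))// ler_norm.
- by exists 1 => // s t _ _; rewrite mul1r expr1.
- by exists 1 => // s t _ _; rewrite mul1r expr1 /rho sinormBC.
Qed.

Lemma rho_bound : exists2 B : R, 1 <= B & forall s t, 0 <= s <= l -> 0 <= t <= l ->
  rho s t <= B.
Proof.
have [M HM] := zb (leq0n m); exists (1 + (M + M)).
  rewrite lerDl addr_ge0//; apply: le_trans (HM 0 _); rewrite ?lexx ?(ltW l0)//;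
  exact: sinorm_ge0.
move=> s t sl tl; rewrite ler_wpDl// (le_trans (sinormD _ _))// sinormN lerD// HM//.
Qed.

Lemma wclass_bound i j v w : (i <= m)%N -> (j <= m)%N -> wclass i j v w ->
  exists2 C : R, 0 <= C & forall s t, 0 <= s <= l -> 0 <= t <= l ->
    `|w s t| <= C * rho s t ^+ v.
Proof.
move=> im jm; have r0 s t : 0 <= rho s t by exact: sinorm_ge0.
elim=> {v w} [v v' A B cA cB|c|v v' w w' cw [C C0 H] cw' [C' C'0 H']
  |v w w' cw [C C0 H] cw' [C' C'0 H']|v v' w vv' cw [C C0 H]].
- have [C C0 H] := vclass_bound im jm cA; have [C' C'0 H'] := vclass_bound im jm cB.
  exists (C * C') => [|s t sl tl]; first exact: mulr_ge0.
  rewrite (le_trans (ip_le _ _))// exprD mulrACA.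
  by apply: ler_pM; rewrite ?sinorm_ge0 ?H ?H'.
- by exists `|c| => // s t _ _; rewrite expr0 mulr1.
- exists (C * C') => [|s t sl tl]; first exact: mulr_ge0.
  by rewrite normrM exprD mulrACA; apply: ler_pM; rewrite ?H ?H'.
- exists (C + C') => [|s t sl tl]; first exact: addr_ge0.
  by rewrite mulrDl (le_trans (ler_normD _ _))// lerD ?H ?H'.
- have [B B1 HB] := rho_bound; exists (C * B ^+ (v - v')) => [|s t sl tl].
    by rewrite mulr_ge0// exprn_ge0// (le_trans _ B1).
  rewrite (le_trans (H s t sl tl))// -mulrA ler_wpM2l// -{1}(subnK vv') exprD.
  by rewrite ler_wpM2r ?exprn_ge0// lerXn2r ?nnegrE ?HB// (le_trans _ B1).
Qed.

Lemma vclass_UC i j v A : (i <= m)%N -> (j <= m)%N -> vclass i j v A ->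
  forall e : R, 0 < e -> exists2 d : R, 0 < d &
    forall s t s' t', 0 <= s <= l -> 0 <= t <= l -> 0 <= s' <= l -> 0 <= t' <= l ->
      `|s - s'| < d -> `|t - t'| < d -> sinorm (A s t - A s' t') <= e.
Proof.
move=> im jm cA e e0; have e20 : 0 < e / 2 by rewrite divr_gt0.
have diff : exists2 d : R, 0 < d &
    forall s t s' t', 0 <= s <= l -> 0 <= t <= l -> 0 <= s' <= l -> 0 <= t' <= l ->
      `|s - s'| < d -> `|t - t'| < d -> sinorm (z 0 s - z 0 t - (z 0 s' - z 0 t')) <= e.
  have [d d0 H] := zc (leq0n m) e20; exists d => // s t s' t' sl tl sl' tl' ss tt.
  rewrite subrACA (splitr e) (le_trans (sinormD _ _))// sinormN lerD//; exact: H.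
case: cA => [v'|a ai|b bj|a ai|b bj||].
- by exists 1 => // *; rewrite subrr sinorm0 ltW.
- by have [d d0 H] := zc (leq_trans ai im) e0; exists d => // s t s' t' *; exact: H.
- by have [d d0 H] := zc (leq_trans bj jm) e0; exists d => // s t s' t' *; exact: H.
- have [d d0 H] := zc (leq_trans ai im) e0; exists d => // s t s' t' *.
  by rewrite -opprD sinormN; exact: H.
- have [d d0 H] := zc (leq_trans bj jm) e0; exists d => // s t s' t' *.
  by rewrite -opprD sinormN; exact: H.
- exact: diff.
- have [d d0 H] := diff; exists d => // s t s' t' *.
  by rewrite -(opprB (z 0 s)) -(opprB (z 0 s')) -opprD sinormN; exact: H.
Qed.

Lemma UC2D (w w' : R -> R -> R) : UC2 l w -> UC2 l w' -> UC2 l (fun s t => w s t + w' s t).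
Proof.
move=> H H' e e0; have e20 : 0 < e / 2 by rewrite divr_gt0.
have [d d0 Hd] := H _ e20; have [d' d'0 Hd'] := H' _ e20.
exists (Num.min d d'); first by rewrite lt_min d0.
move=> s t s' t' sl tl sl' tl'; rewrite !lt_min => /andP[? ?] /andP[? ?].
rewrite opprD addrACA (splitr e) (le_trans (ler_normD _ _))// lerD//; [exact: Hd|exact: Hd'].
Qed.

Lemma UC2M (w w' : R -> R -> R) (C C' : R) :
  (forall s t, 0 <= s <= l -> 0 <= t <= l -> `|w s t| <= C) ->
  (forall s t, 0 <= s <= l -> 0 <= t <= l -> `|w' s t| <= C') ->
  UC2 l w -> UC2 l w' -> UC2 l (fun s t => w s t * w' s t).
Proof.
move=> B B' H H' e e0; pose M := `|C| + `|C'| + 1.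
have M0 : 0 < M by rewrite ltr_wpDl// addr_ge0.
have e20 : 0 < e / 2 / M by rewrite !divr_gt0.
have [d d0 Hd] := H _ e20; have [d' d'0 Hd'] := H' _ e20.
exists (Num.min d d'); first by rewrite lt_min d0.
move=> s t s' t' sl tl sl' tl'; rewrite !lt_min => /andP[? ?] /andP[? ?].
have -> : w s t * w' s t - w s' t' * w' s' t' =
  (w s t - w s' t') * w' s t + w s' t' * (w' s t - w' s' t') by ring.
have b : `|w s' t'| <= M.
  by rewrite (le_trans (B _ _ sl' tl'))// /M; have := ler_norm C; have := normr_ge0 C'; lra.
have b' : `|w' s t| <= M.
  by rewrite (le_trans (B' _ _ sl tl))// /M; have := ler_norm C'; have := normr_ge0 C; lra.
rewrite (splitr e) (le_trans (ler_normD _ _))// lerD// normrM.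
  by rewrite -[leRHS](divfK (lt0r_neq0 M0)); apply: ler_pM => //; exact: Hd.
by rewrite -[leRHS](divfK (lt0r_neq0 M0)) mulrC; apply: ler_pM => //; exact: Hd'.
Qed.

Lemma wclass_bounded i j v w : (i <= m)%N -> (j <= m)%N -> wclass i j v w ->
  exists2 C : R, 0 <= C & forall s t, 0 <= s <= l -> 0 <= t <= l -> `|w s t| <= C.
Proof.
move=> im jm /(wclass_weaken (leq0n v))/(wclass_bound im jm)[C C0 H].
by exists C => // s t sl tl; have := H s t sl tl; rewrite expr0 mulr1.
Qed.

Lemma wclass_UC i j v w : (i <= m)%N -> (j <= m)%N -> wclass i j v w -> UC2 l w.
Proof.
move=> im jm; elim=> {v w} [v v' A B cA cB|c|v v' w w' cw IH cw' IH'
  |v w w' cw IH cw' IH'|v v' w vv' cw IH].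
- have [B0 B00 HB] := rho_bound.
  have bnd u X (cX : vclass i j u X) : exists2 C : R, 0 < C &
      forall s t, 0 <= s <= l -> 0 <= t <= l -> sinorm (X s t) <= C.
    have [C C0 H] := vclass_bound im jm cX; exists (C * B0 ^+ u + 1) => [|s t sl tl].
      by rewrite ltr_wpDl// mulr_ge0// exprn_ge0// (le_trans _ B00).
    rewrite (le_trans (H s t sl tl))// ler_wpDr// ler_wpM2l// lerXn2r ?nnegrE ?sinorm_ge0//.
      by rewrite (le_trans _ B00).
    exact: HB.
  have [C C0 HC] := bnd _ _ cA; have [C' C'0 HC'] := bnd _ _ cB.
  move=> e e0; have e1 : 0 < e / 2 / C by rewrite !divr_gt0.
  have e2 : 0 < e / 2 / C' by rewrite !divr_gt0.
  have [d d0 Hd] := vclass_UC im jm cA e2; have [d' d'0 Hd'] := vclass_UC im jm cB e1.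
  exists (Num.min d d'); first by rewrite lt_min d0.
  move=> s t s' t' sl tl sl' tl'; rewrite !lt_min => /andP[? ?] /andP[? ?].
  rewrite (le_trans (ip_dist_le _ _ _ _))// (splitr e) lerD//.
    rewrite -[leRHS](divfK (lt0r_neq0 C'0)).
    by apply: ler_pM; rewrite ?sinorm_ge0//; [exact: Hd|exact: HC'].
  rewrite -[leRHS](divfK (lt0r_neq0 C0)) mulrC.
  by apply: ler_pM; rewrite ?sinorm_ge0//; [exact: Hd'|exact: HC].
- by move=> e e0; exists 1 => // *; rewrite subrr normr0 ltW.
- have [C _ HC] := wclass_bounded im jm cw; have [C' _ HC'] := wclass_bounded im jm cw'.
  exact: UC2M HC HC' IH IH'.
- exact: UC2D.
- exact: IH.
Qed.

Variable F : nat -> R -> R.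
Hypothesis Fcm : cm_seq F.
Hypothesis Flim : exists L : R, forall e : R, 0 < e -> exists2 d : R, 0 < d &
  forall t, 0 < t -> t < d -> `|F m t - L| <= e.

Lemma cm_seq_normE r x : 0 < x -> `|F r x| = (-1) ^+ r * F r x.
Proof.
move=> x0; have [_ h] := Fcm r x0.
by rewrite -(ger0_norm h) normrM normrX normrN1 expr1n mul1r.
Qed.

Lemma cm_seq_norm_le r x y : 0 < x -> x <= y -> `|F r y| <= `|F r x|.
Proof.
move=> x0 xy; rewrite !cm_seq_normE// ?(lt_le_trans x0)//.
exact: cm_seq_nonincreasing.
Qed.

Lemma cm_seq_gap_le r x h : 0 < x -> 0 <= h -> `|F r x - F r (x + h)| <= h * `|F r.+1 x|.
Proof.
move=> x0; rewrite le_eqVlt => /predU1P[<-|h0]; first by rewrite addr0 subrr normr0 mul0r.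
have [c [xc ch E]] : exists c, [/\ x < c, c < x + h &
    F r (x + h) - F r x = F r.+1 c * (x + h - x)].
  by apply: cm_seq_MVT => //; rewrite ltrDl.
rewrite distrC E [x + h]addrC addrK normrM (gtr0_norm h0) mulrC ler_wpM2l ?(ltW h0)//.
by apply: cm_seq_norm_le => //; exact: ltW.
Qed.

(** The difference with a shift of itself is completely monotonic too: the effect of a shift is
    largest at the smallest argument, which makes the estimates uniform in [s] and [t]. *)
Lemma cm_seq_gap_mono r x y h : 0 < x -> x <= y -> 0 <= h ->
  `|F r y - F r (y + h)| <= `|F r x - F r (x + h)|.
Proof.
move=> x0 xy h0; have cD := cm_seq_diff h0 Fcm.
have N u : 0 < u -> `|F r u - F r (u + h)| = (-1) ^+ r * (F r u - F r (u + h)).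
  move=> u0; have [_ p] := cD r u u0.
  by rewrite -(ger0_norm p) normrM normrX normrN1 expr1n mul1r.
rewrite !N ?(lt_le_trans x0)//.
exact: (@cm_seq_nonincreasing _ _ r x y cD).
Qed.

(** The mean value theorem on [[y / 2, y]], where the derivative of order [r.+1] is smallest in
    absolute value at [y]. *)
Lemma cm_seq_half r y : 0 < y ->
  `|F r.+1 y| * (y / 2) <= `|F r (y / 2)| - `|F r y|.
Proof.
move=> y0; have y20 : 0 < y / 2 by rewrite divr_gt0.
have y2y : y / 2 < y by lra.
have [c [yc cy E]] := cm_seq_MVT r Fcm y20 y2y.
have c0 := lt_trans y20 yc.
have -> : `|F r (y / 2)| - `|F r y| = `|F r.+1 c| * (y / 2).
  rewrite !cm_seq_normE// -mulrBr -opprB E exprS.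
  have -> : y - y / 2 = y / 2 by lra.
  by ring.
by rewrite ler_wpM2r ?(ltW y20)// cm_seq_norm_le// ltW.
Qed.

(** Descending induction on the order, from the limit of [F m]: below order [m], the next derivative
    is bounded near 0 and the function is Lipschitz there. *)
Lemma cm_seq_cauchy0 r (eta : R) : (r <= m)%N -> 0 < eta -> exists2 e0 : R, 0 < e0 &
  forall e e', 0 < e -> e <= e' -> e' <= e0 -> `|F r e - F r e'| <= eta.
Proof.
move=> rm; rewrite -(subKn rm); elim: (m - r)%N eta (leq_subr r m) => [|n IH] eta nm eta0.
  rewrite subn0; have [L HL] := Flim; have eta20 : 0 < eta / 2 by rewrite divr_gt0.
  have [d d0 H] := HL _ eta20; exists (d / 2); first by rewrite divr_gt0.
  move=> e e' ep ee' ed; have d2 : d / 2 < d by lra.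
  have -> : F m e - F m e' = (F m e - L) - (F m e' - L) by ring.
  rewrite (splitr eta) (le_trans (ler_normB _ _))// lerD// H//; lra.
have [e1 e10 H1] := IH _ (ltnW nm) (ltr01 : 0 < 1 :> R).
pose r' := (m - n.+1)%N; have r'E : (m - n = r'.+1)%N by rewrite /r'; lia.
rewrite -/r'; rewrite r'E in H1.
pose B := `|F r'.+1 e1| + 1; have B0 : 0 < B by rewrite ltr_wpDl.
exists (Num.min e1 (eta / B)); first by rewrite lt_min e10 divr_gt0.
move=> e e' ep ee'; rewrite le_min => /andP[e'1 e'2].
have eE : e + (e' - e) = e' by ring.
have := @cm_seq_gap_le r' e (e' - e) ep; rewrite subr_ge0 eE => /(_ ee') h.
rewrite (le_trans h)// -[leRHS](divfK (lt0r_neq0 B0)).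
apply: ler_pM => //; first by rewrite subr_ge0.
  by rewrite (le_trans _ e'2)// gerBl ltW.
rewrite -[F _ e](subrK (F r'.+1 e1)) (le_trans (ler_normD _ _))// /B addrC lerD2l.
by apply: H1 => //; exact: le_trans e'1.
Qed.

(* Each derivative beyond the m-th one costs at most one power of the argument. *)
Lemma cm_seq_tail q (eta : R) : 0 < eta -> exists2 y0 : R, 0 < y0 &
  forall y, 0 < y -> y <= y0 -> `|F (m + q.+1)%N y| * y ^+ q.+1 <= eta.
Proof.
elim: q eta => [|q IH] eta eta0; have eta20 : 0 < eta / 2 by rewrite divr_gt0.
  have [e0 e00 H] := cm_seq_cauchy0 (leqnn m) eta20; exists e0 => // y yp ye.
  have y20 : 0 < y / 2 by rewrite divr_gt0.
  have h1 := cm_seq_half m yp.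
  have h2 : `|F m (y / 2)| - `|F m y| <= eta / 2.
    by rewrite (le_trans (lerB_dist _ _))// H//; lra.
  by rewrite addn1 expr1; lra.
have ep : 0 < eta / 2 / 2 ^+ q.+1 by rewrite divr_gt0// exprn_gt0.
have [y0 y00 H] := IH _ ep; exists y0 => // y yp yy0.
have y20 : 0 < y / 2 by rewrite divr_gt0.
have h1 := cm_seq_half (m + q.+1) yp; have h2 := H (y / 2) y20 _.
have h3 : `|F (m + q.+1)%N (y / 2)| * (y / 2) ^+ q.+1 <= eta / 2 / 2 ^+ q.+1.
  by apply: h2; lra.
have p2 : (0 : R) < 2 ^+ q.+1 by exact: exprn_gt0.
move: h3; rewrite ler_pdivlMr// -mulrA -exprMn divfK ?pnatr_eq0// => h3.
have yq : 0 < y ^+ q.+1 by exact: exprn_gt0.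
have h4 : `|F (m + q.+2)%N y| * (y / 2) <= `|F (m + q.+1)%N (y / 2)|.
  by rewrite addnS; have := normr_ge0 (F (m + q.+1)%N y); lra.
have h5 : `|F (m + q.+2)%N y| * (y / 2) * y ^+ q.+1 <= eta / 2.
  by rewrite (le_trans _ h3)// ler_wpM2r// ltW.
by rewrite exprS; lra.
Qed.

Definition gam s t := ip (z 0 s - z 0 t) (z 0 s - z 0 t).

Lemma gamE s t : gam s t = rho s t ^+ 2. Proof. by rewrite sqr_sinorm. Qed.
Lemma gam_ge0 s t : 0 <= gam s t. Proof. exact: ip_ge0. Qed.
Lemma gamC s t : gam s t = gam t s. Proof. by rewrite !gamE /rho sinormBC. Qed.

Lemma wclass_gam i j : wclass i j 2 gam.
Proof. exact: (wclass_ip (vclass_diff i j) (vclass_diff i j)). Qed.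

(* Derivatives of the kernel [psi (gam s t + e)]: every term of total order [k]
   has at least [2 r - k] factors vanishing on the diagonal next to the r-th
   derivative of [psi]. *)
Inductive kclass (i j k : nat) : (R -> R -> R -> R) -> Prop :=
| kclass_term r v w : wclass i j v w -> (r.*2 <= v + k)%N ->
    kclass i j k (fun e s t => F r (gam s t + e) * w s t)
| kclass_add f g : kclass i j k f -> kclass i j k g ->
    kclass i j k (fun e s t => f e s t + g e s t).

Lemma kclass_swap i j k f : kclass i j k f -> kclass j i k (fun e s t => f e t s).
Proof.
elim=> [r v w cw rv|f1 f2 _ h1 _ h2]; last exact: kclass_add h1 h2.
rewrite (_ : (fun e s t => _) = fun e s t => F r (gam s t + e) * (fun s t => w t s) s t).
  exact: kclass_term (wclass_swap cw) rv.
by apply/funext => e; apply/funext => s; apply/funext => t; rewrite gamC.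
Qed.

(** Differentiating [F r] raises [r] by 1 but brings a factor [dg] of order 1; differentiating [w]
    lowers its order by at most 1. Either way the balance [2 r <= v + k] holds with [k.+1]. *)
Lemma kclass_deriv i j k f : (i < m)%N -> kclass i j k f ->
  exists f', kclass i.+1 j k.+1 f' /\ forall e s t, 0 < e -> 0 < s < l ->
    is_derive s (1 : R) (fun u => f e u t) (f' e s t).
Proof.
move=> im; elim=> [r v w cw rv|f1 f2 _ [g1 [c1 H1]] _ [g2 [c2 H2]]]; last first.
  exists (fun e s t => g1 e s t + g2 e s t); split; first exact: kclass_add.
  by move=> e s t e0 sl; apply: is_deriveD; [exact: H1|exact: H2].
have [dg [cdg Hdg]] := wclass_deriv im (wclass_gam i j).
have [dw [cdw Hdw]] := wclass_deriv im cw.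
exists (fun e s t => F r.+1 (gam s t + e) * (dg s t * w s t) + F r (gam s t + e) * dw s t).
split.
  apply: kclass_add.
    by apply: kclass_term (wclass_mul cdg (wclassS cw)) _; rewrite /= doubleS; lia.
  by apply: kclass_term cdw _; lia.
move=> e s t e0 sl.
have p : 0 < gam s t + e by rewrite ltr_wpDl// gam_ge0.
have dF : is_derive s (1 : R) (fun u => F r (gam u t + e)) (F r.+1 (gam s t + e) * dg s t).
  have [d1 _] := Fcm r p.
  have d2 : is_derive s (1 : R) (fun u => gam u t + e) (dg s t).
    have := Hdg s t sl => h; rewrite -[dg s t]addr0; exact: is_deriveD.
  exact: (@is_derive1_comp _ (F r) (fun u => gam u t + e) s _ _ d1 d2).
have dW := Hdw s t sl.
rewrite (_ : _ + _ = F r (gam s t + e) *: dw s t +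
    w s t *: (F r.+1 (gam s t + e) * dg s t)); last by rewrite /GRing.scale/=; ring.
exact: (@is_deriveM _ _ (fun u => F r (gam u t + e)) (fun u => w u t)).
Qed.

(** For a fixed [e > 0] the arguments of [F r] stay above [e], where it is bounded and Lipschitz. *)
Lemma kclass_UC i j k f e : (i <= m)%N -> (j <= m)%N -> kclass i j k f -> 0 < e ->
  UC2 l (f e).
Proof.
move=> im jm cf e0; elim: cf => [r v w cw _|f1 f2 _ h1 _ h2]; last exact: UC2D.
have [C C0 HC] := wclass_bounded im jm cw.
have p s t : 0 < gam s t + e by rewrite ltr_wpDl// gam_ge0.
apply: (UC2M (C := `|F r e|) _ HC _ (wclass_UC im jm cw)).
  by move=> s t _ _; rewrite cm_seq_norm_le// lerDr gam_ge0.
move=> eta eta0; pose M := `|F r.+1 e| + 1; have M0 : 0 < M by rewrite ltr_wpDl.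
have [d d0 H] := wclass_UC im jm (wclass_gam i j) (divr_gt0 eta0 M0).
exists d => // s t s' t' sl tl sl' tl' sd td.
have := H s t s' t' sl tl sl' tl' sd td.
wlog : s t s' t' sl tl sl' tl' sd td / gam s t <= gam s' t'.
  move=> W; have [/W|/ltW/W h] := leP (gam s t) (gam s' t'); first exact.
  by rewrite distrC [X in _ -> X <= _]distrC; apply: h => //; rewrite distrC.
move=> le hg; have := @cm_seq_gap_le r (gam s t + e) (gam s' t' - gam s t) (p s t).
have E : gam s t + e + (gam s' t' - gam s t) = gam s' t' + e by ring.
rewrite subr_ge0 E => /(_ le) h.
rewrite (le_trans h)// -[leRHS](divfK (lt0r_neq0 M0)); apply: ler_pM => //.
- by rewrite subr_ge0.
- by move: hg; rewrite distrC ger0_norm ?subr_ge0.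
- by rewrite /M ler_wpDr// cm_seq_norm_le// lerDr gam_ge0.
Qed.

(** A term with [r <= m] relies on the Cauchy property of [F r] at 0. If [r > m], then [k <= 2 m]
    forces [w] to be at most a multiple of [gam ^+ (r - m)], which compensates [F r] near the
    diagonal; away from it, [F r] is Lipschitz. *)
Lemma kclass_cauchy i j k f : (i <= m)%N -> (j <= m)%N -> (k <= m.*2)%N -> kclass i j k f ->
  forall eta : R, 0 < eta -> exists2 e0 : R, 0 < e0 & forall e e', 0 < e -> e <= e' ->
    e' <= e0 -> forall s t, 0 <= s <= l -> 0 <= t <= l -> `|f e s t - f e' s t| <= eta.
Proof.
move=> im jm km; elim=> [r v w cw rv|f1 f2 _ h1 _ h2] eta eta0; last first.
  have eta20 : 0 < eta / 2 by rewrite divr_gt0.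
  have [a a0 Ha] := h1 _ eta20; have [b b0 Hb] := h2 _ eta20.
  exists (Num.min a b); first by rewrite lt_min a0.
  move=> e e' e0 ee'; rewrite le_min => /andP[ea eb] s t sl tl.
  by rewrite opprD addrACA (splitr eta) (le_trans (ler_normD _ _))// lerD ?Ha ?Hb.
have gapE e e' s t : 0 < e -> e <= e' -> 
    F r (gam s t + e') = F r (gam s t + e + (e' - e)).
  by move=> _ _; congr F; ring.
have [rm|mr] := leqP r m.
  have [C C0 HC] := wclass_bounded im jm cw.
  have C1 : 0 < C + 1 by rewrite ltr_wpDl.
  have [e0 e00 H] := cm_seq_cauchy0 rm (divr_gt0 eta0 C1).
  exists e0 => // e e' ep ee' e'e0 s t sl tl.
  rewrite -mulrBl normrM -[leRHS](divfK (lt0r_neq0 C1)); apply: ler_pM => //.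
    rewrite (gapE _ _ _ _ ep ee') (le_trans (cm_seq_gap_mono r ep _ _))//.
    - by rewrite lerDr gam_ge0.
    - by rewrite subr_ge0.
    - by have -> : e + (e' - e) = e' by [ring]; exact: H.
  by rewrite (le_trans (HC s t sl tl))// lerDl.
pose q := (r - m).-1; have rE : r = (m + q.+1)%N by rewrite /q; lia.
have cw' : wclass i j q.+1.*2 w by apply: wclass_weaken cw; rewrite /q; lia.
have [C C0 HC] := wclass_bound im jm cw'.
have HC' s t : 0 <= s <= l -> 0 <= t <= l -> `|w s t| <= C * gam s t ^+ q.+1.
  by move=> sl tl; rewrite gamE -exprM mul2n; exact: HC.
have C1 : 0 < C + 1 by rewrite ltr_wpDl.
have [y0 y00 Hy] := cm_seq_tail q (divr_gt0 eta0 C1).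
have [B B1 HB] := rho_bound.
have B0 : 0 <= B by rewrite (le_trans _ B1).
pose M := `|F r.+1 (y0 / 2)| * (C * (B ^+ 2) ^+ q.+1) + 1.
have M0 : 0 < M by rewrite ltr_wpDl// !mulr_ge0// !exprn_ge0.
exists (Num.min (y0 / 2) (eta / M)); first by rewrite lt_min !divr_gt0.
move=> e e' ep ee'; rewrite le_min => /andP[e1 e2] s t sl tl.
have e'p := lt_le_trans ep ee'.
rewrite -mulrBl normrM (gapE _ _ _ _ ep ee').
(* As [e <= y0 / 2] too, [gam s t + e] stays in the range of [Hy] near the diagonal. *)
have [gs|gl] := leP (gam s t) (y0 / 2).
  apply: (@le_trans _ _ (`|F r (gam s t + e)| * (C * (gam s t + e) ^+ q.+1))).
    apply: ler_pM => //.
      have p : 0 < gam s t + e by rewrite ltr_wpDl// gam_ge0.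
      have p' : 0 < gam s t + e + (e' - e) by rewrite ltr_pwDl// subr_ge0.
      have le : gam s t + e <= gam s t + e + (e' - e) by rewrite lerDl subr_ge0.
      have := cm_seq_nonincreasing r Fcm p le.
      have [_ h1] := Fcm r p; have [_ h2] := Fcm r p' => h3.
      rewrite (cm_seq_normE r p); move: h1 h2 h3; rewrite -signr_odd.
      by case: (odd r); rewrite ?expr1 ?expr0 ?mulN1r ?mul1r => *;
        rewrite ler_norml; apply/andP; split; lra.
    rewrite (le_trans (HC' s t sl tl))// ler_wpM2l// lerXn2r ?nnegrE ?gam_ge0//.
      by rewrite addr_ge0 ?gam_ge0// ltW.
    by rewrite lerDl ltW.
  have h : `|F r (gam s t + e)| * (gam s t + e) ^+ q.+1 <= eta / (C + 1).
    by rewrite rE; apply: Hy; [rewrite ltr_wpDl// gam_ge0|lra].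
  rewrite mulrCA (le_trans (ler_wpM2l C0 h))// mulrCA ger_pMr// ler_pdivrMr// mul1r.
  by rewrite lerDl.
have y20 : 0 < y0 / 2 by rewrite divr_gt0.
apply: (@le_trans _ _ (((e' - e) * `|F r.+1 (y0 / 2)|) * (C * (B ^+ 2) ^+ q.+1))).
  apply: ler_pM => //.
    rewrite (le_trans (cm_seq_gap_mono r y20 _ _)) ?subr_ge0//.
      by rewrite (le_trans (ltW gl))// lerDl ltW.
    by apply: cm_seq_gap_le => //; rewrite subr_ge0.
  rewrite (le_trans (HC' s t sl tl))// ler_wpM2l// lerXn2r ?nnegrE ?gam_ge0 ?exprn_ge0//.
  by rewrite gamE lerXn2r ?nnegrE ?sinorm_ge0// HB.
rewrite -mulrA (@le_trans _ _ (eta / M * M))//; last by rewrite divfK// gt_eqF.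
apply: ler_pM; rewrite ?subr_ge0 ?mulr_ge0 ?exprn_ge0//.
  by rewrite (le_trans _ e2)// gerBl ltW.
by rewrite /M lerDl.
Qed.

Lemma UC2_within w t a b : UC2 l w -> 0 <= t <= l -> 0 <= a -> b <= l ->
  {within `[a, b], continuous (fun u => w u t)}.
Proof.
move=> wc tl a0 bl; apply/subspace_continuousP => x; rewrite /= in_itv/= => /andP[ax xb].
apply/cvgrPdist_le => e e0; have [d d0 H] := wc _ e0.
exists d => //= u /= ud; rewrite in_itv/= => /andP[au ub].
apply: H => //; last by rewrite subrr normr0.
  by rewrite (le_trans a0 ax) (le_trans xb bl).
by rewrite (le_trans a0 au) (le_trans ub bl).
Qed.

(** The mean value theorem in [s], then in [t]; the derivative in [t] is that in [s] of the swapped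
    kernel. *)
Lemma kclass_step k n f : (k < m)%N -> kclass k k n f ->
  exists f2, kclass k.+1 k.+1 n.+2 f2 /\ forall e s0 s1 t0 t1 : R, 0 < e ->
    0 <= s0 -> s0 < s1 -> s1 <= l -> 0 <= t0 -> t0 < t1 -> t1 <= l ->
    exists xi zeta, [/\ s0 <= xi <= s1, t0 <= zeta <= t1 &
      f e s1 t1 - f e s0 t1 - f e s1 t0 + f e s0 t0 =
        (s1 - s0) * (t1 - t0) * f2 e xi zeta].
Proof.
move=> km cf; have [f1 [cf1 H1]] := kclass_deriv km cf.
have [g [cg Hg]] := kclass_deriv km (kclass_swap cf1).
exists (fun e s t => g e t s); split; first exact: kclass_swap cg.
move=> e s0 s1 t0 t1 e0 s00 s01 s1l t00 t01 t1l.
have kl := ltnW km.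
have fc := kclass_UC kl kl cf e0.
have f1c := kclass_UC kl km (kclass_swap cf1) e0.
have t0l : 0 <= t0 <= l by rewrite t00 (le_trans (ltW t01)).
have t1l' : 0 <= t1 <= l by rewrite t1l (le_trans t00 (ltW t01)).
have [xi xi01 E1] : exists2 xi, xi \in `]s0, s1[ &
    (f e s1 t1 - f e s1 t0) - (f e s0 t1 - f e s0 t0) =
    (f1 e xi t1 - f1 e xi t0) * (s1 - s0).
  apply: (@MVT _ (fun u => f e u t1 - f e u t0) (fun u => f1 e u t1 - f1 e u t0)) => //.
    move=> u; rewrite in_itv/= => /andP[u0 u1].
    have ul : 0 < u < l by rewrite (le_lt_trans s00 u0) (lt_le_trans u1 s1l).
    by apply: is_deriveB; exact: H1.
  move=> u; apply: continuousB; exact: (UC2_within fc).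
move: xi01; rewrite in_itv/= => /andP[sxi xis].
have xil : 0 <= xi <= l by rewrite (le_trans s00 (ltW sxi)) (le_trans (ltW xis) s1l).
have [ze ze01 E2] : exists2 ze, ze \in `]t0, t1[ &
    f1 e xi t1 - f1 e xi t0 = g e ze xi * (t1 - t0).
  apply: (@MVT _ (fun v => f1 e xi v) (fun v => g e v xi)) => //.
    move=> v; rewrite in_itv/= => /andP[v0 v1].
    have vl : 0 < v < l by rewrite (le_lt_trans t00 v0) (lt_le_trans v1 t1l).
    exact: Hg.
  exact: (UC2_within f1c).
move: ze01; rewrite in_itv/= => /andP[tze zet].
exists xi, ze; split; rewrite ?(ltW sxi) ?(ltW xis) ?(ltW tze) ?(ltW zet)//.
rewrite -[LHS](_ : (f e s1 t1 - f e s1 t0) - (f e s0 t1 - f e s0 t0) = _); last by ring.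
by rewrite E1 E2; ring.
Qed.

Lemma uniform_limit (f : R -> R -> R -> R) : (forall e, 0 < e -> UC2 l (f e)) ->
  (forall eta : R, 0 < eta -> exists2 e0 : R, 0 < e0 & forall e e', 0 < e -> e <= e' ->
    e' <= e0 -> forall s t, 0 <= s <= l -> 0 <= t <= l -> `|f e s t - f e' s t| <= eta) ->
  exists2 g : R -> R -> R, UC2 l g & forall eta : R, 0 < eta -> exists2 e0 : R, 0 < e0 &
    forall e, 0 < e -> e <= e0 ->
      forall s t, 0 <= s <= l -> 0 <= t <= l -> `|f e s t - g s t| <= eta.
Proof.
move=> fc fcau; pose u s t n := f (n.+1%:R^-1) s t.
have small (e0 : R) : 0 < e0 -> exists N, forall n, (N <= n)%N -> n.+1%:R^-1 <= e0 :> R.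
  move=> e00; exists (Num.truncn e0^-1) => n Nn.
  rewrite -[leRHS]invrK lef_pV2 ?posrE ?invr_gt0//.
  by rewrite (le_trans (ltW (truncnS_gt _)))// ler_nat.
have ucvg s t : 0 <= s <= l -> 0 <= t <= l -> cvgn (u s t).
  move=> sl tl; apply/cauchy_cvgP/cauchy_exP => eta eta0.
  have eta20 : 0 < eta / 2 by rewrite divr_gt0.
  have [e0 e00 H] := fcau _ eta20; have [N HN] := small _ e00.
  exists (u s t N); exists N => // n /= Nn; rewrite /ball/= distrC.
  have h : `|u s t n - u s t N| <= eta / 2.
    by apply: H; rewrite ?HN// ?invr_gt0// lef_pV2 ?posrE// ler_nat.
  by rewrite (le_lt_trans h)// ltr_pdivrMr// ltr_pMr// ltr1n.
pose g s t := limn (u s t).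
have gf (eta : R) : 0 < eta -> exists2 e0 : R, 0 < e0 & forall e, 0 < e -> e <= e0 ->
    forall s t, 0 <= s <= l -> 0 <= t <= l -> `|f e s t - g s t| <= eta.
  move=> eta0; have eta20 : 0 < eta / 2 by rewrite divr_gt0.
  have [e0 e00 H] := fcau _ eta20; exists e0 => // e ep ee0 s t sl tl.
  have [N HN] := small _ ep.
  have /cvgrPdist_le/(_ _ eta20)[N' _ HN'] : u s t @ \oo --> g s t by exact: ucvg.
  pose n := maxn N N'.
  have -> : f e s t - g s t = - (u s t n - f e s t) - (g s t - u s t n) by ring.
  rewrite (splitr eta) (le_trans (ler_normB _ _))// lerD// ?normrN.
    by apply: H; rewrite ?invr_gt0// HN// leq_maxl.
  by apply: HN'; exact: leq_maxr.
exists g => // eta eta0; have eta30 : 0 < eta / 3 by rewrite divr_gt0.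
have [e0 e00 H] := gf _ eta30; have [d d0 Hd] := fc _ e00 _ eta30.
exists d => // s t s' t' sl tl sl' tl' sd td.
have -> : g s t - g s' t' = - (f e0 s t - g s t) + (f e0 s t - f e0 s' t')
  + (f e0 s' t' - g s' t') by ring.
apply: (@le_trans _ _ (eta / 3 + eta / 3 + eta / 3)); last by lra.
rewrite (le_trans (ler_normD _ _))// lerD ?H// (le_trans (ler_normD _ _))// lerD ?Hd//.
by rewrite normrN H.
Qed.

Variable psi : R -> R.
Hypothesis psiF : forall x e : R, 0 <= x -> 0 < e -> exists2 d : R, 0 < d &
  forall h, 0 < h -> h < d -> `|F 0%N (x + h) - psi x| <= e.

(** The mean value identities of the regularized kernels survive the uniform limit only up to [eta],
    because their intermediate points vary with [e]. *)
Lemma kernel_chain : exists c : nat -> R -> R -> R,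
  [/\ forall s t, 0 <= s <= l -> 0 <= t <= l -> c 0%N s t = psi (gam s t),
    forall k, (k <= m)%N -> UC2 l (c k) &
    forall k, (k < m)%N -> forall s0 s1 t0 t1 : R,
      0 <= s0 -> s0 < s1 -> s1 <= l -> 0 <= t0 -> t0 < t1 -> t1 <= l ->
      forall eta : R, 0 < eta -> exists xi zeta, [/\ s0 <= xi <= s1, t0 <= zeta <= t1 &
        `|c k s1 t1 - c k s0 t1 - c k s1 t0 + c k s0 t0
          - (s1 - s0) * (t1 - t0) * c k.+1 xi zeta| <= eta]].
Proof.
have [f [f0 fcl fDD]] : exists f : nat -> R -> R -> R -> R,
  [/\ f 0%N = (fun e s t => F 0%N (gam s t + e) * 1),
    forall k, (k <= m)%N -> kclass k k k.*2 (f k) &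
    forall k, (k < m)%N -> forall e s0 s1 t0 t1 : R, 0 < e ->
      0 <= s0 -> s0 < s1 -> s1 <= l -> 0 <= t0 -> t0 < t1 -> t1 <= l ->
      exists xi zeta, [/\ s0 <= xi <= s1, t0 <= zeta <= t1 &
        f k e s1 t1 - f k e s0 t1 - f k e s1 t0 + f k e s0 t0 =
        (s1 - s0) * (t1 - t0) * f k.+1 e xi zeta]].
  suff : forall n, (n <= m)%N -> exists f : nat -> R -> R -> R -> R,
    [/\ f 0%N = (fun e s t => F 0%N (gam s t + e) * 1),
      forall k, (k <= n)%N -> kclass k k k.*2 (f k) &
      forall k, (k < n)%N -> forall e s0 s1 t0 t1 : R, 0 < e ->
        0 <= s0 -> s0 < s1 -> s1 <= l -> 0 <= t0 -> t0 < t1 -> t1 <= l ->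
        exists xi zeta, [/\ s0 <= xi <= s1, t0 <= zeta <= t1 &
          f k e s1 t1 - f k e s0 t1 - f k e s1 t0 + f k e s0 t0 =
          (s1 - s0) * (t1 - t0) * f k.+1 e xi zeta]] by apply.
  elim=> [_|n IH nm].
    exists (fun _ e s t => F 0%N (gam s t + e) * 1); split => // k.
    rewrite leqn0 => /eqP ->.
    exact: (kclass_term (wclass_cst 0 0 1)).
  have [f [f0 f1 f2]] := IH (ltnW nm).
  have [g [cg Hg]] := kclass_step nm (f1 n (leqnn _)).
  exists (fun k => if (k <= n)%N then f k else g); split => //.
    move=> k; rewrite leq_eqVlt => /predU1P[->|]; first by rewrite ltnn doubleS.
    by rewrite ltnS => kn; rewrite kn; exact: f1.
  move=> k; rewrite ltnS => kn; rewrite kn; have [kn'|nk] := ltnP k n; first exact: f2.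
  by have -> : k = n by [apply/eqP; rewrite eqn_leq kn]; exact: Hg.
have /choice[c Hc] : forall k, exists g : R -> R -> R, (k <= m)%N -> UC2 l g /\
    forall eta : R, 0 < eta -> exists2 e0 : R, 0 < e0 & forall e, 0 < e -> e <= e0 ->
      forall s t, 0 <= s <= l -> 0 <= t <= l -> `|f k e s t - g s t| <= eta.
  move=> k; case: (leqP k m) => [km|_]; last by exists (fun _ _ => 0).
  have [|eta eta0|g gc Hg] := @uniform_limit (f k).
  - by move=> e; exact: kclass_UC (fcl k km).
  - by apply: (kclass_cauchy _ _ _ (fcl k km)); rewrite ?leq_double.
  - by exists g.
exists c; split.
- move=> s t sl tl; apply/eqP; rewrite -subr_eq0 -normr_le0.
  apply/ler_addgt0Pr => e e0; rewrite add0r; have e20 : 0 < e / 2 by rewrite divr_gt0.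
  have [_ H] := Hc 0%N (leq0n m); have [e1 e10 H1] := H _ e20.
  have [d d0 Hd] := psiF (gam_ge0 s t) e20.
  pose h := Num.min e1 (d / 2).
  have h0 : 0 < h by rewrite lt_min e10 divr_gt0.
  have hd : h < d by rewrite gt_min; apply/orP; right; lra.
  have he : h <= e1 by rewrite ge_min lexx.
  have -> : c 0%N s t - psi (gam s t) =
      - (f 0%N h s t - c 0%N s t) + (F 0%N (gam s t + h) - psi (gam s t)).
    by rewrite f0; ring.
  by rewrite (splitr e) (le_trans (ler_normD _ _))// normrN lerD ?H1 ?Hd.
- by move=> k km; have [] := Hc k km.
- move=> k km s0 s1 t0 t1 s00 s01 s1l t00 t01 t1l eta eta0.
  pose A := (s1 - s0) * (t1 - t0); have A0 : 0 < A by rewrite mulr_gt0// subr_gt0.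
  (* Four corners and one value multiplied by the area [A], each with error [e1]. *)
  pose e1 := eta / (4 + A); have e10 : 0 < e1 by rewrite divr_gt0// ltr_wpDl.
  have [_ H] := Hc k (ltnW km); have [a a0 Ha] := H _ e10.
  have [_ H'] := Hc k.+1 km; have [b b0 Hb] := H' _ e10.
  pose e := Num.min a b; have e0 : 0 < e by rewrite lt_min a0.
  have ea : e <= a by rewrite ge_min lexx.
  have eb : e <= b by rewrite ge_min lexx orbT.
  have [xi [ze [xis zes E]]] := fDD k km e s0 s1 t0 t1 e0 s00 s01 s1l t00 t01 t1l.
  exists xi, ze; split => //.
  have s0l : 0 <= s0 <= l by rewrite s00 (le_trans (ltW s01)).
  have s1l' : 0 <= s1 <= l by rewrite s1l (le_trans s00 (ltW s01)).
  have t0l : 0 <= t0 <= l by rewrite t00 (le_trans (ltW t01)).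
  have t1l' : 0 <= t1 <= l by rewrite t1l (le_trans t00 (ltW t01)).
  have xil : 0 <= xi <= l.
    by have /andP[? ?] := xis; rewrite (le_trans s00)//= (le_trans _ s1l).
  have zel : 0 <= ze <= l.
    by have /andP[? ?] := zes; rewrite (le_trans t00)//= (le_trans _ t1l).
  have h1 := Ha e e0 ea s1 t1 s1l' t1l'; have h2 := Ha e e0 ea s0 t1 s0l t1l'.
  have h3 := Ha e e0 ea s1 t0 s1l' t0l; have h4 := Ha e e0 ea s0 t0 s0l t0l.
  have h5 : `|A * (f k.+1 e xi ze - c k.+1 xi ze)| <= A * e1.
    by rewrite normrM gtr0_norm// ler_wpM2l ?(ltW A0)// Hb.
  have sum : 4 * e1 + A * e1 = eta.
    by rewrite -mulrDl /e1 mulrC divfK// gt_eqF// ltr_wpDl.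
  have h6 : f k e s1 t1 - f k e s0 t1 - f k e s1 t0 + f k e s0 t0 = A * f k.+1 e xi ze.
    exact: E.
  rewrite -/A; move: h1 h2 h3 h4 h5; rewrite mulrBr !ler_norml.
  move=> /andP[? ?] /andP[? ?] /andP[? ?] /andP[? ?] /andP[? ?].
  by apply/andP; split; lra.
Qed.

Theorem path_Cm (W : semiInner R) (y : R -> W) : si_complete W ->
  (forall s t, 0 <= s <= l -> 0 <= t <= l -> ip (y s) (y t) = psi (gam s t)) ->
  exists D : nat -> R -> W, [/\ D 0%N = y,
    forall k, (k < m)%N -> forall t, 0 <= t <= l -> vderiv l (D k) t (D k.+1 t) &
    forall e : R, 0 < e -> exists2 d : R, 0 < d & forall s t, 0 <= s <= l -> 0 <= t <= l ->
      `|s - t| < d -> sinorm (D m s - D m t) <= e].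
Proof.
move=> Wc yE; have [c [c0 cU cDD]] := kernel_chain.
have yc s t : 0 <= s <= l -> 0 <= t <= l -> ip (y s) (y t) = c 0%N s t.
  by move=> sl tl; rewrite c0// yE.
have [D [D0 D1 D2]] := kernel_Cm l0 Wc yc cU cDD.
exists D; split => // e e0; have e20 : 0 < e ^+ 2 / 2 by rewrite divr_gt0// exprn_gt0.
have [d d0 H] := cU m (leqnn m) _ e20; exists d => // s t sl tl std.
rewrite sinorm_le ?(ltW e0)// ipBl !ipBr !D2//.
have zz (x : R) : `|x - x| < d by rewrite subrr normr0.
have ts : `|t - s| < d by rewrite distrC.
have := H s s s t sl sl sl tl (zz s) std; have := H t t t s tl tl tl sl (zz t) ts.
by rewrite !ler_norml => /andP[? ?] /andP[? ?]; lra.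
Qed.

End KernelCalculus.

(** * The Cauchy-Schwarz inequality for integrals *)

Section RealIntegral.
Context {R : realType} {d : measure_display} {T : measurableType d}.
Variable mu : {measure set T -> \bar R}.

Lemma Rintegral_lin (D : set T) (I : Type) (r : seq I) (a : I -> R) (f : I -> T -> R) :
  measurable D -> (forall i, mu.-integrable D (EFin \o f i)) ->
  mu.-integrable D (EFin \o (fun x => \sum_(i <- r) a i * f i x)) /\
  \int[mu]_(x in D) (\sum_(i <- r) a i * f i x) = \sum_(i <- r) a i * \int[mu]_(x in D) f i x.
Proof.
move=> mD fi; elim: r => [|i r [int E]].
  split.
    rewrite (_ : EFin \o _ = cst 0%E); first exact: integrable0.
    by apply/funext => x; rewrite /= big_nil.
  by rewrite big_nil /Rintegral; under eq_integral do rewrite big_nil; rewrite integral0.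
have ii : mu.-integrable D (EFin \o (fun x => a i * f i x)).
  have := integrableZl mD (a i) (fi i).
  by apply: eq_integrable => // x _; rewrite /= EFinM.
have -> : (fun x => \sum_(j <- i :: r) a j * f j x) =
    (fun x => a i * f i x) \+ (fun x => \sum_(j <- r) a j * f j x).
  by apply/funext => x; rewrite /= big_cons.
split.
  by have := integrableD mD ii int; apply: eq_integrable => // x _; rewrite /= EFinD.
by rewrite big_cons RintegralD// E RintegralZl.
Qed.

(** The discriminant of the integral of [(h + c) ^+ 2], a nonnegative polynomial in [c]. *)
Lemma Rintegral_sqr_le (D : set T) (h : T -> R) : measurable D ->
  (mu D < +oo)%E -> mu.-integrable D (EFin \o h) ->
  mu.-integrable D (EFin \o (fun x => h x ^+ 2)) ->
  (\int[mu]_(x in D) h x) ^+ 2 <= fine (mu D) * \int[mu]_(x in D) (h x ^+ 2).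
Proof.
move=> mD Dfin ih ih2; pose A := fine (mu D); pose J := \int[mu]_(x in D) h x.
pose Q := \int[mu]_(x in D) (h x ^+ 2); rewrite -/A -/J -/Q.
have A0 : 0 <= A by exact: fine_ge0.
have H c : 0 <= Q + c * J *+ 2 + c ^+ 2 * A.
  have ic : mu.-integrable D (EFin \o cst (c ^+ 2)).
    by apply: measurable_bounded_integrable => //; exact/bounded_cst.
  have ich : mu.-integrable D (EFin \o (fun x => 2 * c * h x)).
    have := integrableZl mD (2 * c) ih.
    by apply: eq_integrable => // x _; rewrite /= EFinM.
  have isum : mu.-integrable D (EFin \o ((fun x => 2 * c * h x) \+ cst (c ^+ 2))).
    by have := integrableD mD ich ic; apply: eq_integrable => // x _; rewrite /= EFinD.
  have : 0 <= \int[mu]_(x in D) ((h x + c) ^+ 2).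
    by apply: Rintegral_ge0 => x _; exact: sqr_ge0.
  rewrite (_ : (fun x => (h x + c) ^+ 2) =
    (fun x => h x ^+ 2) \+ ((fun x => 2 * c * h x) \+ cst (c ^+ 2))); last first.
    by apply/funext => x; rewrite /= /cst; ring.
  rewrite RintegralD// RintegralD// RintegralZl// Rintegral_cst// -/Q -/J -/A.
  by congr (_ <= _); ring.
have [A00|An0] := eqVneq A 0.
  rewrite A00 mul0r; have [->|Jn0] := eqVneq J 0; first by rewrite expr0n.
  have := H (- (Q + 1) / (J *+ 2)); rewrite A00 mulr0 addr0 -mulrnAr divfK; last first.
    by rewrite mulrn_eq0.
  by rewrite opprD addrA subrr sub0r oppr_ge0 ler10.
have Ap : 0 < A by rewrite lt_def An0.
have := H (- J / A).
have -> : Q + - J / A * J *+ 2 + (- J / A) ^+ 2 * A = (A * Q - J ^+ 2) / A by field.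
by rewrite pmulr_lge0 ?invr_gt0// subr_ge0.
Qed.

End RealIntegral.

(** * Bounds for successive derivatives on a segment *)

Section SegmentCalculus.
Context {R : realType}.

Definition seg_derives (l : R) (f f' : R -> R) := forall t, 0 <= t <= l ->
  forall e : R, 0 < e -> exists2 d : R, 0 < d & forall s, 0 <= s <= l -> s != t ->
    `|s - t| < d -> `|(f s - f t) / (s - t) - f' t| <= e.

Lemma seg_derivesP l f f' : seg_derives l f f' <->
  forall t, 0 <= t <= l -> seg_quot l f t --> f' t.
Proof.
split=> [H t tl|H t tl e e0].
  apply/seg_quot_cvgP => e e0; have [d d0 Hd] := H t tl e e0.
  by exists d => // s s0 sl; apply: Hd; rewrite s0.
have /seg_quot_cvgP/(_ _ e0)[d d0 Hd] := H t tl.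
by exists d => // s /andP[s0 sl]; exact: Hd.
Qed.

Lemma seg_derives_lim l f f' t : seg_derives l f f' -> 0 <= t <= l ->
  forall e : R, 0 < e -> exists2 d : R, 0 < d & forall s, 0 <= s <= l ->
    `|s - t| < d -> `|f s - f t| <= e.
Proof.
move=> H tl e e0; have [d d0 Hd] := H t tl 1 ltr01.
pose M := `|f' t| + 1; have M0 : 0 < M by rewrite ltr_wpDl.
exists (Num.min d (e / M)); first by rewrite lt_min d0 divr_gt0.
move=> s sl; rewrite lt_min => /andP[sd sM].
have [->|st] := eqVneq s t; first by rewrite subrr normr0 ltW.
have h := Hd s sl st sd; have q : `|(f s - f t) / (s - t)| <= M.
  rewrite -[_ / _](subrK (f' t)) (le_trans (ler_normD _ _))// /M addrC lerD2l//.
have st0 : s - t != 0 by rewrite subr_eq0.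
rewrite -[f s - f t](divfK st0) normrM -[leRHS](divfK (lt0r_neq0 M0)) mulrC.
by apply: ler_pM => //; exact: ltW.
Qed.

Lemma seg_MVT l f f' a b : seg_derives l f f' -> 0 <= a -> a < b -> b <= l ->
  exists c, [/\ a < c, c < b & f b - f a = f' c * (b - a)].
Proof.
move=> H a0 ab bl; have [||c] := @MVT R f f' a b ab.
- move=> x; rewrite in_itv/= => /andP[ax xb]; apply: is_derive_eps => e e0.
  have x0 : 0 < x by exact: le_lt_trans ax.
  have xl : x < l by exact: lt_le_trans bl.
  have [|d d0 Hd] := H x _ e e0; first by rewrite !ltW.
  exists (Num.min d (Num.min x (l - x))); first by rewrite !lt_min d0 x0 subr_gt0.
  move=> u ux; rewrite !lt_min => /and3P[ud u1 u2]; apply: Hd => //.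
  by move: u1 u2; rewrite !ltr_norml => /andP[? ?] /andP[? ?]; apply/andP; split; lra.
- apply/subspace_continuousP => x; rewrite /= in_itv/= => /andP[ax xb].
  apply/cvgrPdist_le => e e0.
  have [|d d0 Hd] := seg_derives_lim H (_ : 0 <= x <= l) e0.
    by rewrite (le_trans a0)//= (le_trans xb).
  exists d => //= u ud; rewrite in_itv/= => /andP[au ub]; rewrite distrC; apply: Hd.
    by rewrite (le_trans a0)//= (le_trans ub).
  by rewrite distrC.
- by rewrite in_itv/= => /andP[? ?] ?; exists c.
Qed.

(* The mean value theorem, applied to iterated difference quotients of step [h]. *)
Lemma derivative_bound_somewhere j l h (g : nat -> R -> R) (M : R) :
  (forall i, (i < j)%N -> seg_derives l (g i) (g i.+1)) -> 0 < h -> j%:R * h <= l ->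
  (forall i, (i <= j)%N -> `|g 0%N (i%:R * h)| <= M) ->
  exists2 xi, 0 <= xi <= l & `|g j xi| <= (2 / h) ^+ j * M.
Proof.
elim: j l g M => [|j IH] l g M dg h0 jl gM.
  exists 0; first by rewrite lexx (le_trans _ jl)// mul0r.
  by have := gM 0%N (leqnn _); rewrite mul0r expr0 mul1r.
pose G i t := (g i (t + h) - g i t) / h.
have jl' : j%:R * h <= l - h by move: jl; rewrite -natr1 mulrDl mul1r; lra.
have [||xi /andP[xi0 xil] Hxi] := IH (l - h) G (2 / h * M) _ h0 jl' _.
- move=> i ij t /andP[t0 tl] e e0.
  have t1 : 0 <= t <= l by apply/andP; split; lra.
  have t2 : 0 <= t + h <= l by apply/andP; split; lra.
  have eh : 0 < e * h / 2 by rewrite divr_gt0// mulr_gt0.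
  have [d1 d10 H1] := dg i (leqW ij) t t1 _ eh.
  have [d2 d20 H2] := dg i (leqW ij) (t + h) t2 _ eh.
  exists (Num.min d1 d2); first by rewrite lt_min d10.
  move=> s /andP[s0 sl] st; rewrite lt_min => /andP[sd1 sd2].
  have E : s + h - (t + h) = s - t by ring.
  have q1 : `|(g i s - g i t) / (s - t) - g i.+1 t| <= e * h / 2.
    by apply: H1 => //; apply/andP; split; lra.
  have q2 : `|(g i (s + h) - g i (t + h)) / (s - t) - g i.+1 (t + h)| <= e * h / 2.
    rewrite -E; apply: H2; rewrite ?E//; first by apply/andP; split; lra.
    by rewrite (inj_eq (addIr h)).
  have st0 : s - t != 0 by rewrite subr_eq0.
  have -> : (G i s - G i t) / (s - t) - G i.+1 t =
      (((g i (s + h) - g i (t + h)) / (s - t) - g i.+1 (t + h)) -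
       ((g i s - g i t) / (s - t) - g i.+1 t)) / h.
    by rewrite /G; field; rewrite st0 gt_eqF.
  rewrite normrM normfV (gtr0_norm h0) ler_pdivrMr//.
  by rewrite (le_trans (ler_normB _ _))//; lra.
- move=> i ij; rewrite /G normrM normfV (gtr0_norm h0) ler_pdivrMr//.
  have -> : 2 / h * M * h = M + M by field; rewrite gt_eqF.
  rewrite (le_trans (ler_normB _ _))// lerD//; last by apply: gM; exact: leqW.
  by have := gM i.+1 ij; rewrite -natr1 mulrDl mul1r.
have xih : xi < xi + h by rewrite ltrDl.
have xihl : xi + h <= l by lra.
have [c [xc ch E]] := seg_MVT (dg j (leqnn _)) xi0 xih xihl.
exists c; first by apply/andP; split; lra.
have -> : g j.+1 c = G j xi.
  by rewrite /G E [xi + h]addrC addrK mulfK// gt_eqF.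
by rewrite exprSr -mulrA.
Qed.

(** Interpolation, in descending order from the Hölder bound on [g m]: each [g j] is bounded at one
    point by the grid values of [g 0], then everywhere by the bound on [g j.+1]. The constant
    precedes [g], which makes it uniform over linear combinations. *)
Lemma chain_bound (m : nat) l (B : R) : 0 < l -> 0 <= B ->
  exists2 C : R, 0 <= C & forall (g : nat -> R -> R) (N : R), 0 <= N ->
    (forall i, (i < m)%N -> seg_derives l (g i) (g i.+1)) ->
    (forall i, (i <= m)%N -> `|g 0%N (i%:R * (l / m.+1%:R))| <= B * N) ->
    (forall s t, 0 <= s -> s <= t -> t <= l -> `|g m t - g m s| <= Num.sqrt (t - s) * N) ->
    forall j, (j <= m)%N -> forall t, 0 <= t <= l -> `|g j t| <= C * N.
Proof.
move=> l0 B0; pose h := l / m.+1%:R; have h0 : 0 < h by rewrite divr_gt0.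
(* Being at least 1, [q] makes [q ^+ m] dominate [(2 / h) ^+ j] for all [j <= m]. *)
pose q := 1 + 2 / h; have q1 : 1 <= q by rewrite lerDl divr_ge0// ltW.
pose C0 := q ^+ m * B; have C00 : 0 <= C0 by rewrite mulr_ge0// exprn_ge0// (le_trans _ q1).
have hj j : (j <= m)%N -> j%:R * h <= l.
  move=> jm; rewrite /h mulrCA ger_pMr// ler_pdivrMr// mul1r ler_nat; exact: leqW.
suff main k : exists2 C : R, 0 <= C & forall (g : nat -> R -> R) (N : R), 0 <= N ->
    (forall i, (i < m)%N -> seg_derives l (g i) (g i.+1)) ->
    (forall i, (i <= m)%N -> `|g 0%N (i%:R * h)| <= B * N) ->
    (forall s t, 0 <= s -> s <= t -> t <= l -> `|g m t - g m s| <= Num.sqrt (t - s) * N) ->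
    forall j, (m - k <= j)%N -> (j <= m)%N -> forall t, 0 <= t <= l -> `|g j t| <= C * N.
  have [C C1 H] := main m; exists C => // g N N0 dg gB gm j jm.
  by apply: H => //; rewrite subnn.
have somewhere (g : nat -> R -> R) N j : 0 <= N -> (j <= m)%N ->
    (forall i, (i < m)%N -> seg_derives l (g i) (g i.+1)) ->
    (forall i, (i <= m)%N -> `|g 0%N (i%:R * h)| <= B * N) ->
    exists2 xi, 0 <= xi <= l & `|g j xi| <= C0 * N.
  move=> N0 jm dg gB.
  have [||xi xil Hxi] := @derivative_bound_somewhere j l h g (B * N) _ h0 (hj j jm) _.
  - by move=> i ij; apply: dg; exact: leq_trans jm.
  - by move=> i ij; apply: gB; exact: leq_trans jm.
  - exists xi => //; rewrite (le_trans Hxi)// /C0 -mulrA ler_wpM2r ?mulr_ge0//.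
    rewrite (@le_trans _ _ (q ^+ j))//; last exact: ler_weXn2l.
    have h2 : 0 <= 2 / h by rewrite divr_ge0// ltW.
    by apply: lerXn2r; rewrite ?nnegrE// /q ?lerDr// addr_ge0.
elim: k => [|k [C C1 IH]].
  exists (C0 + Num.sqrt l); first by rewrite addr_ge0// sqrtr_ge0.
  move=> g N N0 dg gB gm j; rewrite subn0 => mj jm t tl.
  have -> : j = m by apply/eqP; rewrite eqn_leq jm.
  have [xi xil Hxi] := somewhere g N m N0 (leqnn m) dg gB.
  rewrite -[g m t](subrK (g m xi)) (le_trans (ler_normD _ _))// addrC mulrDl lerD//.
  move: tl xil => /andP[t0 tl] /andP[xi0 xil].
  have [tx|xt] := leP xi t.
    by rewrite (le_trans (gm _ _ xi0 tx tl))// ler_wpM2r// ler_sqrt ?(ltW l0)//; lra.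
  by rewrite distrC (le_trans (gm _ _ t0 (ltW xt) xil))// ler_wpM2r// ler_sqrt ?(ltW l0)//; lra.
exists (C + (C0 + C * l)) => [|g N N0 dg gB gm j mj jm t tl].
  by rewrite !addr_ge0// mulr_ge0// ltW.
have H := IH g N N0 dg gB gm.
have CN : 0 <= C * N by rewrite mulr_ge0.
have C0N : 0 <= C0 * N by rewrite mulr_ge0.
have ClN : 0 <= C * l * N by rewrite !mulr_ge0// ltW.
have [j'|jj] := leqP (m - k) j.
  by rewrite (le_trans (H j j' jm t tl))// !mulrDl lerDl addr_ge0.
have jm' : (j < m)%N := leq_trans jj (leq_subr _ _).
have jk : (m - k <= j.+1)%N by rewrite (leq_trans (leqSpred _))// -subnS ltnS.
have [xi xil Hxi] := somewhere g N j N0 jm dg gB.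
rewrite -[g j t](subrK (g j xi)) (le_trans (ler_normD _ _))// !mulrDl.
suff : `|g j t - g j xi| <= C * l * N by lra.
move: tl xil => /andP[t0 tl] /andP[xi0 xil].
have step a b : 0 <= a -> a < b -> b <= l -> `|g j b - g j a| <= C * l * N.
  move=> a0 ab bl; have [c [ac cb ->]] := seg_MVT (dg j jm') a0 ab bl.
  rewrite normrM mulrAC; apply: ler_pM => //; first by apply: H => //; apply/andP; split; lra.
  by rewrite ger0_norm; lra.
have [tx|tx|->] := ltgtP t xi.
- by rewrite distrC; exact: step.
- exact: step.
- by rewrite subrr normr0.
Qed.

End SegmentCalculus.

(** * Duality with the linear combinations of a family *)

Section Duality.
Context {R : realType} {V : semiInner R} {T : Type}.
Variable z : T -> V.
Implicit Types (L : seq (R * T)) (U : V).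

Definition comb L : V := \sum_(q <- L) q.1 *: z q.2.

Definition span_closure U := forall e : R, 0 < e -> exists L, sinorm (U - comb L) <= e.

Lemma ip_comb U L : ip U (comb L) = \sum_(q <- L) q.1 * ip U (z q.2).
Proof. by rewrite ip_sumr; apply: eq_bigr => q _; rewrite ipZr. Qed.

Lemma span_closure_point x : span_closure (z x).
Proof.
move=> e e0; exists [:: (1, x)].
by rewrite /comb big_seq1 scale1r subrr sinorm0 ltW.
Qed.

Lemma comb_cat L1 L2 : comb (L1 ++ L2) = comb L1 + comb L2.
Proof. by rewrite /comb big_cat. Qed.

Lemma comb_scale a L : comb [seq (a * q.1, q.2) | q <- L] = a *: comb L.
Proof.
rewrite /comb big_map scaler_sumr; apply: eq_bigr => q _.
by rewrite /= scalerA.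
Qed.

Lemma span_closureD U1 U2 : span_closure U1 -> span_closure U2 -> span_closure (U1 + U2).
Proof.
move=> H1 H2 e e0; have e2 : 0 < e / 2 by rewrite divr_gt0.
have [L1 h1] := H1 _ e2; have [L2 h2] := H2 _ e2; exists (L1 ++ L2).
rewrite comb_cat opprD addrACA (le_trans (sinormD _ _))//.
by rewrite (le_trans (lerD h1 h2))// -splitr.
Qed.

Lemma span_closureZ a U : span_closure U -> span_closure (a *: U).
Proof.
move=> H e e0; have a0 : 0 < `|a| + 1 by rewrite ltr_wpDl.
have [L h] := H (e / (`|a| + 1)) (divr_gt0 e0 a0).
exists [seq (a * q.1, q.2) | q <- L].
rewrite comb_scale -scalerBr sinormZ.
rewrite (le_trans (ler_wpM2l (normr_ge0 _) h))// mulrCA ger_pMr//.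
by rewrite ler_pdivrMr// mul1r lerDl.
Qed.

Lemma span_closureB U1 U2 : span_closure U1 -> span_closure U2 -> span_closure (U1 - U2).
Proof. by move=> H1 H2; rewrite -scaleN1r; apply: span_closureD => //; exact: span_closureZ. Qed.

Lemma span_closure_sum (I : Type) (r : seq I) (P : pred I) (F : I -> V) :
  (forall i, P i -> span_closure (F i)) -> span_closure (\sum_(i <- r | P i) F i).
Proof.
move=> H; apply: (big_ind span_closure) => //; last exact: span_closureD.
by move=> e e0; exists [::]; rewrite /comb big_nil subrr sinorm0 ltW.
Qed.

Lemma span_closure_lim U : (forall e : R, 0 < e -> exists2 U', span_closure U' & sinorm (U' - U) <= e) ->
  span_closure U.
Proof.
move=> H e e0; have e2 : 0 < e / 2 by rewrite divr_gt0.
have [U' H' h1] := H _ e2; have [L h2] := H' _ e2; exists L.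
rewrite (le_trans (sinormB_le _ U' _))// (sinormBC U).
by rewrite (le_trans (lerD h1 h2))// -splitr.
Qed.

(** A vector of the closed span is tested on its own approximations, whose norms are close to its
    norm: this gives |U|^2 <= B |U|. *)
Lemma span_duality U B : span_closure U -> 0 <= B ->
  (forall L, `|ip U (comb L)| <= B * sinorm (comb L)) -> sinorm U <= B.
Proof.
move=> HU B0 HB; have N0 : 0 <= sinorm U by exact: sinorm_ge0.
have key : sinorm U ^+ 2 <= B * sinorm U.
  apply/ler_addgt0Pl => e e0; pose M := sinorm U + B + 1.
  have M0 : 0 < M by rewrite ltr_wpDl// addr_ge0.
  have [L h] := HU (e / M) (divr_gt0 e0 M0).
  have n1 : sinorm (comb L) <= sinorm U + e / M.
    have -> : comb L = U - (U - comb L) by rewrite opprB addrC subrK.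
    by rewrite (le_trans (sinormD _ _))// sinormN lerD2l.
  rewrite sqr_sinorm -{2}[U](subrK (comb L)) ipDr.
  have h1 : ip U (U - comb L) <= sinorm U * (e / M).
    rewrite (le_trans (ler_norm _))// (le_trans (ip_le _ _))//.
    by rewrite ler_wpM2l.
  have h2 : ip U (comb L) <= B * (sinorm U + e / M).
    by rewrite (le_trans (ler_norm _))// (le_trans (HB L))// ler_wpM2l.
  have h3 : (sinorm U + B) * (e / M) <= e.
    by rewrite mulrCA ger_pMr// ler_pdivrMr// mul1r lerDl.
  by move: h1 h2 h3; rewrite mulrDr mulrDl; lra.
have [->//|n0] := eqVneq (sinorm U) 0.
have np : 0 < sinorm U by rewrite lt_def n0.
by rewrite -(ler_pM2r np) -expr2.
Qed.

End Duality.

(* The norms of difference quotients of the path are estimated by duality against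
   the linear combinations of the family [z]. *)
Lemma weakly_Cm_path (R : realType) (V : semiInner R) (T : Type) (z : T -> V)
    (l : R) (m : nat) (c : R -> T) (u : T -> nat -> R -> R) :
  0 < l -> si_complete V ->
  (forall x t, 0 <= t <= l -> u x 0%N t = ip (z x) (z (c t))) ->
  (forall x j, (j < m)%N -> seg_derives l (u x j) (u x j.+1)) ->
  (forall L s t, 0 <= s -> s <= t -> t <= l ->
     `|\sum_(q <- L) q.1 * u q.2 m t - \sum_(q <- L) q.1 * u q.2 m s| <=
       Num.sqrt (t - s) * sinorm (comb z L)) ->
  exists (D : nat -> R -> V) (C : R), 0 <= C /\ [/\ forall t, D 0%N t = z (c t),
    forall k, (k < m)%N -> forall t, 0 <= t <= l -> vderiv l (D k) t (D k.+1 t),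
    forall k t x, (k <= m)%N -> 0 <= t <= l -> ip (D k t) (z x) = u x k t,
    forall k t, (k <= m)%N -> 0 <= t <= l -> span_closure z (D k t) /\ sinorm (D k t) <= C &
    forall k s t, (k <= m)%N -> 0 <= s -> s <= t -> t <= l ->
      sinorm (D k t - D k s) <= C * Num.sqrt (t - s)].
Proof.
move=> l0 Vc u0 du uH.
pose g (L : seq (R * T)) k t := \sum_(q <- L) q.1 * u q.2 k t.
have dg L k : (k < m)%N -> seg_derives l (g L k) (g L k.+1).
  move=> km; elim: L => [|q L IH] t tl e e0.
    exists 1 => // s sl st _; rewrite /g !big_nil !subrr mul0r subr0 normr0; exact: ltW.
  pose M := `|q.1| + 1; have M0 : 0 < M by rewrite ltr_wpDl.
  have e2 : 0 < e / 2 by rewrite divr_gt0.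
  have [d1 d10 H1] := IH t tl _ e2.
  have [d2 d20 H2] := du q.2 k km t tl (e / 2 / M) (divr_gt0 e2 M0).
  exists (Num.min d1 d2); first by rewrite lt_min d10.
  move=> s sl st; rewrite lt_min => /andP[sd1 sd2].
  rewrite /g !big_cons.
  set A := \sum_(_ <- _) _; set B := \sum_(_ <- _) _; set A' := \sum_(_ <- _) _.
  have st0 : s - t != 0 by rewrite subr_eq0.
  have -> : (q.1 * u q.2 k s + A - (q.1 * u q.2 k t + B)) / (s - t) - (q.1 * u q.2 k.+1 t + A') =
     ((A - B) / (s - t) - A') + q.1 * ((u q.2 k s - u q.2 k t) / (s - t) - u q.2 k.+1 t) by field.
  rewrite (le_trans (ler_normD _ _))// [leRHS]splitr lerD//; first exact: H1.
  rewrite normrM (le_trans (ler_wpM2l (normr_ge0 _) (H2 s sl st sd2)))//.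
  by rewrite mulrCA ger_pMr// ler_pdivrMr// mul1r lerDl.
have g0 L t : 0 <= t <= l -> g L 0%N t = ip (z (c t)) (comb z L).
  move=> tl; rewrite ip_comb; apply: eq_bigr => q _.
  by rewrite u0// ipC.
(* The grid values of [g L 0] are inner products with [comb z L], at most [B * sinorm (comb z L)] by
   Cauchy-Schwarz. *)
pose B := \sum_(i < m.+1) sinorm (z (c (i%:R * (l / m.+1%:R)))).
have B0 : 0 <= B by apply: sumr_ge0 => i _; exact: sinorm_ge0.
have [C0 C00 HC] := chain_bound m l0 B0.
have gC L k t : (k <= m)%N -> 0 <= t <= l -> `|g L k t| <= C0 * sinorm (comb z L).
  move=> km; apply: HC => //; first exact: sinorm_ge0; last exact: uH.
  - by move=> i im; exact: dg.
  - move=> i im; rewrite g0; last first.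
      rewrite mulr_ge0//= ?divr_ge0// ?(ltW l0)// mulrCA ger_pMr//.
      by rewrite ler_pdivrMr// mul1r ler_nat leqW.
    rewrite (le_trans (ip_le _ _))// ler_wpM2r ?sinorm_ge0//.
    rewrite /B (bigD1 (Ordinal (im : i < m.+1)%N))//= lerDl.
    by apply: sumr_ge0 => j _; exact: sinorm_ge0.
pose C := C0 + (1 + C0 * Num.sqrt l).
have C01 : C0 <= C by rewrite lerDl addr_ge0// mulr_ge0// sqrtr_ge0.
have C1 : 1 <= C by rewrite /C; have := mulr_ge0 C00 (sqrtr_ge0 l); lra.
have C2 : C0 * Num.sqrt l <= C by rewrite /C; lra.
have Cp : 0 < C by exact: lt_le_trans C1.
(* Below order [m], the Hölder bound comes from the bound on the next derivative, as
   [t - s <= Num.sqrt l * Num.sqrt (t - s)]. *)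
have gH : forall L k (s t : R), (k <= m)%N -> 0 <= s -> s <= t -> t <= l ->
    `|g L k t - g L k s| <= C * Num.sqrt (t - s) * sinorm (comb z L).
  move=> L k s t; rewrite leq_eqVlt => /predU1P[->|km] s0 st tl.
    rewrite (le_trans (uH L s t s0 st tl))// ler_wpM2r ?sinorm_ge0//.
    by rewrite ler_peMl// sqrtr_ge0.
  have [<-|st'] := eqVneq s t.
    by rewrite !subrr normr0 sqrtr0 mulr0 mul0r.
  have lts : s < t by rewrite lt_def eq_sym st'.
  have [x [sx xt ->]] := seg_MVT (dg L k km) s0 lts tl.
  have ts : 0 <= t - s by lra.
  rewrite normrM (ger0_norm ts).
  have h1 : `|g L k.+1 x| <= C0 * sinorm (comb z L).
    by apply: gC => //; apply/andP; split; lra.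
  have h2 : t - s <= Num.sqrt l * Num.sqrt (t - s).
    rewrite -{1}[t - s]sqr_sqrtr// expr2 ler_wpM2r ?sqrtr_ge0// ler_sqrt ?(ltW l0)//.
    by lra.
  rewrite (le_trans (ler_pM (normr_ge0 _) ts h1 h2))//.
  have -> : C0 * sinorm (comb z L) * (Num.sqrt l * Num.sqrt (t - s)) =
    C0 * Num.sqrt l * (Num.sqrt (t - s) * sinorm (comb z L)) by ring.
  by rewrite -[leRHS]mulrA ler_wpM2r// mulr_ge0 ?sinorm_ge0// sqrtr_ge0.
have gH' : forall L k (s t : R), (k <= m)%N -> 0 <= s <= l -> 0 <= t <= l ->
    `|g L k s - g L k t| <= C * Num.sqrt `|s - t| * sinorm (comb z L).
  move=> L k s t km /andP[s0 sl] /andP[t0 tl]; have [st|/ltW st] := leP s t.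
    by rewrite distrC (distrC s) (@ger0_norm _ (t - s)) ?subr_ge0//; exact: gH.
  by rewrite (@ger0_norm _ (s - t)) ?subr_ge0//; exact: gH.
(* The invariant of the construction: staying in the closed span allows duality at the next
   order. *)
pose good k (y : R -> V) := forall t, 0 <= t <= l -> span_closure z (y t) /\
  forall x, ip (y t) (z x) = u x k t.
have good_comb k y L t : good k y -> 0 <= t <= l -> ip (y t) (comb z L) = g L k t.
  by move=> Hy tl; rewrite ip_comb; apply: eq_bigr => q _; rewrite (Hy t tl).2.
have step k y : (k < m)%N -> good k y -> exists y' : R -> V, good k.+1 y' /\
    forall t, 0 <= t <= l -> vderiv l y t (y' t).
  move=> km Hy; suff H t : 0 <= t <= l -> exists U, vderiv l y t U.
    have /choice[y' Hy'] : forall t, exists U, 0 <= t <= l -> vderiv l y t U.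
      move=> t; case tl : (0 <= t <= l); last by exists 0.
      by have [U HU] := H t tl; exists U.
    exists y'; split=> // t tl; split.
      apply: span_closure_lim => e e0; have [d d0 Hd] := Hy' t tl e e0.
      have [s [sl st sd]] := seg_near_point l0 tl d0.
      exists (vquot y t s); last exact: Hd.
      apply: span_closureZ; apply: span_closureB; [exact: (Hy s sl).1|exact: (Hy t tl).1].
    move=> x; apply/eqP; rewrite -subr_eq0 -normr_le0; apply/ler_addgt0Pl => e e0.
    rewrite addr0; have M0 : 0 < 2 * (sinorm (z x) + 1).
      by rewrite mulr_gt0// ltr_wpDl// sinorm_ge0.
    have e2 : 0 < e / 2 by rewrite divr_gt0.
    have [d1 d10 H1] := Hy' t tl (e / (2 * (sinorm (z x) + 1))) (divr_gt0 e0 M0).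
    have [d2 d20 H2] := du x k km t tl _ e2.
    have d0 : 0 < Num.min d1 d2 by rewrite lt_min d10.
    have [s [sl st]] := seg_near_point l0 tl d0; rewrite lt_min => /andP[sd1 sd2].
    have := H2 s sl st sd2; have := H1 s sl st sd1.
    have E : ip (vquot y t s) (z x) = (u x k s - u x k t) / (s - t).
      by rewrite ipZl ipBl (Hy s sl).2 (Hy t tl).2 mulrC.
    rewrite -E => h1 h2; rewrite -[ip (y' t) _](subrK (ip (vquot y t s) (z x))) -addrA.
    rewrite (le_trans (ler_normD _ _))// [leRHS]splitr lerD//.
    rewrite -ipBl (le_trans (ip_le _ _))// sinormBC.
    rewrite (le_trans (ler_wpM2r (sinorm_ge0 _) h1))//.
    have zx0 := sinorm_ge0 (z x).
    rewrite mulrAC ler_pdivrMr//.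
    have -> : e / 2 * (2 * (sinorm (z x) + 1)) = e * (sinorm (z x) + 1) by field.
    by rewrite ler_wpM2l ?(ltW e0)// lerDl.
  move=> tl; apply: (vderiv_cauchy l0 Vc tl) => e e0.
  (* Tested on a combination, the two quotients are values of [g L k.+1] at points within this
     radius of [t], hence at most [(e / C) ^+ 2] apart; the Hölder bound then gives [e]. *)
  exists ((e / C) ^+ 2 / 2); first by rewrite divr_gt0// exprn_gt0// divr_gt0.
  move=> s s' sl sl' st st' sd sd'.
  apply: (span_duality (z := z)); last 1 first.
  - move=> L; rewrite ipBl !ipZl !ipBl.
    rewrite (good_comb k y L s Hy sl) (good_comb k y L s' Hy sl') (good_comb k y L t Hy tl).
    have Q r : 0 <= r <= l -> r != t -> exists x, [/\ 0 <= x <= l,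
        `|x - t| <= `|r - t| & (r - t)^-1 * (g L k r - g L k t) = g L k.+1 x].
      move=> /andP[r0 rl] rt; move: (tl) => /andP[t0 tl'].
      have rt0 : r - t != 0 by rewrite subr_eq0.
      have [ltr|gtr|] := ltgtP r t; last by move/eqP; rewrite (negbTE rt).
        have [x [rx xt E]] := seg_MVT (dg L k km) r0 ltr tl'; exists x; split.
        - by apply/andP; split; lra.
        - by rewrite !ltr0_norm ?subr_lt0//; lra.
        - by rewrite -[g L k r - _]opprB E; field.
      have [x [rx xt E]] := seg_MVT (dg L k km) t0 gtr rl; exists x; split.
      - by apply/andP; split; lra.
      - by rewrite !gtr0_norm ?subr_gt0//; lra.
      - by rewrite E; field.
    have [x [xl xt ->]] := Q s sl st; have [x' [xl' xt' ->]] := Q s' sl' st'.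
    rewrite (le_trans (gH' L k.+1 x x' km xl xl'))// ler_wpM2r ?sinorm_ge0//.
    rewrite mulrC -ler_pdivlMr//.
    have eC : 0 <= e / C by rewrite divr_ge0// ltW.
    have -> : e / C = Num.sqrt ((e / C) ^+ 2) by rewrite sqrtr_sqr ger0_norm.
    rewrite ler_sqrt ?sqr_ge0//.
    have -> : x - x' = (x - t) - (x' - t) by ring.
    rewrite (le_trans (ler_normB _ _))// [leRHS]splitr lerD//.
      by rewrite (le_trans xt)// ltW.
    by rewrite (le_trans xt')// ltW.
  - apply: span_closureB; apply: span_closureZ; apply: span_closureB.
    + exact: (Hy s sl).1.
    + exact: (Hy t tl).1.
    + exact: (Hy s' sl').1.
    + exact: (Hy t tl).1.
  - exact: ltW.
have good0 : good 0%N (fun t => z (c t)).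
  by move=> t tl; split; [exact: span_closure_point|move=> x; rewrite u0// ipC].
(* The next derivative is chosen as a function of the current path, so that the sequence can be
   defined by recursion. *)
have /choice[F HF] : forall k, exists F : (R -> V) -> R -> V, forall y,
    (k < m)%N -> good k y ->
    good k.+1 (F y) /\ forall t, 0 <= t <= l -> vderiv l y t (F y t).
  move=> k; suff /choice[F HF] : forall y, exists y', (k < m)%N -> good k y ->
      good k.+1 y' /\ forall t, 0 <= t <= l -> vderiv l y t (y' t) by exists F.
  move=> y; have [[km gk]|nk] := pselect ((k < m)%N /\ good k y).
    by have [y' Hy'] := step k y km gk; exists y'.
  by exists y => km gk; case: nk.
pose D := fix D k := if k is k'.+1 then F k' (D k') else fun t => z (c t).
have gD k : (k <= m)%N -> good k (D k).
  elim: k => [//|k IH km]; exact: (HF k (D k) km (IH (ltnW km))).1.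
exists D, C; split; first exact: ltW.
split=> //.
- move=> k km t tl; exact: (HF k (D k) km (gD k (ltnW km))).2.
- by move=> k t x km tl; exact: (gD k km t tl).2.
- move=> k t km tl; split; first exact: (gD k km t tl).1.
  apply: (le_trans _ C01); apply: (span_duality (gD k km t tl).1 C00) => L.
  by rewrite (good_comb k _ L t (gD k km))//; exact: gC.
- move=> k s t km s0 st tl.
  have sl : 0 <= s <= l by apply/andP; split; lra.
  have tl' : 0 <= t <= l by apply/andP; split; lra.
  apply: (span_duality (z := z)).
  + by apply: span_closureB; [exact: (gD k km t tl').1|exact: (gD k km s sl).1].
  + by rewrite mulr_ge0 ?sqrtr_ge0// ltW.
  + move=> L; rewrite ipBl (good_comb k _ L t (gD k km))// (good_comb k _ L s (gD k km))//.
    exact: gH.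
Qed.

(** * Quadratic forms in square-integrable functions *)

Section L2Sums.
Context {R : realType} {d : measure_display} {T : measurableType d}.
Variable mu : {measure set T -> \bar R}.

Lemma L2_restrict_integrableM (D : set T) (f g : T -> R) : measurable D ->
  (f \_ D) \in Lfun mu 2%:E -> (g \_ D) \in Lfun mu 2%:E ->
  mu.-integrable D (EFin \o (fun x => f x * g x)).
Proof.
move=> mD fL gL; have := Lfun2_mul_Lfun1 fL gL => /Lfun1_integrable h.
have : mu.-integrable D (EFin \o (fun x => (f \_ D) x * (g \_ D) x)).
  exact: (integrableS _ _ (@subsetT _ D) h).
by apply: eq_integrable => // x xD; rewrite /= /patch xD.
Qed.

Lemma L2_restrict_measurable (D : set T) (f : T -> R) : measurable D ->
  (f \_ D) \in Lfun mu 2%:E -> measurable_fun D f.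
Proof.
move=> mD /andP[]; rewrite inE/= => mf _; apply/(measurable_restrictT _ mD).
exact: mf.
Qed.

Lemma Rintegral_sqr_sum (D : set T) (I : Type) (L : seq (R * I)) (k : I -> T -> R) :
  measurable D -> (forall i, (k i \_ D) \in Lfun mu 2%:E) ->
  mu.-integrable D (EFin \o (fun x => (\sum_(q <- L) q.1 * k q.2 x) ^+ 2)) /\
  \int[mu]_(x in D) ((\sum_(q <- L) q.1 * k q.2 x) ^+ 2) =
    \sum_(q <- L) \sum_(r <- L) q.1 * r.1 * \int[mu]_(x in D) (k q.2 x * k r.2 x).
Proof.
move=> mD kL; have ik2 i j : mu.-integrable D (EFin \o (fun x => k i x * k j x)).
  exact: L2_restrict_integrableM.
have L1 i := @Rintegral_lin _ _ _ mu D _ L fst (fun q x => k i x * k q.2 x) mD (fun q => ik2 i q.2).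
have [ih2 Eh2] := @Rintegral_lin _ _ _ mu D _ L fst
  (fun q x => \sum_(r <- L) r.1 * (k q.2 x * k r.2 x)) mD (fun q => (L1 q.2).1).
have -> : (fun x => (\sum_(q <- L) q.1 * k q.2 x) ^+ 2) =
    (fun x => \sum_(q <- L) q.1 * (\sum_(r <- L) r.1 * (k q.2 x * k r.2 x))).
  apply/funext => x; rewrite expr2 mulr_suml; apply: eq_bigr => q _.
  rewrite -mulrA; congr (_ * _); rewrite mulr_sumr; apply: eq_bigr => r _; ring.
split=> //; rewrite Eh2; apply: eq_bigr => q _; rewrite (L1 q.2).2 mulr_sumr.
by apply: eq_bigr => r _; rewrite mulrA.
Qed.

Lemma L2_sum_sqr_le (D D' : set T) (I : Type) (L : seq (R * I)) (k : I -> T -> R) :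
  measurable D -> measurable D' -> D' `<=` D -> (mu D' < +oo)%E ->
  (forall i, (k i \_ D) \in Lfun mu 2%:E) ->
  (\sum_(q <- L) q.1 * \int[mu]_(x in D') k q.2 x) ^+ 2 <=
    fine (mu D') *
    \sum_(q <- L) \sum_(r <- L) q.1 * r.1 * \int[mu]_(x in D) (k q.2 x * k r.2 x).
Proof.
move=> mD mD' DD' fD' kL.
(* On a set of finite measure, [|k| <= 1 + k ^+ 2] gives the integrability. *)
have ik i : mu.-integrable D' (EFin \o k i).
  have i1 : mu.-integrable D' (EFin \o (fun x => 1 + k i x ^+ 2)).
    have h1 : mu.-integrable D' (EFin \o cst 1).
      by apply: measurable_bounded_integrable => //; exact/bounded_cst.
    have h2 := integrableS mD mD' DD' (L2_restrict_integrableM mD (kL i) (kL i)).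
    have := integrableD mD' h1 h2.
    by apply: eq_integrable => // x _; rewrite /= EFinD.
  apply: (le_integrable mD' _ _ i1).
    apply/measurable_EFinP; apply: (measurable_funS mD DD').
    exact: L2_restrict_measurable.
  move=> x _; rewrite /= lee_fin [leRHS]ger0_norm ?addr_ge0 ?sqr_ge0//.
  have := sqr_ge0 (`|k i x| - 1); rewrite sqrrB real_normK ?num_real// expr1n mulr1 mulr2n.
  by have := normr_ge0 (k i x); have := sqr_ge0 (k i x); lra.
have [ih Eh] := @Rintegral_lin _ _ _ mu D' _ L fst (fun q => k q.2) mD' (fun q => ik q.2).
have [ih2 Eh2] := Rintegral_sqr_sum L mD kL.
rewrite -Eh -Eh2; have ih2' := integrableS mD mD' DD' ih2.
rewrite (le_trans (Rintegral_sqr_le mD' fD' ih ih2'))//.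
apply: ler_wpM2l; first exact: fine_ge0.
apply: fine_le; try exact: integrable_fin_num.
apply: ge0_subset_integral => //; first by case/integrableP: ih2.
by move=> x _; rewrite lee_fin sqr_ge0.
Qed.

Lemma Rintegral_sqr_sum_ge0 (D : set T) (I : Type) (L : seq (R * I)) (k : I -> T -> R) :
  measurable D -> (forall i, (k i \_ D) \in Lfun mu 2%:E) ->
  0 <= \sum_(q <- L) \sum_(r <- L) q.1 * r.1 * \int[mu]_(x in D) (k q.2 x * k r.2 x).
Proof.
move=> mD kL; have [_ <-] := Rintegral_sqr_sum L mD kL.
by apply: Rintegral_ge0 => x _; exact: sqr_ge0.
Qed.

End L2Sums.

(** * Hölder bounds along an edge for combinations of the kernel *)

Section EdgeEstimates.
Context {R : realType}.
Notation mu := (@lebesgue_measure R).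

(** The density is replaced by [seg_deriv] itself, equal to it on the segment outside of a null set
    to which the two endpoints are added. *)
Lemma seg_FTC l f s t : 0 < l -> seg_abs_continuous l f -> seg_L2 l (seg_deriv l f) ->
  0 <= s -> s <= t -> t <= l ->
  f t - f s = \int[mu]_(x in `[s, t]) seg_deriv l f x.
Proof.
move=> l0 fac fL s0 st tl; have [phi [iphi phiE phiae]] := FTC_abs_continuous l0 fac.
rewrite phiE// /Rintegral; congr fine.
have sub : [set` `[s, t]] `<=` [set` `[0, l]].
  by apply: subset_itv; rewrite bnd_simp.
have ne (c : R) : {ae mu, forall x, x != c}.
  exists [set c]; split; [exact: measurable_set1|exact: lebesgue_measure_set1|].
  by move=> x /= /negP; rewrite negbK => /eqP.
apply: ae_eq_integral => //.
- apply: (measurable_funS measurableT) => //; exact: (measurable_int _ iphi).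
- apply/measurable_EFinP; apply: (measurable_funS _ sub) => //.
  exact: (L2_restrict_measurable _ fL).
- have := ne 0; have := ne l; apply: (@filterS3 _ _ (ae_filter_ringOfSetsType mu)) phiae => x h xl x0 /=.
  rewrite in_itv/= => /andP[sx xt]; rewrite h// lt_def x0/= (le_trans s0)//=.
  by rewrite lt_def eq_sym xl (le_trans xt).
Qed.

Context (G : metricGraph R) (p : nat) (K : gpoint G -> gpoint G -> R).
Hypothesis p0 : (0 < p)%N.
Hypothesis rK : reproducing_kernel (spaceF (G := G) p) (innerF (G := G) p) K.

(** Cauchy-Schwarz for the integral of the p-th derivatives over [[s, t]]; by the reproducing
    property, the double sum is the squared norm of the combination. Derivatives are taken before
    the combination because an iterated [lim] is linear only where the limits exist. *)
Lemma edge_derivn_holder (e : edge G) (L : seq (R * gpoint G)) (s t : R) :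
  0 <= s -> s <= t -> t <= len e ->
  `|\sum_(q <- L) q.1 * edge_derivn e p.-1 (K q.2) t -
    \sum_(q <- L) q.1 * edge_derivn e p.-1 (K q.2) s| <=
  Num.sqrt (t - s) * Num.sqrt (\sum_(q <- L) \sum_(r <- L) q.1 * r.1 * K q.2 r.2).
Proof.
move=> s0 st tl; have l0 := len_gt0 e; have [KF Krep] := rK.
pose k x e' := edge_derivn e' p (K x).
have kL x e' : seg_L2 (len e') (k x e') by have [_ _ + _] := KF x; exact.
have kE x e' : k x e' = seg_deriv (len e') (edge_derivn e' p.-1 (K x)).
  by rewrite /k /edge_derivn -[in LHS](prednK p0).
have KE x y : K x y = \sum_e' \int[mu]_(u in `[0, len e']) (k x e' u * k y e' u).
  by rewrite -(Krep (K x) y (KF x)).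
have -> : \sum_(q <- L) \sum_(r <- L) q.1 * r.1 * K q.2 r.2 =
   \sum_e' \sum_(q <- L) \sum_(r <- L) q.1 * r.1 *
     \int[mu]_(u in `[0, len e']) (k q.2 e' u * k r.2 e' u).
  rewrite [RHS]exchange_big/=; apply: eq_bigr => q _.
  rewrite [RHS]exchange_big/=; apply: eq_bigr => r _.
  by rewrite KE mulr_sumr.
rewrite -sumrB -sqrtrM ?subr_ge0// -sqrtr_sqr ler_wsqrtr//.
have -> : \sum_(q <- L) (q.1 * edge_derivn e p.-1 (K q.2) t - q.1 * edge_derivn e p.-1 (K q.2) s) =
    \sum_(q <- L) q.1 * \int[mu]_(u in `[s, t]) k q.2 e u.
  apply: eq_bigr => q _; rewrite -mulrBr kE -seg_FTC// -?kE//.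
  by have [_ + _ _] := KF q.2; exact.
have sub : [set` `[s, t]] `<=` [set` `[0, len e]].
  by apply: subset_itv; rewrite bnd_simp.
have fst' : (mu `[s, t]%classic < +oo)%E.
  by rewrite lebesgue_measure_itv/=; case: ifP; rewrite ?ltry.
have := @L2_sum_sqr_le _ _ _ mu _ _ _ L (fun x => k x e) (measurable_itv `[0, len e])
  (measurable_itv `[s, t]) sub fst' (fun x => kL x e).
move=> h; apply: (le_trans h).
have -> : fine (mu `[s, t]%classic) = t - s.
  rewrite lebesgue_measure_itv/= lte_fin; case: ltP => // ts.
  by have -> : t = s; [apply/eqP; rewrite eq_le ts|rewrite subrr].
apply: ler_wpM2l; first by rewrite subr_ge0.
rewrite (bigD1 e)//= lerDl; apply: sumr_ge0 => e' _.
by apply: (@Rintegral_sqr_sum_ge0 _ _ _ mu _ _ L (fun x => k x e')) => // x; exact: kL.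
Qed.

Lemma edge_derivn_derives (f : gpoint G -> R) (e : edge G) j : spaceF p f ->
  (j < p.-1)%N -> seg_derives (len e) (edge_derivn e j f) (edge_derivn e j.+1 f).
Proof.
move=> [[fC _] _ _ _] jm; apply/seg_derivesP => t tl.
by have [/(_ j jm t) + _] := fC e; rewrite in_itv/=; exact.
Qed.

End EdgeEstimates.

(** * From random variables to vectors of L^2 *)

Section MeanSquare.
Context {R : realType} {d : measure_display} {Omega : measurableType d}.
Variable P : probability Omega R.

Definition L2rv (U : L2 P) : {RV P >-> R} := (U : L2type P).

Lemma centred_covariance_L2 (T : Type) (X : T -> {RV P >-> R}) (C : T -> T -> R) :
  (forall x, 'E_P[X x] = 0)%E -> (forall x y, covariance P (X x) (X y) = (C x y)%:E) ->
  exists x : T -> L2 P,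
    (forall t, L2rv (x t) = X t :> (Omega -> R)) /\ forall s t, ip (x s) (x t) = C s t.
Proof.
move=> EX CX.
have intE s t : (\int[P]_w (X s w * X t w)%:E = (C s t)%:E)%E.
  rewrite -CX unlock/= !EX/= unlock; apply: eq_integral => w _.
  by rewrite -[RHS]/((X s w - 0) * (X t w - 0))%:E !subr0.
have /choice[x Hx] : forall t, exists U : L2 P, L2rv U = X t :> (Omega -> R).
  move=> t; have [] := @L2_mem _ _ _ P (X t); first exact: measurable_funPT.
    by under eq_integral do rewrite expr2; rewrite intE ltry.
  by move=> U HU; exists U.
exists x; split => // s t; apply: EFin_inj; rewrite -intE [LHS]L2ipE.
have h u w : (x u : L2type P) w = X u w by rewrite -Hx.
by apply: eq_integral => w _; rewrite !h.
Qed.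

Lemma variogramE (T : Type) (X : T -> {RV P >-> R}) (x : T -> L2 P) s t :
  (forall t, 'E_P[X t] = 0)%E -> (forall t, L2rv (x t) = X t :> (Omega -> R)) ->
  variogram X s t = sinorm (x s - x t) ^+ 2.
Proof.
move=> EX xX; have xw u w : X u w = (x u : L2type P) w by rewrite -xX.
have L1 u : (X u : Omega -> R) \in Lfun P 1.
  rewrite -xX; apply: Lfun_subset12; first by rewrite fin_num_measure.
  exact: LfunP.
have E0 : ('E_P[(X s \- X t)%R] = 0)%E by rewrite expectationB// !EX sube0.
apply: EFin_inj; rewrite L2_normE /variogram /variance unlock E0 /= unlock.
have -> : (\int[P]_w ((((X s \- X t) \- cst 0) * ((X s \- X t) \- cst 0))%R w)%:E =
   (sinorm (x s - x t) ^+ 2)%:E)%E; last by rewrite /= L2_normE.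
rewrite L2_normE; apply: eq_integral => w _; congr (_%:E).
rewrite -[LHS]/((X s w - X t w - 0) * (X s w - X t w - 0)) subr0 -expr2.
by rewrite !xw.
Qed.

Lemma ms_cvg_L2 (X : R -> Omega -> R) (F : set_system R) (x : R -> L2 P) (U : L2 P) :
  Filter F -> (forall s, X s = L2rv (x s) :> (Omega -> R)) ->
  (forall e : R, 0 < e -> \forall s \near F, sinorm (x s - U) <= e) ->
  ms_cvg P X F (L2rv U).
Proof.
move=> FF Xx H; rewrite /ms_cvg.
have -> : (fun s => 'E_P[fun w => ((X s w - L2rv U w) ^+ 2)%R])%E =
    (fun s => (sinorm (x s - U) ^+ 2)%:E).
  apply/funext => s; rewrite L2_normE unlock; apply: eq_integral => w _.
  by rewrite Xx.
apply: (@cvg_EFin _ _ F FF); first by apply: nearW.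
apply/cvgrPdist_le => e e0; near=> s; rewrite sub0r normrN ger0_norm ?sqr_ge0//=.
rewrite -[leRHS]sqr_sqrtr ?(ltW e0)// ler_pXn2r ?nnegrE ?sinorm_ge0 ?sqrtr_ge0//.
by near: s; apply: H; rewrite sqrtr_gt0.
Unshelve. all: by end_near. Qed.

Variables (l : R) (m : nat) (X : R -> {RV P >-> R}) (y : nat -> R -> L2 P).
Hypothesis yX : forall t, L2rv (y 0%N t) = X t :> (Omega -> R).
Hypothesis yd : forall k, (k < m)%N -> forall t, 0 <= t <= l -> vderiv l (y k) t (y k.+1 t).

(** Order 0 is [X] itself because [ms_derivs] asks for an equality of random variables, whereas
    [y 0] agrees with [X] as a function. *)
Definition ms_chain k t : {RV P >-> R} := if k is 0%N then X t else L2rv (y k t).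

Lemma ms_chainE k t : L2rv (y k t) = ms_chain k t :> (Omega -> R).
Proof. by case: k => [|k]; first exact: yX. Qed.

Lemma ms_chain_derivs : ms_derivs l m X ms_chain.
Proof.
split=> // k km t; rewrite in_itv/= => tl.
apply: (@ms_cvg_L2 _ _ (vquot (y k) t)) => [s|e e0].
  apply/funext => w; rewrite -!ms_chainE /= mulrC; congr (_ * _).
have [d' d0 H] := yd km tl e0; exists d' => //= s sd st; rewrite in_itv/= => sl.
by apply: H; rewrite // distrC.
Qed.

Lemma ms_C_chain :
  (forall e : R, 0 < e -> exists2 d : R, 0 < d & forall s t, 0 <= s <= l -> 0 <= t <= l ->
      `|s - t| < d -> sinorm (y m s - y m t) <= e) ->
  ms_C l m X.
Proof.
move=> yc; exists ms_chain; first exact: ms_chain_derivs.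
move=> t; rewrite in_itv/= => tl.
have -> : (ms_chain m t : Omega -> R) = L2rv (y m t) by rewrite ms_chainE.
apply: (@ms_cvg_L2 _ _ (y m)) => [s|e e0]; first by rewrite ms_chainE.
have [d' d0 H] := yc e e0; exists d' => //= s sd; rewrite in_itv/= => sl.
by apply: H; rewrite // distrC.
Qed.

End MeanSquare.

(* [a] plays the role of psi'(0+); allowing it to depend on [eta] spares the
   construction of that limit. *)
Lemma cm_expansion0 (R : realType) (F : nat -> R -> R) (psi0 : R) (m : nat) :
  cm_seq F -> (0 < m)%N ->
  (exists L : R, forall e : R, 0 < e -> exists2 d : R, 0 < d &
     forall t, 0 < t -> t < d -> `|F m t - L| <= e) ->
  (forall e : R, 0 < e -> exists2 d : R, 0 < d & forall t, 0 < t -> t < d ->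
     `|F 0%N t - psi0| <= e) ->
  exists2 A : R, 0 <= A & forall eta : R, 0 < eta -> exists a d : R,
    [/\ `|a| <= A, 0 < d & forall g, 0 < g -> g <= d -> `|F 0%N g - psi0 - a * g| <= eta * g].
Proof.
move=> cF m0 Flim F0.
have [e1 e10 H1] := cm_seq_cauchy0 (@ltr01 R) cF Flim m0 (@ltr01 R).
exists (`|F 1%N e1| + 1) => [|eta eta0]; first by rewrite addr_ge0.
have [e2 e20 H2] := cm_seq_cauchy0 (@ltr01 R) cF Flim m0 eta0.
pose d := Num.min e1 e2; have d0 : 0 < d by rewrite lt_min e10.
have de1 : d <= e1 by rewrite ge_min lexx.
have de2 : d <= e2 by rewrite ge_min lexx orbT.
exists (F 1%N d), d; split => //.
  rewrite -[F 1%N d](subrK (F 1%N e1)) (le_trans (ler_normD _ _))// addrC lerD2l.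
  exact: H1.
move=> g g0 gd; apply/ler_addgt0Pl => e e0; have e4 : 0 < e / 2 by rewrite divr_gt0.
have M0 : 0 < `|F 1%N d| + 1 by rewrite ltr_wpDl.
(* As [psi0] is a limit at 0, the mean value theorem is applied on [[x, g]], with [x] so small that
   its contribution is at most [e]. *)
have [c c0 Hc] := F0 _ e4; pose x := Num.min (c / 2) (Num.min (g / 2) (e / 2 / (`|F 1%N d| + 1))).
have x0 : 0 < x by rewrite !lt_min !divr_gt0.
have xc : x < c by rewrite (@le_lt_trans _ _ (c / 2)) ?ge_min ?lexx//; lra.
have xg : x < g.
  by rewrite (@le_lt_trans _ _ (g / 2)) ?ge_min ?lexx ?orbT//; lra.
have xe : `|F 1%N d| * x <= e / 2.
  have xe : x <= e / 2 / (`|F 1%N d| + 1) by rewrite !ge_min lexx !orbT.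
  rewrite (le_trans (ler_wpM2l (normr_ge0 _) xe))// mulrCA ger_pMr//.
  by rewrite ler_pdivrMr// mul1r lerDl.
have [y [xy yg E]] := cm_seq_MVT 0%N cF x0 xg.
have h1 : `|F 1%N y - F 1%N d| <= eta.
  by apply: H2 => //; [exact: lt_trans xy|rewrite (le_trans (ltW yg))].
have h2 := Hc x x0 xc.
have -> : F 0%N g - psi0 - F 1%N d * g =
    (F 0%N x - psi0) - F 1%N d * x + (F 1%N y - F 1%N d) * (g - x).
  by rewrite mulrBl -E; ring.
rewrite (le_trans (ler_normD _ _))// lerD//.
  rewrite (le_trans (ler_normB _ _))// [leRHS]splitr lerD//.
  by rewrite normrM (gtr0_norm x0).
rewrite normrM; apply: ler_pM => //.
by rewrite ger0_norm; lra.
Qed.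

Lemma common_radius (R : realType) (I : Type) (r : seq I) (Q : I -> R -> Prop) :
  (forall i, exists2 d : R, 0 < d & forall h, 0 < h -> h < d -> Q i h) ->
  exists2 d : R, 0 < d & forall h, 0 < h -> h < d -> foldr (fun i => and (Q i h)) True r.
Proof.
move=> H; elim: r => [|i r [d d0 IH]]; first by exists 1.
have [d' d'0 H'] := H i; exists (Num.min d' d); first by rewrite lt_min d'0.
by move=> h h0; rewrite lt_min => /andP[h1 h2]; split; [exact: H'|exact: IH].
Qed.

Lemma common_radius_fin (R : realType) (I : finType) (Q : I -> R -> Prop) :
  (forall i, exists2 d : R, 0 < d & forall h, 0 < h -> h < d -> Q i h) ->
  exists2 d : R, 0 < d & forall h, 0 < h -> h < d -> forall i, Q i h.
Proof.
move=> H; have [d d0 Hd] := common_radius (enum I) H; exists d => // h h0 hd i.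
have := Hd h h0 hd; have : i \in enum I by rewrite mem_enum.
elim: (enum I) => //= j r IH; rewrite inE => /predU1P[->|ir] [] //.
by move=> _; exact: IH.
Qed.

(** * The first-order Kirchhoff condition *)

Section Kirchhoff.
Context {R : realType} {V W : semiInner R} {I : finType}.
Variables (Q : pred I) (l : I -> R) (z : I -> R -> V) (y : I -> R -> W).
Variables (zv : V) (yv : W) (wz : I -> V) (wy : I -> W) (psi : R -> R).
Hypothesis l0 : forall i, 0 < l i.
Hypothesis z0 : forall i, Q i -> z i 0 = zv.
Hypothesis y0 : forall i, Q i -> y i 0 = yv.
Hypothesis zd : forall i, vderiv (l i) (z i) 0 (wz i).
Hypothesis yd : forall i, vderiv (l i) (y i) 0 (wy i).
Hypothesis yz : forall i j s t, Q i -> Q j -> 0 <= s <= l i -> 0 <= t <= l j ->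
  ip (y i s) (y j t) = psi (sinorm (z i s - z j t) ^+ 2).
Hypothesis psiE : exists2 A : R, 0 <= A & forall eta : R, 0 < eta -> exists a d : R,
  [/\ `|a| <= A, 0 < d & forall g, 0 < g -> g <= d -> `|psi g - psi 0 - a * g| <= eta * g].

(* As |z i h - zv|^2 = O(h^2), the expansion of [psi] at 0 shows that the Gram
   matrix of the increments y i h - yv is -2 a times the one of the increments
   z i h - zv, up to o(h^2). *)
Lemma kirchhoff_transfer : sinorm (\sum_(i | Q i) wz i) = 0 -> sinorm (\sum_(i | Q i) wy i) = 0.
Proof.
move=> wz0; apply/eqP; rewrite eq_le sinorm_ge0 andbT; apply/ler_addgt0Pl => eps eps0.
rewrite addr0; have [A A0 HA] := psiE; pose n : R := #|I|%:R + 1.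
have n0 : 0 < n by rewrite ltr_wpDl.
pose M := 1 + \sum_i sinorm (wz i).
have M1 : 1 <= M by rewrite lerDl sumr_ge0// => i _; exact: sinorm_ge0.
have M0 : 0 < M by exact: lt_le_trans M1.
have wzM i : sinorm (wz i) + 1 <= M.
  rewrite /M addrC lerD2l (bigD1 i)//= lerDl.
  by apply: sumr_ge0 => j _; exact: sinorm_ge0.
pose e := eps / 2; have e0 : 0 < e by rewrite divr_gt0.
pose e1 := e / n; have e10 : 0 < e1 by rewrite divr_gt0.
pose e2 := Num.min 1 (e / (2 * n * (A + 1))).
have A1 : 0 < A + 1 by rewrite ltr_wpDl.
have e20 : 0 < e2 by rewrite lt_min ltr01 divr_gt0// !mulr_gt0.
(* Chosen so that [n ^+ 2 * (eta * (6 * (M * h) ^+ 2))] is half of [(e * h) ^+ 2]; [e2] keeps the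
   term in [T] within the other half. *)
pose eta := e ^+ 2 / (12 * n ^+ 2 * M ^+ 2).
have eta0 : 0 < eta by rewrite divr_gt0 ?exprn_gt0// !mulr_gt0 ?exprn_gt0.
have [a [del [aA del0 Hdel]]] := HA eta eta0.
have [d d0 Hd] : exists2 d : R, 0 < d & forall h, 0 < h -> h < d -> forall i,
    [/\ 0 <= h <= l i, sinorm (vquot (z i) 0 h - wz i) <= e2 &
        sinorm (vquot (y i) 0 h - wy i) <= e1].
  apply: common_radius_fin => i.
  have [d1 d10 H1] := zd i e20; have [d2 d20 H2] := yd i e10.
  exists (Num.min (l i) (Num.min d1 d2)); first by rewrite !lt_min l0 d10.
  move=> h h0; rewrite !lt_min => /and3P[hl hd1 hd2].
  have hl' : 0 <= h <= l i by rewrite !ltW.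
  have hn : `|h - 0| = h by rewrite subr0 gtr0_norm.
  by split => //; [apply: H1|apply: H2]; rewrite ?hn// gt_eqF.
(* The last two bounds keep the squared norms of [Z i] and [Z i - Z j], at most [(2 * M * h) ^+ 2],
   in the range of the expansion of [psi]. *)
pose h := Num.min (d / 2) (Num.min 1 (del / (4 * M ^+ 2))).
have h0 : 0 < h by rewrite !lt_min ltr01 !divr_gt0// mulr_gt0// exprn_gt0.
have hd : h < d by rewrite (@le_lt_trans _ _ (d / 2)) ?ge_min ?lexx//; lra.
have h1 : h <= 1 by rewrite !ge_min lexx !orbT.
have hdel : 4 * M ^+ 2 * h ^+ 2 <= del.
  have hh : h <= del / (4 * M ^+ 2) by rewrite !ge_min lexx !orbT.
  rewrite mulrC -ler_pdivlMr ?mulr_gt0 ?exprn_gt0//; apply: le_trans hh.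
  by rewrite expr2 ger_pMl.
have {Hd} Hd i := Hd h h0 hd i.
have hl i : 0 <= h <= l i by case: (Hd i).
have zl i : 0 <= (0 : R) <= l i by rewrite lexx ltW.
have hn0 : h != 0 by rewrite gt_eqF.
pose Y i := y i h - yv; have [Z ZE] : exists Z, forall i, Z i = z i h - zv by exists (fun i => z i h - zv).
have ZM i : Q i -> sinorm (Z i) <= M * h.
  move=> Qi; have [_ hz _] := Hd i.
  have -> : Z i = h *: vquot (z i) 0 h.
    by rewrite ZE /vquot subr0 scalerA mulfV// scale1r z0.
  rewrite sinormZ (gtr0_norm h0) mulrC ler_wpM2r ?(ltW h0)//.
  rewrite -[vquot _ _ _](subrK (wz i)) (le_trans (sinormD _ _))// addrC.
  by rewrite (le_trans _ (wzM i))// lerD2l (le_trans hz)// ge_min lexx.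
pose g (x : V) := sinorm x ^+ 2.
have gE (x : V) : g x = ip x x by rewrite /g sqr_sinorm.
pose E (x : R) := psi x - psi 0 - a * x.
have EB (x : V) (c : R) : 0 <= c -> sinorm x <= c * M * h -> c ^+ 2 <= 4 ->
    `|E (g x)| <= eta * (c ^+ 2 * (M * h) ^+ 2).
  move=> c0 xc c4; have gx : g x <= c ^+ 2 * (M * h) ^+ 2.
    rewrite -exprMn mulrA ler_pXn2r// ?nnegrE ?sinorm_ge0//.
    by rewrite !mulr_ge0// ?(ltW M0) ?(ltW h0).
  have [x0|x0] := eqVneq (g x) 0.
    by rewrite /E x0 mulr0 subr0 subrr normr0 mulr_ge0 ?(ltW eta0)// mulr_ge0// ?sqr_ge0.
  have gx0 : 0 < g x by rewrite lt_def x0/=; exact: sqr_ge0.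
  rewrite (le_trans (Hdel _ gx0 _)) ?ler_wpM2l ?(ltW eta0)//.
  rewrite (le_trans gx)// (le_trans _ hdel)// exprMn mulrA ler_wpM2r ?sqr_ge0//.
  by rewrite ler_wpM2r ?sqr_ge0.
(* Polarization: the linear parts of the three expansions combine into [- 2 * a * ip (Z i) (Z j)],
   and the remainders add up with weights 4 + 1 + 1 = 6. *)
have YZ i j : Q i -> Q j -> ip (Y i) (Y j) <=
    eta * (6 * (M * h) ^+ 2) - 2 * a * ip (Z i) (Z j).
  move=> Qi Qj.
  have -> : ip (Y i) (Y j) = E (g (Z i - Z j)) - E (g (Z i)) - E (g (Z j)) - 2 * a * ip (Z i) (Z j).
    have -> : Z i - Z j = z i h - z j h by rewrite !ZE opprB addrA subrK.
    have Eij : ip (y i h) (y j h) = psi (g (z i h - z j h)) by exact: yz.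
    have Ei : ip (y i h) yv = psi (g (Z i)) by rewrite -(y0 Qi) yz// ZE z0.
    have Ej : ip yv (y j h) = psi (g (Z j)) by rewrite ipC -(y0 Qj) yz// ZE z0.
    have Ev : ip yv yv = psi 0 by rewrite -(y0 Qi) yz// subrr sinorm0 expr0n.
    rewrite /Y ipBl !ipBr Eij Ei Ej Ev /E.
    have -> : g (z i h - z j h) = g (Z i) + g (Z j) - 2 * ip (Z i) (Z j).
      have -> : z i h - z j h = Z i - Z j by rewrite !ZE opprB addrA subrK.
      by rewrite !gE ipBl !ipBr (ipC (Z j) (Z i)); ring.
    by ring.
  have b1 : `|E (g (Z i - Z j))| <= eta * (2 ^+ 2 * (M * h) ^+ 2).
    apply: EB => //; last by rewrite -natrX ler_nat.
    rewrite (le_trans (sinormD _ _))// sinormN.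
    by have := ZM i Qi; have := ZM j Qj; rewrite -[2 * M * h]mulrA => ? ?; lra.
  have b2 : `|E (g (Z i))| <= eta * (1 ^+ 2 * (M * h) ^+ 2).
    by apply: EB; rewrite ?mul1r ?ZM// expr1n ler1n.
  have b3 : `|E (g (Z j))| <= eta * (1 ^+ 2 * (M * h) ^+ 2).
    by apply: EB; rewrite ?mul1r ?ZM// expr1n ler1n.
  move: b1 b2 b3; set x1 := E _; set x2 := E _; set x3 := E _.
  rewrite expr1n mul1r -[2 ^+ 2]/(2 * 2).
  set B := eta * (M * h) ^+ 2; rewrite !ler_norml => /andP[_ b1] /andP[b2 _] /andP[b3 _].
  have e4 : eta * (2 * 2 * (M * h) ^+ 2) = 4 * B by rewrite /B; ring.
  have e6 : eta * (6 * (M * h) ^+ 2) = 6 * B by rewrite /B; ring.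
  by rewrite e6; rewrite e4 in b1; lra.
pose S := \sum_(i | Q i) Y i; pose T := \sum_(i | Q i) Z i.
have cardQ (c : R) : 0 <= c -> \sum_(i | Q i) c <= n * c.
  move=> c0; rewrite sumr_const -mulr_natl ler_wpM2r// /n (@le_trans _ _ #|I|%:R)//.
    by rewrite ler_nat max_card.
  by rewrite lerDl.
have TE : sinorm T <= n * e2 * h.
  have -> : T = h *: (\sum_(i | Q i) (vquot (z i) 0 h - wz i) + \sum_(i | Q i) wz i).
    rewrite sumrB subrK scaler_sumr; apply: eq_bigr => i Qi.
    by rewrite ZE /vquot subr0 scalerA mulfV// scale1r z0.
  rewrite sinormZ (gtr0_norm h0) mulrC ler_wpM2r ?(ltW h0)//.
  rewrite (le_trans (sinormD _ _))// wz0 addr0 (le_trans (sinorm_sum _ _ _))//.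
  apply: (le_trans _ (cardQ e2 (ltW e20))); apply: ler_sum => i _.
  by have [] := Hd i.
have SE : sinorm S ^+ 2 <= n ^+ 2 * (eta * (6 * (M * h) ^+ 2)) + 2 * A * sinorm T ^+ 2.
  rewrite !sqr_sinorm ip_suml.
  have c0 : 0 <= eta * (6 * (M * h) ^+ 2).
    by rewrite mulr_ge0 ?(ltW eta0)// mulr_ge0// sqr_ge0.
  apply: (@le_trans _ _ (\sum_(i | Q i) \sum_(j | Q j)
     (eta * (6 * (M * h) ^+ 2) - 2 * a * ip (Z i) (Z j)))).
    apply: ler_sum => i Qi; rewrite ip_sumr; apply: ler_sum => j Qj; exact: YZ.
  have -> : \sum_(i | Q i) \sum_(j | Q j) (eta * (6 * (M * h) ^+ 2) - 2 * a * ip (Z i) (Z j)) =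
      \sum_(i | Q i) \sum_(j | Q j) (eta * (6 * (M * h) ^+ 2)) - 2 * a * ip T T.
    rewrite ip_suml mulr_sumr -sumrB; apply: eq_bigr => i _.
    by rewrite ip_sumr mulr_sumr -sumrB.
  apply: lerD.
    rewrite [n ^+ 2]expr2 -mulrA (le_trans _ (cardQ _ _))//; last by rewrite mulr_ge0// (ltW n0).
    by apply: ler_sum => i Qi; exact: cardQ.
  rewrite -mulNr ler_wpM2r ?ip_ge0// -mulrN ler_wpM2l//.
  by rewrite (le_trans (ler_norm _))// normrN.
have Se : sinorm S <= e * h.
  have eh0 : 0 <= e * h by exact: mulr_ge0 (ltW e0) (ltW h0).
  rewrite -(@ler_pXn2r _ 2)// ?nnegrE ?sinorm_ge0//.
  rewrite (le_trans SE)//.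
  have t1 : n ^+ 2 * (eta * (6 * (M * h) ^+ 2)) = e ^+ 2 / 2 * h ^+ 2.
    by rewrite /eta; field; rewrite !gt_eqF.
  have t2 : 2 * A * sinorm T ^+ 2 <= e ^+ 2 / 2 * h ^+ 2.
    have ee : n * e2 * h <= e / (2 * (A + 1)) * h.
      rewrite ler_wpM2r ?(ltW h0)//.
      have -> : e / (2 * (A + 1)) = n * (e / (2 * n * (A + 1))).
        by field; rewrite !gt_eqF.
      by rewrite ler_wpM2l ?(ltW n0)// ge_min lexx orbT.
    have tt := le_trans TE ee.
    have b0 : 0 <= e / (2 * (A + 1)) * h.
      by rewrite mulr_ge0 ?(ltW h0)// divr_ge0 ?(ltW e0)// mulr_ge0 ?(ltW A1).
    have t3 : sinorm T ^+ 2 <= (e / (2 * (A + 1)) * h) ^+ 2.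
      by rewrite ler_pXn2r// ?nnegrE ?sinorm_ge0.
    apply: (le_trans (ler_wpM2l _ t3)); first by rewrite mulr_ge0.
    have -> : 2 * A * (e / (2 * (A + 1)) * h) ^+ 2 = e ^+ 2 / 2 * h ^+ 2 * (A / (A + 1) ^+ 2).
      by field; rewrite gt_eqF.
    rewrite ler_piMr//; first by rewrite mulr_ge0 ?sqr_ge0// divr_ge0// sqr_ge0.
    rewrite ler_pdivrMr ?exprn_gt0// mul1r; have := sqr_ge0 A; rewrite sqrrD1; lra.
  by rewrite exprMn; lra.
have -> : \sum_(i | Q i) wy i = h^-1 *: S - \sum_(i | Q i) (vquot (y i) 0 h - wy i).
  rewrite sumrB opprB addrC; have -> : \sum_(i | Q i) vquot (y i) 0 h = h^-1 *: S.
    by rewrite scaler_sumr; apply: eq_bigr => i Qi; rewrite /vquot subr0 y0.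
  by rewrite subrK.
rewrite (le_trans (sinormD _ _))// sinormN.
have -> : eps = e + e by rewrite /e -splitr.
apply: lerD.
  by rewrite sinormZ normfV (gtr0_norm h0) mulrC ler_pdivrMr.
have -> : e = n * e1 by rewrite /e1 mulrC divfK// gt_eqF.
rewrite (le_trans (sinorm_sum _ _ _))// (le_trans _ (cardQ e1 (ltW e10)))//.
by apply: ler_sum => i _; have [] := Hd i.
Qed.

End Kirchhoff.

(** * Chains of derivatives along a segment *)

Section RegularChains.
Context {R : realType} {V : semiInner R} {T : Type}.
Variables (z : T -> V) (l : R) (m : nat).
Hypothesis l0 : 0 < l.

Definition regular_chain (D : nat -> R -> V) (C : R) : Prop := [/\ 0 <= C,
  forall k, (k < m)%N -> forall t, 0 <= t <= l -> vderiv l (D k) t (D k.+1 t),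
  forall k t, (k <= m)%N -> 0 <= t <= l -> span_closure z (D k t) /\ sinorm (D k t) <= C &
  forall k s t, (k <= m)%N -> 0 <= s -> s <= t -> t <= l ->
    sinorm (D k t - D k s) <= C * Num.sqrt (t - s)].

(** The derivatives for the opposite orientation, as seen when exiting from the target of an
    edge. *)
Definition reverse_chain (D : nat -> R -> V) (k : nat) (t : R) : V := (-1) ^+ k *: D k (l - t).

Lemma reverse_regular_chain D C : regular_chain D C -> regular_chain (reverse_chain D) C.
Proof.
move=> [C0 Dd Db Dh]; have rev t : 0 <= t <= l -> 0 <= l - t <= l.
  by move=> /andP[? ?]; apply/andP; split; lra.
have n1 k : `|(-1 : R) ^+ k| = 1 by rewrite normrX normrN normr1 expr1n.
split => //.
- move=> k km t tl e e0; have [d d0 H] := Dd k km _ (rev t tl) e e0.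
  exists d => // s sl st sd.
  have E : l - s - (l - t) = - (s - t) by ring.
  have -> : vquot (reverse_chain D k) t s - reverse_chain D k.+1 t =
     (-1) ^+ k.+1 *: (vquot (D k) (l - t) (l - s) - D k.+1 (l - t)).
    rewrite /vquot /reverse_chain E invrN exprS mulN1r !scaleNr opprK -scalerBr.
    by rewrite -[RHS]scalerN opprD !opprK [RHS]scalerDr !scalerA mulrC.
  rewrite sinormZ n1 mul1r; apply: H; rewrite ?rev// ?E ?normrN//.
  by rewrite (inj_eq (addrI l)) (inj_eq oppr_inj).
- move=> k t km tl; have [h1 h2] := Db k _ km (rev t tl); split.
    exact: span_closureZ.
  by rewrite sinormZ n1 mul1r.
- move=> k s t km s0 st tl; rewrite -scalerBr sinormZ n1 mul1r sinormBC.
  have := Dh k (l - t) (l - s) km.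
  have -> : l - s - (l - t) = t - s by ring.
  by apply; lra.
Qed.

Lemma regular_chain_uniform D C k (e : R) : regular_chain D C -> (k <= m)%N -> 0 < e ->
  exists2 d : R, 0 < d & forall s t, 0 <= s <= l -> 0 <= t <= l -> `|s - t| < d ->
    sinorm (D k s - D k t) <= e.
Proof.
move=> [C0 _ _ Dh] km e0; have C1 : 0 < C + 1 by rewrite ltr_wpDl.
exists ((e / (C + 1)) ^+ 2); first by rewrite exprn_gt0// divr_gt0.
have main s t : 0 <= s -> s <= t -> t <= l -> t - s < (e / (C + 1)) ^+ 2 ->
    sinorm (D k t - D k s) <= e.
  move=> s0 st tl std; rewrite (le_trans (Dh k s t km s0 st tl))//.
  have : Num.sqrt (t - s) <= e / (C + 1).
    have ec : 0 <= e / (C + 1) by rewrite divr_ge0 ?ltW.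
    by rewrite -[leRHS](ger0_norm ec) -sqrtr_sqr ler_wsqrtr// ltW.
  move=> /(ler_wpM2l C0) h; apply: (le_trans h).
  by rewrite mulrCA ger_pMr// ler_pdivrMr// mul1r lerDl.
move=> s t /andP[s0 sl] /andP[t0 tl]; have [st|/ltW st] := leP s t.
  by rewrite distrC ger0_norm ?subr_ge0// sinormBC; exact: main.
by rewrite ger0_norm ?subr_ge0//; exact: main.
Qed.

Lemma regular_chain_transfer D C (psi : R -> R) (W : semiInner R) (y : R -> W) :
  regular_chain D C -> completely_monotonic psi ->
  (exists L : R, derive1n m psi t @[t --> 0^'+] --> L) ->
  si_complete W ->
  (forall s t, 0 <= s <= l -> 0 <= t <= l ->
     ip (y s) (y t) = psi (sinorm (D 0%N s - D 0%N t) ^+ 2)) ->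
  exists E : nat -> R -> W, [/\ E 0%N = y,
    forall k, (k < m)%N -> forall t, 0 <= t <= l -> vderiv l (E k) t (E k.+1 t) &
    forall e : R, 0 < e -> exists2 d : R, 0 < d & forall s t, 0 <= s <= l -> 0 <= t <= l ->
      `|s - t| < d -> sinorm (E m s - E m t) <= e].
Proof.
move=> DC cm [L HL] Wc yE; have [C0 Dd Db _] := DC.
apply: (path_Cm l0 Dd _ _ (cm_seq_derive1n cm) _ (psi := psi)) => //.
- by move=> k km e e0; exact: (regular_chain_uniform DC km e0).
- by move=> k km; exists C => t tl; exact: (Db k t km tl).2.
- exists L => e e0; have /cvgrPdist_le/(_ e e0)[d d0 Hd] := HL.
  exists d => // t t0 td; rewrite distrC; apply: Hd => //=.
  by rewrite sub0r normrN gtr0_norm.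
- move=> x e x0 e0; have [d d0 H] := cm_right_continuous cm x0 e0.
  by exists d => // h h0 hd; rewrite [x + h]addrC /=; apply: H => //; exact: ltW.
- by move=> s t sl tl; rewrite yE// sqr_sinorm.
Qed.

End RegularChains.

Lemma cm_limit_expansion0 (R : realType) (psi : R -> R) (m : nat) :
  completely_monotonic psi -> (0 < m)%N ->
  (exists L : R, derive1n m psi t @[t --> 0^'+] --> L) ->
  exists2 A : R, 0 <= A & forall eta : R, 0 < eta -> exists a d : R,
    [/\ `|a| <= A, 0 < d & forall g, 0 < g -> g <= d -> `|psi g - psi 0 - a * g| <= eta * g].
Proof.
move=> cm m0 [L HL]; apply: (cm_expansion0 (cm_seq_derive1n cm) m0).
- exists L => e e0; have /cvgrPdist_le/(_ e e0)[d d0 Hd] := HL.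
  exists d => // t t0 td; rewrite distrC; apply: Hd => //=.
  by rewrite sub0r normrN gtr0_norm.
- move=> e e0; have [d d0 H] := cm_right_continuous cm (lexx 0) e0.
  by exists d => // t t0 td; have := H t (ltW t0) td; rewrite addr0.
Qed.

(** * Derivatives of Z along the edges *)

Section GraphChains.
Context {R : realType} (G : metricGraph R) (p : nat) (K : gpoint G -> gpoint G -> R).
Hypothesis p0 : (0 < p)%N.
Hypothesis rK : reproducing_kernel (spaceF (G := G) p) (innerF (G := G) p) K.
Context {V : semiInner R} (z : gpoint G -> V).
Hypothesis Vc : si_complete V.
Hypothesis zK : forall x y, ip (z x) (z y) = K x y.

Lemma edge_regular_chain (e : edge G) : exists (D : nat -> R -> V) (C : R),
  regular_chain z (len e) p.-1 D C /\ forall t, D 0%N t = z (edge_pt e t).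
Proof.
have [|||D [C [C0 [D0 Dd _ Db Dh]]]] := @weakly_Cm_path R V _ z (len e) p.-1
  (fun t => edge_pt e t) (fun x k => edge_derivn e k (K x)) (len_gt0 e) Vc.
- by move=> x t _; rewrite zK.
- by move=> x j; apply: edge_derivn_derives; exact: rK.1.
- move=> L s t s0 st tl; rewrite (le_trans (edge_derivn_holder p0 rK L s0 st tl))//.
  rewrite le_eqVlt; apply/orP; left; apply/eqP; congr (_ * Num.sqrt _).
  rewrite ip_comb; apply: eq_bigr => q _; rewrite ipC ip_comb mulr_sumr.
  by apply: eq_bigr => r _; rewrite zK mulrA.
- by exists D, C.
Qed.

Lemma exit_regular_chain (v : vertex G) (e : edge G) : exists (D : nat -> R -> V) (C : R),
  regular_chain z (len e) p.-1 D C /\ forall t, D 0%N t = z (exit_pt v e t).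
Proof.
have [D [C [H D0]]] := edge_regular_chain e; rewrite /exit_pt; case: (src e == v).
  by exists D, C.
exists (reverse_chain (len e) D), C; split; first exact: reverse_regular_chain.
by move=> t; rewrite /reverse_chain expr0 scale1r D0.
Qed.

Lemma exit_pt0 (v : vertex G) (e : edge G) : incident v e -> exit_pt v e 0 = inl v.
Proof.
rewrite /incident /exit_pt /edge_pt; case: eqP => [<- _|ne /= /eqP <-].
  by case: insubP => [[x /= h] h0|/= _]; [move: h0; rewrite /= ltxx|rewrite lexx].
rewrite subr0; case: insubP => [[x /= h] h0|/= _].
  by move: h0; rewrite /= ltxx andbF.
by rewrite leNgt len_gt0.
Qed.

(** Through this pairing the Kirchhoff condition of the functions [K x] reaches the vectors. *)
Lemma exit_derivn1 (v : vertex G) (e : edge G) D C x : (1 < p)%N ->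
  regular_chain z (len e) p.-1 D C -> (forall t, D 0%N t = z (exit_pt v e t)) ->
  ip (D 1%N 0) (z x) = exit_derivn v e 1 (K x).
Proof.
move=> p1 [_ Dd _ _] D0; have m0 : (0 < p.-1)%N by rewrite -subn1 subn_gt0.
have tl : 0 <= (0 : R) <= len e by rewrite lexx ltW// len_gt0.
rewrite /exit_derivn /=; apply/esym/seg_deriv_cvg => //; first exact: len_gt0.
apply/seg_quot_cvgP => eps eps0; have M0 : 0 < sinorm (z x) + 1.
  by rewrite ltr_wpDl// sinorm_ge0.
have [d d0 H] := Dd 0%N m0 0 tl (eps / (sinorm (z x) + 1)) (divr_gt0 eps0 M0).
exists d => // s s0 sl st sd; have sl' : 0 <= s <= len e by rewrite s0.
have := H s sl' st sd => h.
have -> : (K x (exit_pt v e s) - K x (exit_pt v e 0)) / (s - 0) - ip (D 1%N 0) (z x) =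
    ip (vquot (D 0%N) 0 s - D 1%N 0) (z x).
  by rewrite ipBl ipZl ipBl !D0 !zK mulrC -!zK ![ip _ (z x)]ipC !zK.
rewrite (le_trans (ip_le _ _))// (le_trans (ler_wpM2r (sinorm_ge0 _) h))//.
by rewrite mulrAC ler_pdivrMr// ler_wpM2l ?(ltW eps0)// lerDl.
Qed.

End GraphChains.

(** * Mean-square regularity of Y on the graph *)

Lemma L2_sumE (R : realType) (d : measure_display) (Omega : measurableType d)
    (P : probability Omega R) (I : Type) (r : seq I) (Q : pred I) (F : I -> L2 P) w :
  ((\sum_(i <- r | Q i) F i : L2 P) : L2type P) w = \sum_(i <- r | Q i) (F i : L2type P) w.
Proof.
elim: r => [|i r IH]; first by rewrite !big_nil.
by rewrite !big_cons; case: ifP => _ //; rewrite -IH.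
Qed.

Lemma L2_norm0_ae (R : realType) (d : measure_display) (Omega : measurableType d)
    (P : probability Omega R) (U : L2 P) : sinorm U = 0 ->
  {ae P, forall w, (U : L2type P) w = 0}.
Proof.
move=> U0; have mU := L2_measurable U.
have : (\int[P]_w `|((U : L2type P) w ^+ 2)%:E|)%E = 0%E.
  have -> : (\int[P]_w `|((U : L2type P) w ^+ 2)%:E| = \int[P]_w ((U : L2type P) w ^+ 2)%:E)%E.
    by apply: eq_integral => w _; rewrite gee0_abs// lee_fin sqr_ge0.
  by rewrite -L2_normE U0 expr0n.
have mU2 : measurable_fun setT (fun w => ((U : L2type P) w ^+ 2)%:E).
  by apply/measurable_EFinP; exact: measurable_funX.
move=> /(ae_eq_integral_abs P measurableT mU2); apply: filterS => w /(_ I) /= [] /eqP.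
by rewrite sqrf_eq0 => /eqP.
Qed.

Section MeanSquareGraph.
Context {R : realType} (G : metricGraph R) (p : nat) (K : gpoint G -> gpoint G -> R).
Hypothesis p1 : (1 < p)%N.
Hypothesis rK : reproducing_kernel (spaceF (G := G) p) (innerF (G := G) p) K.
Context {V : semiInner R} (z : gpoint G -> V).
Hypothesis Vc : si_complete V.
Hypothesis zK : forall x y, ip (z x) (z y) = K x y.
Variable psi : R -> R.
Hypothesis psi_cm : completely_monotonic psi.
Hypothesis psi_lim : exists L : R, derive1n p.-1 psi t @[t --> 0^'+] --> L.
Context (d : measure_display) (Omega : measurableType d) (P : probability Omega R).
Variables (Y : gpoint G -> {RV P >-> R}) (y : gpoint G -> L2 P).
Hypothesis yY : forall x, L2rv (y x) = Y x :> (Omega -> R).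
Hypothesis yE : forall x x', ip (y x) (y x') = psi (sinorm (z x - z x') ^+ 2).

Let p0 : (0 < p)%N := ltnW p1.
Let m0 : (0 < p.-1)%N. Proof. by rewrite -subn1 subn_gt0. Qed.

Lemma ms_chain_exists (l : R) (c : R -> gpoint G) D C : 0 < l ->
  regular_chain z l p.-1 D C -> (forall t, D 0%N t = z (c t)) ->
  exists E : nat -> R -> L2 P, [/\ E 0%N = fun t => y (c t),
    forall k, (k < p.-1)%N -> forall t, 0 <= t <= l -> vderiv l (E k) t (E k.+1 t) &
    forall e : R, 0 < e -> exists2 d : R, 0 < d & forall s t, 0 <= s <= l -> 0 <= t <= l ->
      `|s - t| < d -> sinorm (E p.-1 s - E p.-1 t) <= e].
Proof.
move=> l0 DC D0; apply: (regular_chain_transfer l0 DC psi_cm psi_lim (@L2_complete _ _ _ P)).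
by move=> s t _ _; rewrite yE !D0.
Qed.

Theorem ms_C_graph_cm : ms_C_graph 1 p.-1 Y.
Proof.
split=> [e|v i i1].
  have [D [C [DC D0]]] := edge_regular_chain p0 rK Vc zK e.
  have [E [E0 Ed Eu]] := ms_chain_exists (len_gt0 e) DC D0.
  by apply: (ms_C_chain (y := E)) => // t; rewrite E0 yY.
case: i i1 => [|[|//]] _.
  exists (fun _ => Y (inl v)).
    move=> e ve; exists (fun _ t => Y (exit_pt v e t)); first by split.
    by rewrite exit_pt0.
  by apply: aeW => w.
have /choice[D0 /choice[C HD]] : forall e, exists D C,
    regular_chain z (len e) p.-1 D C /\ forall t, D 0%N t = z (exit_pt v e t).
  by move=> e; exact: (exit_regular_chain p0 rK Vc zK v e).
have /choice[E HE] : forall e, exists E : nat -> R -> L2 P,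
   [/\ E 0%N = fun t => y (exit_pt v e t),
    forall k, (k < p.-1)%N -> forall t, 0 <= t <= len e -> vderiv (len e) (E k) t (E k.+1 t) &
    forall e' : R, 0 < e' -> exists2 d : R, 0 < d & forall s t, 0 <= s <= len e -> 0 <= t <= len e ->
      `|s - t| < d -> sinorm (E p.-1 s - E p.-1 t) <= e'].
  by move=> e; have [h1 h2] := HD e; exact: (ms_chain_exists (len_gt0 e) h1 h2).
exists (fun e => L2rv (E e 1%N 0)).
  move=> e ve; have [E0 Ed _] := HE e.
  exists (ms_chain (fun h => Y (exit_pt v e h)) (E e)) => //.
  have [|h1 h2] := @ms_chain_derivs _ _ _ P (len e) p.-1 (fun h => Y (exit_pt v e h)) (E e) _ Ed.
    by move=> t; rewrite E0 yY.
  by split=> // k k1; apply: h2; exact: leq_trans k1 m0.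
have tl (e : edge G) : 0 <= (0 : R) <= len e by rewrite lexx ltW// len_gt0.
(* The sum lies in the closed span of [z] and is orthogonal to every [z x], because [K x] satisfies
   the Kirchhoff condition of order 1. *)
have s0 : sinorm (\sum_(e | incident v e) D0 e 1%N 0) = 0.
  apply/eqP; rewrite eq_le sinorm_ge0 andbT.
  apply: (span_duality (z := z)) => //.
    by apply: span_closure_sum => e _; have [[_ _ /(_ 1%N 0 m0 (tl e))[+ _] _] _] := HD e.
  move=> L; rewrite mul0r ip_comb big1 ?normr0// => q _.
  rewrite ip_suml; under eq_bigr => e ve.
    have [h1 h2] := HD e; rewrite (exit_derivn1 zK q.2 p1 h1 h2).
    over.
  by have [[_ /(_ v 1%N m0)]] := rK.1 q.2; rewrite /kirchhoff /= => -> _ _ _; rewrite mulr0.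
have s1 : sinorm (\sum_(e | incident v e) E e 1%N 0) = 0.
  apply: (@kirchhoff_transfer _ V (L2 P) _ (incident v) (@len _ G) (fun e => D0 e 0%N)
    (fun e => E e 0%N) (z (inl v)) (y (inl v)) (fun e => D0 e 1%N 0) (fun e => E e 1%N 0) psi) => //.
  - exact: len_gt0.
  - by move=> e ve; have [_ ->] := HD e; rewrite exit_pt0.
  - by move=> e ve; have [-> _ _] := HE e; rewrite exit_pt0.
  - by move=> e; have [[_ + _ _] _] := HD e; apply.
  - by move=> e; have [_ + _] := HE e; apply.
  - move=> e e' s t _ _ _ _; have [-> _ _] := HE e; have [-> _ _] := HE e'.
    by rewrite yE; have [_ ->] := HD e; have [_ ->] := HD e'.
  - exact: (cm_limit_expansion0 psi_cm m0 psi_lim).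
have := L2_norm0_ae s1; apply: filterS => w; rewrite L2_sumE => h.
by rewrite /kirchhoff.
Qed.

End MeanSquareGraph.

Lemma Lfun2_bounded_restrict (R : realType) (d : measure_display) (T : measurableType d)
    (mu : {measure set T -> \bar R}) (D : set T) (f : T -> R) (C : R) : measurable D ->
  (mu D < +oo)%E -> measurable_fun D f -> (forall x, D x -> `|f x| <= C) ->
  f \_ D \in Lfun mu 2%:E.
Proof.
move=> mD muD mf fC; apply: Lfun2_mem; first exact/(measurable_restrictT _ mD).
apply: (@le_lt_trans _ _ (\int[mu]_(x in D) (C ^+ 2)%:E)%E); last first.
  by rewrite integral_cst// lte_mul_pinfty// ?lee_fin ?sqr_ge0.
rewrite [leRHS]integral_mkcond; apply: ge0_le_integral => //.
- by move=> t _; rewrite lee_fin sqr_ge0.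
- apply/measurable_EFinP/measurable_funX; exact/(measurable_restrictT _ mD).
- by apply/(measurable_restrictT _ mD); exact: measurable_cst.
- move=> t _; rewrite /patch; case: ifP => [|_]; last by rewrite expr0n.
  rewrite inE/= => tD; rewrite lee_fin -[leLHS]real_normK ?num_real//.
  have h := fC t tD.
  by rewrite ler_pXn2r ?nnegrE// (le_trans _ h).
Qed.

(** * Polynomials on a segment, flat at its endpoints *)

Section Polynomials.
Context {R : realType}.
Implicit Types (q : {poly R}).

(** The difference quotient at [t] is itself a polynomial, by the factor theorem, and takes the
    value q'(t) at [t]. *)
Lemma horner_quot q (t e : R) : 0 < e -> exists2 d : R, 0 < d & forall s, s != t ->
  `|s - t| < d -> `|(q.[s] - q.[t]) / (s - t) - q^`().[t]| <= e.
Proof.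
move=> e0; have /factor_theorem[g gE] : root (q - q.[t]%:P) t.
  by rewrite /root !hornerE subrr.
have qE : q = g * ('X - t%:P) + q.[t]%:P by rewrite -gE subrK.
have -> : q^`().[t] = g.[t].
  by rewrite qE derivD derivM derivXsubC derivC mulr1 !hornerE subrr mulr0 add0r.
have /cvgrPdist_le/(_ e e0)[d d0 Hd] := @continuous_horner R g t.
exists d => // s st sd; have st0 : s - t != 0 by rewrite subr_eq0.
have -> : (q.[s] - q.[t]) / (s - t) = g.[s].
  have -> : q.[s] = g.[s] * (s - t) + q.[t] by rewrite {1}qE !hornerE.
  by rewrite addrK mulfK.
by rewrite distrC; apply: Hd; rewrite /= distrC.
Qed.

Lemma seg_deriv_horner l (f : R -> R) q t : 0 < l ->
  (forall s, 0 <= s <= l -> f s = q.[s]) -> 0 <= t <= l ->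
  seg_quot l f t --> q^`().[t] /\ seg_deriv l f t = q^`().[t].
Proof.
move=> l0 fq tl; have H : seg_quot l f t --> q^`().[t].
  apply/seg_quot_cvgP => e e0; have [d d0 Hd] := @horner_quot q t e e0.
  by exists d => // s s0 sl st sd; rewrite !fq// ?s0//; exact: Hd.
by split=> //; exact: seg_deriv_cvg.
Qed.

Lemma seg_derivn_horner l (f : R -> R) q k t : 0 < l ->
  (forall s, 0 <= s <= l -> f s = q.[s]) -> 0 <= t <= l ->
  seg_derivn l k f t = q^`(k).[t].
Proof.
move=> l0 fq; elim: k t => [|k IH] t tl; first by rewrite derivn0; exact: fq.
by rewrite derivnS; have [_ <-] := seg_deriv_horner l0 IH tl.
Qed.

Lemma horner_bounded q (l : R) : 0 <= l ->
  exists2 C : R, 0 <= C & forall t, 0 <= t <= l -> `|q.[t]| <= C.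
Proof.
move=> l0; elim/poly_ind: q => [|q c [C C0 IH]].
  by exists 0 => // t _; rewrite horner0 normr0.
exists (C * l + `|c|) => [|t tl]; first by rewrite addr_ge0// mulr_ge0.
rewrite !hornerE (le_trans (ler_normD _ _))// lerD2r normrM.
apply: ler_pM => //; first exact: IH.
by case/andP: tl => t0 tl; rewrite ger0_norm.
Qed.

Lemma derivn_XsubC_exp_root (a : R) n q k : (k < n)%N ->
  ((('X - a%:P) ^+ n * q)^`(k)).[a] = 0.
Proof.
elim: k n q => [|k IH] [|n] q // kn.
  by rewrite derivn0 !hornerE subrr expr0n mul0r.
rewrite derivSn derivM deriv_exp derivXsubC mul1r /=.
have -> : ('X - a%:P) ^+ n *+ n.+1 * q + ('X - a%:P) ^+ n.+1 * q^`() =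
  ('X - a%:P) ^+ n * (q *+ n.+1 + ('X - a%:P) * q^`()).
  by rewrite [in LHS]exprSr [RHS]mulrDr mulrA mulrnAl; congr (_ + _); rewrite mulrnAr.
exact: IH.
Qed.

Lemma derivn_reverse (l : R) q k :
  (q \Po (l%:P - 'X))^`(k) = (-1) ^+ k *: (q^`(k) \Po (l%:P - 'X)).
Proof.
elim: k => [|k IH]; first by rewrite !derivn0 expr0 scale1r.
rewrite !derivnS IH derivZ deriv_comp derivB derivC derivX sub0r mulrN1 exprSr mulrN1.
by rewrite scaleNr scalerN.
Qed.

(* A Bezout relation between X^p and (X - l)^p provides the step. *)
Lemma flat_step (l : R) p : l != 0 -> (0 < p)%N -> exists S : {poly R},
  [/\ S.[0] = 0, S.[l] = 1 & forall k, (0 < k)%N -> (k < p)%N ->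
     (S^`(k)).[0] = 0 /\ (S^`(k)).[l] = 0].
Proof.
move=> l0 p0.
have /Bezout_eq1_coprimepP[[u v] /= uv] :
    coprimep (('X - 0%:P) ^+ p) (('X - l%:P) ^+ p : {poly R}).
  by apply/coprimep_expl/coprimep_expr/coprimep_XsubC2; rewrite subr0.
pose S := u * ('X - 0%:P) ^+ p.
have SE : S = 1 - v * ('X - l%:P) ^+ p by rewrite -uv addrK.
exists S; split.
- by rewrite /S !hornerE oppr0 expr0n (gtn_eqF p0) mulr0.
- by rewrite SE !hornerE subrr expr0n (gtn_eqF p0) mulr0 subr0.
- move=> k k0 kp; split; first by rewrite /S mulrC derivn_XsubC_exp_root.
  rewrite SE derivnB -(polyC1 R) derivnC (gtn_eqF k0) sub0r hornerN mulrC.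
  by rewrite derivn_XsubC_exp_root// oppr0.
Qed.

End Polynomials.

(** * Piecewise polynomial members of F *)

Section PiecewisePolynomials.
Context {R : realType} (G : metricGraph R) (p : nat).
Hypothesis p0 : (0 < p)%N.
Variables (a : vertex G -> R) (Q : edge G -> {poly R}).
Hypothesis Q0 : forall e, (Q e).[0] = a (src e).
Hypothesis Ql : forall e, (Q e).[len e] = a (tgt e).
Hypothesis Qflat : forall e k, (0 < k)%N -> (k < p)%N ->
  ((Q e)^`(k)).[0] = 0 /\ ((Q e)^`(k)).[len e] = 0.

Definition piecewise_poly (x : gpoint G) : R :=
  match x with inl v => a v | inr u => (Q (sval u).1).[(sval u).2] end.

Lemma piecewise_polyE e t : 0 <= t <= len e -> piecewise_poly (edge_pt e t) = (Q e).[t].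
Proof.
move=> /andP[t0 tl]; rewrite /edge_pt; case: insubP => [[x h] _ /= E|/= h].
  by rewrite /= E.
case: ifP => /= t0'.
  by have -> : t = 0; [apply/eqP; rewrite eq_le t0'|rewrite Q0].
have -> : t = len e; last by rewrite Ql.
move: h; rewrite ltNge t0'/= -leNgt => lt; by apply/eqP; rewrite eq_le tl.
Qed.

Lemma piecewise_poly_edge_derivn e k t : 0 <= t <= len e ->
  edge_derivn e k piecewise_poly t = ((Q e)^`(k)).[t].
Proof.
move=> tl; apply: seg_derivn_horner => //; first exact: len_gt0.
by move=> s sl; rewrite /restr piecewise_polyE.
Qed.

Lemma piecewise_poly_exit_derivn v e k : incident v e -> (k < p)%N ->
  exit_derivn v e k piecewise_poly = if k is 0%N then a v else 0.
Proof.
move=> ve kp; have l0 := len_gt0 e.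
have tl : 0 <= (0 : R) <= len e by rewrite lexx ltW.
pose q := if src e == v then Q e else Q e \Po ((len e)%:P - 'X).
have qE h : 0 <= h <= len e -> piecewise_poly (exit_pt v e h) = q.[h].
  move=> hl; rewrite /exit_pt /q; case: ifP => _; first exact: piecewise_polyE.
  rewrite piecewise_polyE ?horner_comp ?hornerE//.
  by move: hl => /andP[? ?]; apply/andP; split; lra.
rewrite /exit_derivn (seg_derivn_horner k l0 qE tl).
case: k kp => [|k] kp.
  rewrite derivn0 -qE//; have := ve; rewrite /incident => /orP ve'.
  rewrite qE// /q; case: eqP => [<-|ne]; first by rewrite Q0.
  by case: ve' => /eqP // <-; rewrite horner_comp !hornerE subr0 Ql.
rewrite /q; case: ifP => _; first by have [] := Qflat e (ltn0Sn k) kp.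
rewrite derivn_reverse hornerZ horner_comp !hornerE subr0.
by have [_ ->] := Qflat e (ltn0Sn k) kp; rewrite mulr0.
Qed.

(** The Kirchhoff conditions hold because the exiting derivatives of orders 1 to [p.-1] vanish at
    all vertices; absolute continuity is a Lipschitz bound, as the p-th derivative is bounded. *)
Lemma piecewise_poly_spaceF : \sum_v a v = 0 -> spaceF p piecewise_poly.
Proof.
move=> a0; split => //.
- split=> [e|v i im].
    have l0 := len_gt0 e; split.
      move=> i im t; rewrite in_itv/= => tl; apply/cvg_ex; exists ((Q e)^`(i.+1)).[t].
      have H s : 0 <= s <= len e -> edge_derivn e i piecewise_poly s = ((Q e)^`(i)).[s].
        exact: piecewise_poly_edge_derivn.
      by rewrite derivnS; have [] := seg_deriv_horner l0 H tl.
    have H : {within `[0, len e], continuous (horner ((Q e)^`(p.-1)))}.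
      by apply: continuous_subspaceT => x; exact: continuous_horner.
    apply: (subspace_eq_continuous _ H) => t; rewrite inE/= in_itv/= => tl.
    by rewrite /from_subspace; apply/esym/piecewise_poly_edge_derivn.
  have ip : (i < p)%N by rewrite -(prednK p0) ltnS.
  rewrite /kirchhoff; case: ifP => io.
    rewrite big1// => e ve; rewrite piecewise_poly_exit_derivn//.
    by case: (i) io.
  by move=> e1 e2 v1 v2; rewrite !piecewise_poly_exit_derivn.
- move=> e eps eps0; have l0 := len_gt0 e.
  have [C C0 HC] := horner_bounded ((Q e)^`(p)) (ltW l0).
  have C1 : 0 < C + 1 by rewrite ltr_wpDl.
  have lip s t : 0 <= s -> s <= t -> t <= len e ->
      `|edge_derivn e p.-1 piecewise_poly t - edge_derivn e p.-1 piecewise_poly s|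
        <= (C + 1) * (t - s).
    move=> s0 st tl; have [->|ne] := eqVneq s t; first by rewrite !subrr normr0 mulr0.
    have lts : s < t by rewrite lt_def eq_sym ne.
    rewrite !piecewise_poly_edge_derivn; try by apply/andP; split; lra.
    have dq : seg_derives (len e) (horner ((Q e)^`(p.-1))) (horner ((Q e)^`(p))).
      move=> x xl e' e'0; have [d d0 Hd] := @horner_quot R ((Q e)^`(p.-1)) x e' e'0.
      have E : (Q e)^`(p) = ((Q e)^`(p.-1))^`() by rewrite -derivnS prednK.
      by exists d => // u ul ux ud; rewrite E; exact: Hd.
    have [c [sc ct ->]] := seg_MVT dq s0 lts tl.
    rewrite normrM (@ger0_norm _ (t - s)) ?subr_ge0// ler_wpM2r ?subr_ge0//.
    by rewrite (le_trans (HC c _)) ?lerDl//; apply/andP; split; lra.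
  exists (eps / (C + 1)); first by rewrite divr_gt0.
  move=> n u v uv _ sm; apply: (@le_lt_trans _ _ (\sum_i (C + 1) * (v i - u i))).
    by apply: ler_sum => i _; have [? [? ?]] := uv i; exact: lip.
  by rewrite -mulr_sumr mulrC -ltr_pdivlMr.
- move=> e; have l0 := len_gt0 e; rewrite /seg_L2.
  have -> : edge_derivn e p piecewise_poly \_ `[0, len e] =
      (horner ((Q e)^`(p))) \_ `[0, len e].
    apply/funext => t; rewrite /patch; case: ifP => //.
    by rewrite inE/= in_itv/= => tl; exact: piecewise_poly_edge_derivn.
  have mq : measurable_fun `[0, len e]%classic (horner ((Q e)^`(p))).
    apply: (measurable_funS measurableT) => //.
    by apply: continuous_measurable_fun => x; exact: continuous_horner.
  have [C C0 HC] := horner_bounded ((Q e)^`(p)) (ltW l0).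
  have fin : (@lebesgue_measure R `[0%R, len e]%classic < +oo)%E.
    by rewrite lebesgue_measure_itv/= lte_fin l0 -EFinD ltry.
  have H t : [set` `[0, len e]] t -> `|((Q e)^`(p)).[t]| <= C.
    by rewrite /= in_itv/=; exact: HC.
  exact: (@Lfun2_bounded_restrict R _ _ (@lebesgue_measure R) _ _ C _ fin mq H).
Qed.

End PiecewisePolynomials.

(** * Separation of the points of the graph *)

Section Separation.
Context {R : realType} (G : metricGraph R) (p : nat).
Hypothesis p0 : (0 < p)%N.

Lemma spaceF_separates_interior (u : {x : edge G * R | 0 < x.2 < len x.1}) (y : gpoint G) :
  inr u <> y -> exists f, spaceF p f /\ f (inr u) != f y.
Proof.
case: u => -[e t] /= htl uy; have /andP[t0 tl] := htl.
(* A root at [y] when it is inside the same edge; otherwise the function already vanishes at [y],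
   being 0 at the vertices and off [e]. *)
pose q : {poly R} := if y is inr u' then (if (sval u').1 == e then 'X - (sval u').2%:P else 1) else 1.
pose Q e' : {poly R} :=
  if e' == e then ('X - 0%:P) ^+ p * (('X - (len e)%:P) ^+ p * q) else 0.
have Qflat e' k : (k < p)%N -> ((Q e')^`(k)).[0] = 0 /\ ((Q e')^`(k)).[len e'] = 0.
  move=> kp; rewrite /Q; case: eqP => [->|_]; last by rewrite linear0 !horner0.
  split; first exact: derivn_XsubC_exp_root.
  by rewrite mulrCA derivn_XsubC_exp_root.
pose f := piecewise_poly (fun _ => 0) Q; exists f; split.
  apply: piecewise_poly_spaceF => //.
  - by move=> e'; have [+ _] := Qflat e' 0%N p0; rewrite derivn0.
  - by move=> e'; have [_ +] := Qflat e' 0%N p0; rewrite derivn0.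
  - by move=> e' k _; exact: Qflat.
  - by rewrite big1.
have fy : f y = 0.
  rewrite /f /Q /q; case: y uy q Q Qflat f => [//|[[e' t'] /= h']] uy.
  by case: eqP => _ *; rewrite !hornerE//= subrr mulr0.
rewrite fy /f /= /Q eqxx !hornerE !mulf_neq0 ?expf_neq0 ?subr_eq0//.
- by rewrite gt_eqF.
- by rewrite lt_eqF.
- rewrite /q; case: y uy q Q Qflat f fy => [v|[[e' t'] /= h']] uy *.
    by rewrite hornerE oner_eq0.
  case: (e' =P e) => [ee|_]; last by rewrite hornerE oner_eq0.
  rewrite !hornerE subr_eq0; apply/eqP => tt; apply: uy; congr inr.
  by apply: val_inj; rewrite /= ee tt.
Qed.

Lemma spaceF_separates (x y : gpoint G) : x <> y -> exists f, spaceF p f /\ f x != f y.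
Proof.
case: x y => [v|u] [w|u'] xy; last 2 first.
- exact: spaceF_separates_interior.
- exact: spaceF_separates_interior.
- have vw : w != v by apply/eqP => wv; apply: xy; rewrite wv.
  have /choice[S HS] : forall e : edge G, exists S : {poly R},
    [/\ S.[0] = 0, S.[len e] = 1 & forall k, (0 < k)%N -> (k < p)%N ->
     (S^`(k)).[0] = 0 /\ (S^`(k)).[len e] = 0].
    by move=> e; apply: flat_step => //; rewrite gt_eqF// len_gt0.
  (* Opposite values at [v] and [w] meet the constraint that the vertex values sum to 0. *)
  pose a u : R := if u == v then 1 else if u == w then -1 else 0.
  pose Q e := (a (src e))%:P + (a (tgt e) - a (src e)) *: S e.
  exists (piecewise_poly a Q); split.
    apply: piecewise_poly_spaceF => //.
    + by move=> e; have [S0 _ _] := HS e; rewrite /Q !hornerE S0 mulr0 addr0.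
    + by move=> e; have [_ S1 _] := HS e; rewrite /Q !hornerE S1 mulr1 addrC subrK.
    + move=> e k k0 kp; have [_ _ /(_ k k0 kp)[h1 h2]] := HS e.
      by rewrite /Q derivnD derivnC (gtn_eqF k0) add0r derivnZ !hornerZ h1 h2 mulr0.
    + rewrite (bigD1 v)//= (bigD1 w)//= big1 ?addr0.
        by rewrite /a eqxx (negbTE vw) eqxx subrr.
      by move=> u /andP[uv uw]; rewrite /a (negbTE uv) (negbTE uw).
  rewrite /= /a eqxx (negbTE vw) eqxx -subr_eq0 opprK; apply/eqP; lra.
- have [|f [fF fxy]] := @spaceF_separates_interior u' (inl v); first exact/nesym.
  by exists f; split=> //; rewrite eq_sym.
Qed.

End Separation.

Theorem theorem3p1 (R : realType) (G : metricGraph R) (p : nat)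
    (K : gpoint G -> gpoint G -> R)
    (d : measure_display) (Omega : measurableType d) (P : probability Omega R)
    (Z : gpoint G -> {RV P >-> R}) :
  (1 <= p)%N ->
  reproducing_kernel (spaceF (G := G) p) (innerF (G := G) p) K ->
  centred_gaussian_process Z K ->
  let d_p := fun x y : gpoint G => Num.sqrt (variogram Z x y) in
  is_distance d_p /\
  (forall psi : R -> R,
     completely_monotonic psi -> nonconstant_on_nonneg psi ->
     let C_Y := fun x y : gpoint G => psi (d_p x y ^+ 2) in
     strictly_positive_definite C_Y /\
     ((2 <= p)%N ->
      (exists l : R, derive1n p.-1 psi t @[t --> 0^'+] --> l) ->
      forall (d' : measure_display) (Omega' : measurableType d')
             (P' : probability Omega' R) (Y : gpoint G -> {RV P' >-> R}),
        centred_gaussian_process Y C_Y ->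
        ms_C_graph 1 p.-1 Y)).
Proof.
move=> p0 rK [_ EZ CZ] d_p; have [z [zZ zK]] := centred_covariance_L2 EZ CZ.
have dE x y : d_p x y = sinorm (z x - z y).
  by rewrite /d_p (variogramE _ _ EZ zZ) sqrtr_sqr ger0_norm// sinorm_ge0.
have z_inj x y : sinorm (z x - z y) = 0 -> x = y.
  move=> zxy; apply: contrapT => /(spaceF_separates p0)[f [fF /eqP]]; apply.
  have [KF Kf] := rK; rewrite -(Kf f x fF) -(Kf f y fF); congr innerF.
  apply/funext => w; apply/eqP; rewrite -subr_eq0 -normr_le0 -!zK -ipBl.
  by rewrite (le_trans (ip_le _ _))// zxy mul0r.
split.
  split=> [x y|x y|x y|x y w]; rewrite !dE.
  - exact: sinorm_ge0.
  - by split=> [|->]; [exact: z_inj|rewrite subrr sinorm0].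
  - exact: sinormBC.
  - exact: sinormB_le.
move=> psi cm nc C_Y; split.
  split=> [x y|n x a x_inj a0]; first by rewrite /C_Y !dE sinormBC.
  rewrite /C_Y; apply: (cm_strictly_positive cm nc) => //.
  - by move=> i j; exact: sqr_ge0.
  - move=> i j; rewrite sqrf_eq0 dE; apply/eqP/eqP => [/z_inj/x_inj//|->].
    by rewrite subrr sinorm0.
  - move=> s s01; under eq_bigr do under eq_bigr do rewrite dE.
    apply: gaussian_kernel_strict => // i j; apply: contra_neq => /z_inj/x_inj//.
move=> p1 plim d' Omega' P' Y [_ EY CY].
have [y [yY yE]] := centred_covariance_L2 EY CY.
apply: (ms_C_graph_cm p1 rK (@L2_complete _ _ _ P) zK cm plim yY).
by move=> x x'; rewrite yE /C_Y dE.
Qed.
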